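(* Let $\xi$ be a centered real random variable with unit variance and finite fourth moment, and for each $n$ let $W_n$ be an $n\times n$ real symmetric random matrix whose entries above the main diagonal are iid copies of $\xi$ (all matrices defined on a common probability space). Fix any sequence of positive integers $d=d(n)$ with $d(n)=O(\log n)$, $d(n)\to\infty$, and $n\,d(n)$ even for every $n$. Then there exists a sequence of non-random $d$-regular (simple) graphs on $n$ vertices with adjacency matrices $A_n$ such that $$\mathbb{P}\Big(\liminf_{n\to\infty}\Big\|\tfrac{1}{\sqrt{d}}A_n\circ W_n\Big\|>2\Big)=1,$$ where $\circ$ is the entrywise (Hadamard) product and $\|\cdot\|$ the spectral norm.
   Context: Since $A_n$ is the adjacency matrix of a simple graph its diagonal is zero, so the diagonal entries of $W_n$ play no role.
   Formalization: The graphs are required to be simple and d(n)-regular only for all sufficiently large n, since a d(n)-regular simple graph on n vertices cannot exist when d(n) ≥ n (for example n = 1, where d(1) ≥ 1). *)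

(* Defs.v *)
From HB Require Import structures.
From mathcomp Require Import all_boot all_order all_algebra.
From mathcomp Require Import all_classical all_reals all_analysis.
Set Implicit Arguments. Unset Strict Implicit. Unset Printing Implicit Defensive.
Import Order.TTheory GRing.Theory Num.Theory.
Local Open Scope classical_set_scope.
Local Open Scope ring_scope.

Definition simple_graph (n : nat) (e : rel 'I_n) : Prop :=
  (forall i j, e i j = e j i) /\ (forall i, e i i = false).

Definition regular (n : nat) (e : rel 'I_n) (k : nat) : Prop :=
  forall i, #|[set j | e i j]| = k.

Definition adjmx (R : realType) (n : nat) (e : rel 'I_n) : 'M[R]_n :=
  \matrix_(i, j) (e i j)%:R.

Definition hadamard (R : realType) (m n : nat) (A B : 'M[R]_(m, n)) : 'M[R]_(m, n) :=
  \matrix_(i, j) (A i j * B i j).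

Definition vnorm2 (R : realType) (n : nat) (x : 'cV[R]_n) : R :=
  Num.sqrt (\sum_i (x i 0) ^+ 2).

Definition spec_norm (R : realType) (n : nat) (M : 'M[R]_n) : R :=
  sup [set r | exists x : 'cV[R]_n, vnorm2 x <= 1 /\ r = vnorm2 (M *m x)].

Definition mutually_independent d (T : measurableType d) (R : realType)
  (P : probability T R) (I : finType) (A : {set I}) (X : I -> T -> R) : Prop :=
  forall (S : {set I}), S \subset A ->
  forall B : I -> set R, (forall i, measurable (B i)) ->
  P [set w | forall i, i \in S -> B i (X i w)] =
  (\prod_(i in S) P (X i @^-1` B i))%E.

Definition same_law d (T : measurableType d) (R : realType)
  (P : probability T R) (X Y : T -> R) : Prop :=
  forall B : set R, measurable B -> P (X @^-1` B) = P (Y @^-1` B).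

(* Main.v *)
(** The graph is a disjoint union of about [n/(d+1)] cliques on [d+1] vertices,
    completed by a circulant [d]-regular graph on the remaining vertices. For every
    [c > 0] there is [eps > 0] such that the normalized weighted clique has norm
    above [2 + eps] with probability at least [exp (- c d)]. The cliques are
    independent and [d = O(log n)], so for [c] small the probability that they all
    fail is [O(n^-2)], and Borel-Cantelli applies.

    For a single clique, split the vertices into [N = L^3] parts and let the entry
    [v_x] of the test vector be a combination, over [k <= L], of the weighted
    numbers of paths of length [k] from [x] visiting pairwise distinct parts. The
    edges between distinct parts alone give a Rayleigh quotient [2 - O(L^-2)] in mean.
    No edge inside a part enters [v] at the vertices of that part, so the law of these
    edges can be tilted by factors [1 + tau z] with [tau] of the sign of [v_x v_y];
    this adds a term of order [L^(-3/2)], which beats the loss, while the second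
    moment of the density is at most [exp (c d)]. By Cauchy-Schwarz, a positive mean
    under the tilted law becomes a lower bound for a probability under the original law.

    The computation takes place on a finite product space: entries are truncated at
    [kappa sqrt d] and rounded. As the fourth moment is finite, truncation affects an
    entry with probability [O(d^-2)], and a clique has only [O(d^2)] entries. *)
Require Import Defs.
From HB Require Import structures.
From mathcomp Require Import all_boot all_order all_algebra.
From mathcomp Require Import all_classical all_reals all_analysis.
From mathcomp Require Import measurable_realfun ring lra zify.
Import Order.TTheory GRing.Theory Num.Theory.
Local Open Scope classical_set_scope.
Local Open Scope ring_scope.
Set Implicit Arguments.
Unset Strict Implicit.
Unset Printing Implicit Defensive.

(** * Finite product spaces and tilted laws *)

(** The exponents come from a scaling. With [m ~ d / N] vertices per part there are about
    [d ^ 2 / (2 N)] edges inside parts, so tilting them by [tau] costs a second moment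
    [exp (O (d ^ 2 tau ^ 2 / N))]. A budget [exp (O (r ^ 2 d))] allows [tau ~ r sqrt (N / d)], and a
    vertex then gains [m tau ~ r sqrt (d / N)]. Relative to [sqrt d] the losses are [L ^ -2], from
    cutting off the path length, and [L / N], from the parts already visited. They balance at
    [N = L ^ 3], where the gain wins by a factor of order [r sqrt L], however small [r] is. A
    density with factors [1 + tau z] must be nonnegative; as [tau ~ 1 / sqrt d], this forces
    truncation at a multiple of [sqrt d]. The tilt follows the sign of [v_x v_y], so the gain is
    governed by the mean of [|v_x v_y|] and not by a second moment. For [x], [y] in one part, [v_x]
    and [v_y] are linear forms in disjoint sets of edges with the same coefficients, and their
    second and fourth moments bound this mean from below. *)

Section FiniteProduct.
Context (R : realType) (I V : finType).
Implicit Types (p : I -> V -> R) (F G : {ffun I -> V} -> R) (i : I).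

Definition upd (w : {ffun I -> V}) i v : {ffun I -> V} :=
  [ffun j => if j == i then v else w j].

Definition wt p (w : {ffun I -> V}) : R := \prod_i p i (w i).

Definition Ex p F : R := \sum_w wt p w * F w.

(** Conditional expectation given all coordinates other than [i], taken under [p i]. *)
Definition avg p i F (w : {ffun I -> V}) : R := \sum_v p i v * F (upd w i v).

Definition ign (T : Type) i (F : {ffun I -> V} -> T) : Prop :=
  forall w v, F (upd w i v) = F w.

Definition law p : Prop := (forall i v, 0 <= p i v) /\ (forall i, \sum_v p i v = 1).

Lemma upd_at w i v : upd w i v i = v.
Proof. by rewrite ffunE eqxx. Qed.

Lemma upd_ne w i j v : j != i -> upd w i v j = w j.
Proof. by move=> ji; rewrite ffunE (negbTE ji). Qed.

Lemma upd_upd w i v v' : upd (upd w i v) i v' = upd w i v'.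
Proof. by apply/ffunP => j; rewrite !ffunE; case: eqP. Qed.

Lemma upd_id w i : upd w i (w i) = w.
Proof. by apply/ffunP => j; rewrite !ffunE; case: eqP => // ->. Qed.

Lemma upd_comm w i j v v' : i != j -> upd (upd w i v) j v' = upd (upd w j v') i v.
Proof.
move=> ij; apply/ffunP => k; rewrite !ffunE.
by case: (k =P j) => [->|//]; rewrite eq_sym (negbTE ij).
Qed.

Lemma wt_ge0 p w : law p -> 0 <= wt p w.
Proof. by case=> p0 _; apply: prodr_ge0 => i _. Qed.

Lemma ExD p F G : Ex p (fun w => F w + G w) = Ex p F + Ex p G.
Proof. by rewrite -big_split; apply: eq_bigr => w _; rewrite /= mulrDr. Qed.

Lemma ExZ p a F : Ex p (fun w => a * F w) = a * Ex p F.
Proof. by rewrite mulr_sumr; apply: eq_bigr => w _; rewrite mulrCA. Qed.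

Lemma ExB p F G : Ex p (fun w => F w - G w) = Ex p F - Ex p G.
Proof. by rewrite -sumrB; apply: eq_bigr => w _; rewrite /= mulrBr. Qed.

Lemma Ex_sum (J : Type) (s : seq J) (Q : pred J) p (F : J -> {ffun I -> V} -> R) :
  Ex p (fun w => \sum_(j <- s | Q j) F j w) = \sum_(j <- s | Q j) Ex p (F j).
Proof. by rewrite /Ex exchange_big; apply: eq_bigr => w _; rewrite mulr_sumr. Qed.

Lemma eq_Ex p F G : F =1 G -> Ex p F = Ex p G.
Proof. by move=> FG; apply: eq_bigr => w _; rewrite FG. Qed.

Lemma le_Ex p F G : law p -> (forall w, F w <= G w) -> Ex p F <= Ex p G.
Proof. by move=> lp FG; apply: ler_sum => w _; rewrite ler_wpM2l // wt_ge0. Qed.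

Lemma Ex_ge0 p F : law p -> (forall w, 0 <= F w) -> 0 <= Ex p F.
Proof. by move=> lp F0; apply: sumr_ge0 => w _; rewrite mulr_ge0 // wt_ge0. Qed.

(** Resampling one coordinate: pairs of a configuration and a spare value are permuted by the
    involution that exchanges the coordinate [j] with the spare value. Afterwards the spare value
    has law [p j], whose total mass 1 makes it disappear. *)
Lemma Ex_replace p q j F : law p -> (forall i, i != j -> p i =1 q i) ->
  Ex q F = Ex p (avg q j F).
Proof.
move=> [_ p1] pq; rewrite /Ex /avg.
under [RHS]eq_bigr do rewrite mulr_sumr.
rewrite pair_bigA /=.
pose h (x : {ffun I -> V} * V) := (upd x.1 j x.2, x.1 j).
have hK : involutive h.
  by move=> [w v]; rewrite /h /= upd_at upd_upd upd_id.
rewrite (reindex_inj (inv_inj hK)) /=.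
transitivity (\sum_(k : {ffun I -> V} * V) wt q k.1 * F k.1 * p j k.2); last first.
  apply: eq_bigr => -[w v] _ /=; rewrite upd_upd upd_id /wt.
  rewrite (bigD1 j) //= [in RHS](bigD1 j) //= upd_at.
  rewrite [X in _ = _ * X * _](eq_bigr (fun i => q i (w i))); first by ring.
  by move=> i ij; rewrite upd_ne // pq.
rewrite -(pair_bigA _ (fun w v => wt q w * F w * p j v)) /=.
by apply: eq_bigr => w _; rewrite -mulr_sumr p1 mulr1.
Qed.

Lemma Ex_avg p i F : law p -> Ex p (avg p i F) = Ex p F.
Proof. by move=> lp; rewrite -(Ex_replace (q := p)). Qed.

Lemma avg_ign p i F : law p -> ign i F -> avg p i F =1 F.
Proof.
move=> [_ p1] iF w; rewrite /avg (eq_bigr (fun v => p i v * F w)).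
  by rewrite -mulr_suml p1 mul1r.
by move=> v _; rewrite iF.
Qed.

Lemma Ex_cst p a : law p -> Ex p (fun=> a) = a.
Proof.
move=> [p0 p1]; rewrite /Ex -mulr_suml /wt.
by rewrite -(bigA_distr_bigA p) /= big1 ?mul1r // => i _; rewrite p1.
Qed.

Lemma Ex_coord p i (phi : V -> R) F : law p -> ign i F ->
  Ex p (fun w => phi (w i) * F w) = (\sum_v p i v * phi v) * Ex p F.
Proof.
move=> lp iF; rewrite -(Ex_avg i) // -ExZ; apply: eq_Ex => w.
rewrite /avg mulr_suml; apply: eq_bigr => v _.
by rewrite upd_at iF mulrA.
Qed.

Lemma ign_cst (T : Type) i (a : T) : ign i (fun=> a).
Proof. by []. Qed.

Lemma ign_coord (T : Type) i j (phi : V -> T) : j != i -> ign i (fun w => phi (w j)).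
Proof. by move=> ji w v; rewrite upd_ne. Qed.

Lemma ign_comp (T U : Type) i (h : T -> U) (F : {ffun I -> V} -> T) :
  ign i F -> ign i (fun w => h (F w)).
Proof. by move=> iF w v; rewrite iF. Qed.

Lemma ign_mul i F G : ign i F -> ign i G -> ign i (fun w => F w * G w).
Proof. by move=> iF iG w v; rewrite iF iG. Qed.

Lemma ign_add i F G : ign i F -> ign i G -> ign i (fun w => F w + G w).
Proof. by move=> iF iG w v; rewrite iF iG. Qed.

Lemma ign_exp i n F : ign i F -> ign i (fun w => F w ^+ n).
Proof. by move=> iF w v; rewrite iF. Qed.

Lemma ign_inv i F : ign i F -> ign i (fun w => (F w)^-1).
Proof. by move=> iF w v; rewrite iF. Qed.

Lemma ign_sum (J : eqType) (s : seq J) (Q : pred J) i (F : J -> {ffun I -> V} -> R) :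
  (forall j, j \in s -> Q j -> ign i (F j)) -> ign i (fun w => \sum_(j <- s | Q j) F j w).
Proof.
move=> iF w v; rewrite big_seq_cond [RHS]big_seq_cond.
by apply: eq_bigr => j /andP[js Qj]; rewrite iF.
Qed.

Lemma ign_prod (J : eqType) (s : seq J) (Q : pred J) i (F : J -> {ffun I -> V} -> R) :
  (forall j, j \in s -> Q j -> ign i (F j)) -> ign i (fun w => \prod_(j <- s | Q j) F j w).
Proof.
move=> iF w v; rewrite big_seq_cond [RHS]big_seq_cond.
by apply: eq_bigr => j /andP[js Qj]; rewrite iF.
Qed.

(* Averaging over the coordinates of [s] leaves [F] unchanged and turns [G] into a constant. *)
Lemma Ex_indep p (s : {set I}) F G : law p ->
  (forall i, i \in s -> ign i F) -> (forall i, i \notin s -> ign i G) ->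
  Ex p (fun w => F w * G w) = Ex p F * Ex p G.
Proof.
move=> lp iF iG.
have key (t : seq I) : {subset t <= s} -> exists H, [/\ Ex p (fun w => F w * H w) = Ex p (fun w => F w * G w),
    Ex p H = Ex p G & forall i, i \notin s \/ i \in t -> ign i H].
  elim: t => [|j t IH] ts.
    by exists G; split=> // i [|//]; exact: iG.
  have [|H [H1 H2 H3]] := IH; first by move=> i it; apply: ts; rewrite inE it orbT.
  have js : j \in s by apply: ts; rewrite inE eqxx.
  exists (avg p j H); split.
  - rewrite -H1 -[RHS](Ex_avg j) //; apply: eq_Ex => w.
    by rewrite mulr_sumr; apply: eq_bigr => v _; rewrite iF // mulrCA.
  - by rewrite Ex_avg.
  - move=> i iH w v; rewrite /avg; apply: eq_bigr => v' _.
    case: (eqVneq i j) => [->|ij]; first by rewrite upd_upd.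
    rewrite upd_comm // H3 //; case: iH; first by left.
    by rewrite inE (negbTE ij) /=; right.
have [|H [H1 H2 H3]] := key (enum s); first by move=> i; rewrite mem_enum.
have iH i : ign i H.
  by apply: H3; rewrite mem_enum; case: (i \in s); [right | left].
have cH w w' : H w = H w'.
  have aux (t : seq I) : H [ffun i => if i \in t then w' i else w i] = H w.
    elim: t => [|j t IH]; first by congr H; apply/ffunP => i; rewrite ffunE.
    rewrite -IH -[RHS](iH j _ (w' j)); congr H; apply/ffunP => i; rewrite !ffunE inE.
    by have [->|] := eqVneq i j.
  rewrite -(aux (enum I)); congr H; apply/ffunP => i; by rewrite ffunE mem_enum.
case: (pickP {ffun I -> V}) => [w0 _|no]; last first.
  by rewrite /Ex !big1 ?mul0r // => w _; have := no w.
rewrite -H1 -H2.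
have E : Ex p H = H w0.
  by rewrite -[RHS](Ex_cst (p := p)) //; apply: eq_Ex => w; exact: cH.
rewrite E [RHS]mulrC -ExZ; apply: eq_Ex => w.
by rewrite mulrC (cH w w0).
Qed.

(** Hybrid argument: the coordinates switch from [p] to [q] one at a time. A coordinate of [s] costs
    a factor [t]; any other costs nothing, since averaging a function over a coordinate that it
    ignores changes nothing. *)
Lemma Ex_dominated p q (t : R) (s : {set I}) F : law p -> law q -> 0 <= t ->
  (forall i v, t * p i v <= q i v) -> (forall w, 0 <= F w) ->
  (forall i, i \notin s -> ign i F) -> t ^+ #|s| * Ex p F <= Ex q F.
Proof.
move=> lp lq t0 pq F0 iF.
pose r (u : seq I) i := if i \in u then q i else p i.
have lr u : law (r u).
  by split=> [i v|i]; rewrite /r; case: ifP => _; [case: lq|case: lp|case: lq|case: lp].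
have key (u : seq I) : uniq u -> t ^+ count (fun i => i \in s) u * Ex p F <= Ex (r u) F.
  elim: u => [|j u IH]; first by rewrite expr0 mul1r.
  case/andP => ju /IH {}IH; rewrite (Ex_replace (p := r u) (q := r (j :: u)) (j := j)) //; last first.
    by move=> i ij v; rewrite /r in_cons (negbTE ij).
  have [js|js] := boolP (j \in s); last first.
    rewrite /= (negbTE js) add0n (le_trans IH) // le_eqVlt; apply/orP; left; apply/eqP.
    by apply: eq_Ex => w; rewrite avg_ign //; exact: iF.
  rewrite /= js exprS -mulrA; apply: le_trans (ler_wpM2l t0 IH) _.
  rewrite -ExZ -[leLHS](Ex_avg j) //; apply: le_Ex => // w; apply: ler_sum => v _.
  by rewrite mulrCA mulrA ler_wpM2r // /r mem_head (negbTE ju).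
have := key (enum I) (enum_uniq _).
have -> : count (fun i => i \in s) (enum I) = #|s|.
  by rewrite -size_filter enumT cardE /enum_mem.
suff -> : Ex (r (enum I)) F = Ex q F by [].
apply: eq_bigr => w _; congr (_ * _); apply: eq_bigr => i _.
by rewrite /r mem_enum.
Qed.

End FiniteProduct.

(** * Moments of linear forms with random coefficients, and their tilts *)

Section LinearForms.
Context (R : realType) (I V : finType) (p : I -> V -> R) (val : V -> R).
Context (J : eqType) (c : J -> I) (s2 K4 : R).
Hypothesis lp : law p.
Implicit Types (F : {ffun I -> V} -> R) (a : J -> {ffun I -> V} -> R) (s : seq J).

Definition standard (i : I) : Prop :=
  [/\ \sum_v p i v * val v = 0, \sum_v p i v * val v ^+ 2 = s2
    & \sum_v p i v * val v ^+ 4 <= K4].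

(** The coefficients [a j] are random, but in use they ignore all coordinates [c k] with [k] in [s].
    Conditionally on the other coordinates, [linf] is then a linear form in independent centered
    variables, and [sqf] is the squared norm of its coefficients. *)
Definition linf s a (w : {ffun I -> V}) : R := \sum_(j <- s) val (w (c j)) * a j w.
Definition sqf s a (w : {ffun I -> V}) : R := \sum_(j <- s) a j w ^+ 2.
(** Density of a change of law that moves the conditional mean of [val (w (c j))] from 0 to
    [s2 * a j w]. *)
Definition tilt s a (w : {ffun I -> V}) : R := \prod_(j <- s) (1 + a j w * val (w (c j))).

Lemma Ex_val1 i F : standard i -> ign i F -> Ex p (fun w => val (w i) * F w) = 0.
Proof. by move=> [m1 _ _] iF; rewrite (Ex_coord val) // m1 mul0r. Qed.

Lemma Ex_val2 i F : standard i -> ign i F ->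
  Ex p (fun w => val (w i) ^+ 2 * F w) = s2 * Ex p F.
Proof. by move=> [_ m2 _] iF; rewrite (Ex_coord (fun v => val v ^+ 2)) // m2. Qed.

Lemma Ex_val4 i F : standard i -> ign i F -> (forall w, 0 <= F w) ->
  Ex p (fun w => val (w i) ^+ 4 * F w) <= K4 * Ex p F.
Proof.
move=> [_ _ m4] iF F0; rewrite (Ex_coord (fun v => val v ^+ 4)) //.
by rewrite ler_wpM2r // Ex_ge0.
Qed.

Definition wellposed s : Prop :=
  [/\ uniq s, {in s &, injective c} & forall j, j \in s -> standard (c j)].

Definition igns (T : Type) s (F : {ffun I -> V} -> T) : Prop :=
  forall j, j \in s -> ign (c j) F.

Lemma wellposed_cons j s : wellposed (j :: s) ->
  [/\ wellposed s, standard (c j) & forall k, k \in s -> c k != c j].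
Proof.
move=> [/= /andP[js us] ic st]; split; last 2 first.
- by apply: st; rewrite mem_head.
- move=> k ks; apply/eqP => /ic; rewrite !inE ks eqxx orbT => /(_ isT isT) kj.
  by rewrite kj (negbTE js) in ks.
split=> //; first by move=> k l ks ls; apply: ic; rewrite inE ?ks ?ls orbT.
by move=> k ks; apply: st; rewrite inE ks orbT.
Qed.

Lemma igns_cons (T : Type) j s (F : {ffun I -> V} -> T) :
  igns (j :: s) F -> ign (c j) F /\ igns s F.
Proof.
move=> h; split; first by apply: h; rewrite mem_head.
by move=> k ks; apply: h; rewrite inE ks orbT.
Qed.

Lemma linf_ign i s a : (forall k, k \in s -> c k != i) ->
  (forall k, k \in s -> ign i (a k)) -> ign i (linf s a).
Proof.
move=> ne ia; apply: ign_sum => k ks _; apply: ign_mul; last exact: ia.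
by apply: ign_coord; exact: ne.
Qed.

Lemma Ex_linf1 s a F : wellposed s -> (forall j, j \in s -> igns s (a j)) ->
  igns s F -> Ex p (fun w => linf s a w * F w) = 0.
Proof.
move=> [_ _ st] ia iF.
rewrite (eq_Ex p (G := fun w => \sum_(j <- s) val (w (c j)) * (a j w * F w))); last first.
  by move=> w; rewrite mulr_suml; apply: eq_bigr => j _; rewrite mulrA.
rewrite Ex_sum big_seq big1 // => j js; apply: Ex_val1; first exact: st.
by apply: ign_mul; [exact: ia | exact: iF].
Qed.

Lemma Ex_linf2 s a F : wellposed s -> (forall j, j \in s -> igns s (a j)) ->
  igns s F -> Ex p (fun w => linf s a w ^+ 2 * F w) = s2 * Ex p (fun w => sqf s a w * F w).
Proof.
elim: s F => [|j s IH] F ws ia iF.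
  by rewrite -ExZ; apply: eq_Ex => w; rewrite /linf /sqf !big_nil expr0n /= !mul0r mulr0.
have [ws' sj ne] := wellposed_cons ws.
have [iFj iFs] := igns_cons iF.
have [iaj iajs] : ign (c j) (a j) /\ igns s (a j) by apply: igns_cons; apply: ia; rewrite mem_head.
have iak k : k \in s -> ign (c j) (a k) /\ igns s (a k).
  by move=> ks; apply: igns_cons; apply: ia; rewrite inE ks orbT.
have iX : ign (c j) (linf s a) by apply: linf_ign => // k /iak[].
rewrite (eq_Ex p (G := fun w => (val (w (c j)) ^+ 2 * (a j w ^+ 2 * F w) +
   val (w (c j)) * (2 * a j w * linf s a w * F w)) + linf s a w ^+ 2 * F w)); last first.
  by move=> w; rewrite /linf big_cons; ring.
rewrite !ExD Ex_val2 //; last by apply: ign_mul => //; exact: ign_exp.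
rewrite Ex_val1 //; last by do !apply: ign_mul.
rewrite IH //; last by move=> k /iak[].
rewrite addr0 -mulrDr -ExD; congr (_ * _); apply: eq_Ex => w.
by rewrite /sqf big_cons mulrDl.
Qed.

(** In the expansion of [(u + X) ^ 4], with [u] the new term, both odd products vanish: [u X ^ 3]
    because [u] is centered, [u ^ 3 X] because [X] is, so no third moment enters. The assumption on
    [K4] bounds [6 * s2 ^ 2] by [2 * K4], which completes the square of [sqf]. *)
Lemma Ex_linf4 s a F : 0 <= s2 -> 3 * s2 ^+ 2 <= K4 -> wellposed s ->
  (forall j, j \in s -> igns s (a j)) -> igns s F -> (forall w, 0 <= F w) ->
  Ex p (fun w => linf s a w ^+ 4 * F w) <= K4 * Ex p (fun w => sqf s a w ^+ 2 * F w).
Proof.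
move=> s20 sK; elim: s F => [|j s IH] F ws ia iF F0.
  rewrite -ExZ; apply: le_Ex => // w; rewrite /linf /sqf !big_nil !expr0n /=; lra.
have [ws' sj ne] := wellposed_cons ws.
have [iFj iFs] := igns_cons iF.
have [iaj iajs] : ign (c j) (a j) /\ igns s (a j) by apply: igns_cons; apply: ia; rewrite mem_head.
have iak k : k \in s -> ign (c j) (a k) /\ igns s (a k).
  by move=> ks; apply: igns_cons; apply: ia; rewrite inE ks orbT.
have ias k : k \in s -> igns s (a k) by move=> /iak[].
have iX : ign (c j) (linf s a) by apply: linf_ign => // k /iak[].
have iexp k n : ign k (a j) -> ign k (fun w => a j w ^+ n).
  exact: ign_exp.
have iXexp n : ign (c j) (fun w => linf s a w ^+ n).
  exact: ign_exp.
rewrite (eq_Ex p (G := fun w => val (w (c j)) ^+ 4 * (a j w ^+ 4 * F w) +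
   (4 * (val (w (c j)) ^+ 3 * (linf s a w * (a j w ^+ 3 * F w))) +
   (6 * (val (w (c j)) ^+ 2 * (linf s a w ^+ 2 * (a j w ^+ 2 * F w))) +
   (val (w (c j)) * (4 * a j w * linf s a w ^+ 3 * F w) +
    linf s a w ^+ 4 * F w))))); last first.
  by move=> w; rewrite /linf big_cons; ring.
rewrite !ExD !ExZ.
rewrite (Ex_coord (fun v => val v ^+ 3)) //; last by do !apply: ign_mul => //; exact: iexp.
rewrite (Ex_linf1 ws' ias); last by move=> k ks; apply: ign_mul; [apply: iexp; exact: iajs|exact: iFs].
rewrite (@Ex_val1 (c j)) //; last by do !apply: ign_mul.
rewrite Ex_val2 //; last by do !apply: ign_mul => //; exact: iexp.
rewrite (Ex_linf2 ws' ias); last by move=> k ks; apply: ign_mul; [apply: iexp; exact: iajs|exact: iFs].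
have aF0 n w : 0 <= a j w ^+ n.*2 * F w by rewrite mulr_ge0 // -mul2n exprM exprn_ge0 // sqr_ge0.
have := @Ex_val4 (c j) (fun w => a j w ^+ 4 * F w) sj _ (aF0 2%N).
move=> /(_ (ign_mul (iexp _ _ iaj) iFj)) H4.
have {}IH := IH F ws' ias iFs F0.
rewrite mulr0 mulr0 !add0r.
apply: le_trans (lerD H4 (lerD (_ : _ <= 2 * K4 * Ex p (fun w => sqf s a w * (a j w ^+ 2 * F w))) IH)) _.
  rewrite !mulrA ler_wpM2r //; last by lra.
  apply: Ex_ge0 => // w; rewrite mulr_ge0 ?(aF0 1%N) //.
  by apply: sumr_ge0 => k _; exact: sqr_ge0.
rewrite mulrAC -!ExZ mulrC -!ExZ -!ExD; apply: le_Ex => // w.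
rewrite /sqf big_cons le_eqVlt; apply/orP; left; apply/eqP; ring.
Qed.

Lemma tilt_ign i s a : (forall k, k \in s -> c k != i) ->
  (forall k, k \in s -> ign i (a k)) -> ign i (tilt s a).
Proof.
move=> ne ia; apply: ign_prod => k ks _; apply: ign_add; first exact: ign_cst.
by apply: ign_mul; [exact: ia | apply: ign_coord; exact: ne].
Qed.

Lemma Ex_tilt s a F : wellposed s -> (forall j, j \in s -> igns s (a j)) ->
  igns s F -> Ex p (fun w => tilt s a w * F w) = Ex p F.
Proof.
elim: s F => [|j s IH] F ws ia iF.
  by apply: eq_Ex => w; rewrite /tilt big_nil mul1r.
have [ws' sj ne] := wellposed_cons ws.
have [iFj iFs] := igns_cons iF.
have [iaj iajs] : ign (c j) (a j) /\ igns s (a j) by apply: igns_cons; apply: ia; rewrite mem_head.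
have iak k : k \in s -> ign (c j) (a k) /\ igns s (a k).
  by move=> ks; apply: igns_cons; apply: ia; rewrite inE ks orbT.
have iX : ign (c j) (tilt s a) by apply: tilt_ign => // k /iak[].
rewrite (eq_Ex p (G := fun w => tilt s a w * F w + val (w (c j)) * (a j w * tilt s a w * F w))); last first.
  by move=> w; rewrite /tilt big_cons; ring.
rewrite ExD Ex_val1 //; last by do !apply: ign_mul.
by rewrite addr0 IH // => k /iak[].
Qed.

Lemma Ex_tilt2 s a F (b : R) : 0 <= s2 -> (forall j w, a j w ^+ 2 <= b) -> wellposed s ->
  (forall j, j \in s -> igns s (a j)) -> igns s F -> (forall w, 0 <= F w) ->
  Ex p (fun w => tilt s a w ^+ 2 * F w) <= (1 + b * s2) ^+ size s * Ex p F.
Proof.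
move=> s20 ab; elim: s F => [|j s IH] F ws ia iF F0.
  rewrite expr0 mul1r; apply: le_Ex => // w; rewrite /tilt big_nil; lra.
have [ws' sj ne] := wellposed_cons ws.
have [iFj iFs] := igns_cons iF.
have [iaj iajs] : ign (c j) (a j) /\ igns s (a j) by apply: igns_cons; apply: ia; rewrite mem_head.
have iak k : k \in s -> ign (c j) (a k) /\ igns s (a k).
  by move=> ks; apply: igns_cons; apply: ia; rewrite inE ks orbT.
have iX : ign (c j) (tilt s a) by apply: tilt_ign => // k /iak[].
have iX2 : ign (c j) (fun w => tilt s a w ^+ 2) by exact: ign_exp.
have ia2 : ign (c j) (fun w => a j w ^+ 2) by exact: ign_exp.
rewrite (eq_Ex p (G := fun w => tilt s a w ^+ 2 * F w + (val (w (c j)) * (2 * a j w * tilt s a w ^+ 2 * F w)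
  + val (w (c j)) ^+ 2 * (a j w ^+ 2 * tilt s a w ^+ 2 * F w)))); last first.
  by move=> w; rewrite /tilt big_cons; ring.
rewrite !ExD Ex_val1 //; last by do !apply: ign_mul.
rewrite Ex_val2 //; last by do !apply: ign_mul.
rewrite add0r; apply: le_trans (_ : (1 + b * s2) * Ex p (fun w => tilt s a w ^+ 2 * F w) <= _).
  rewrite mulrDl mul1r lerD2l mulrAC [leRHS]mulrC ler_wpM2l // -ExZ; apply: le_Ex => // w.
  by rewrite -mulrA ler_wpM2r // mulr_ge0 // sqr_ge0.
(* The sign of [b] is read off at some configuration; one exists because the total mass is 1. *)
have b0 : 0 <= b.
  case: (pickP {ffun I -> V}) => [w _|no]; first exact: le_trans (sqr_ge0 _) (ab j w).
  have := Ex_cst 1 lp; rewrite /Ex big_pred0 => [/eqP|w]; first by rewrite eq_sym oner_eq0.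
  by have := no w.
rewrite exprS -mulrA ler_wpM2l //; first by rewrite addr_ge0 // mulr_ge0.
by apply: IH => // k /iak[].
Qed.

(** Only the factor of [j] feels the coordinate [c j], and [val * (1 + a * val)] has conditional
    mean [s2 * a]. The other factors integrate to 1, since [a j] and [F] ignore their
    coordinates. *)
Lemma Ex_tilt_val s a F j : wellposed s -> (forall k, k \in s -> igns s (a k)) ->
  igns s F -> j \in s ->
  Ex p (fun w => tilt s a w * (val (w (c j)) * F w)) = s2 * Ex p (fun w => a j w * F w).
Proof.
move=> ws ia iF js.
have pr : perm_eq s (j :: rem j s) by exact: perm_to_rem.
have mr k : (k \in j :: rem j s) = (k \in s) by rewrite (perm_mem pr).
have [ws' sj ne] : [/\ wellposed (rem j s), standard (c j) & forall k, k \in rem j s -> c k != c j].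
  apply: wellposed_cons; case: ws => u i st; split; first by rewrite -(perm_uniq pr).
    by move=> k l; rewrite !mr; exact: i.
  by move=> k; rewrite mr; exact: st.
have sub k : k \in rem j s -> k \in s by exact: mem_rem.
have iX : ign (c j) (tilt (rem j s) a).
  by apply: tilt_ign => // k /sub ks; exact: (ia k ks).
have iaj := ia j js.
rewrite (eq_Ex p (G := fun w => val (w (c j)) * (tilt (rem j s) a w * F w) +
   val (w (c j)) ^+ 2 * (tilt (rem j s) a w * (a j w * F w)))); last first.
  by move=> w; rewrite /tilt (perm_big _ pr) big_cons /=; ring.
have iaF k : k \in s -> ign (c k) (fun w => a j w * F w).
  by move=> ks; apply: ign_mul; [exact: iaj | exact: iF].
rewrite ExD Ex_val1 //; last by apply: ign_mul => //; exact: iF.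
rewrite Ex_val2 //; last by apply: ign_mul => //; exact: iaF.
rewrite add0r Ex_tilt //.
- by move=> k /sub ks l /sub ls; exact: ia.
- by move=> k /sub; exact: iaF.
Qed.

End LinearForms.

(* The quartic is the tangent minorant of [`|t|] at [r]. *)
Lemma ge_norm_quartic (R : realType) (r t : R) : 0 < r ->
  3 / (2 * r) * t ^+ 2 - 1 / (2 * r ^+ 3) * t ^+ 4 <= `|t|.
Proof.
move=> r0; rewrite -[t ^+ 2]real_normK ?num_real //.
rewrite (_ : t ^+ 4 = (`|t| ^+ 2) ^+ 2); last by rewrite real_normK ?num_real // -exprM.
have := normr_ge0 t; set u := `|t| => u0.
rewrite -subr_ge0.
have -> : u - (3 / (2 * r) * u ^+ 2 - 1 / (2 * r ^+ 3) * (u ^+ 2) ^+ 2) =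
   u * (u - r) ^+ 2 * (u + 2 * r) / (2 * r ^+ 3) by field; rewrite gt_eqF.
have r0' := ltW r0.
by do ?[exact: sqr_ge0 | apply: divr_ge0 | apply: mulr_ge0 | apply: addr_ge0 | apply: exprn_ge0].
Qed.

Section BilinearForm.
Context (R : realType) (I V : finType) (p : I -> V -> R) (val : V -> R).
Context (J : eqType) (c1 c2 : J -> I) (s2 K4 : R) (s : seq J).
Context (a : J -> {ffun I -> V} -> R).
Hypothesis lp : law p.
Hypotheses (s2_ge : 1 / 2 <= s2) (K4_ge : 3 * s2 ^+ 2 <= K4).
Hypotheses (ws1 : wellposed p val c1 s2 K4 s) (ws2 : wellposed p val c2 s2 K4 s).
Hypothesis c12 : forall j k, j \in s -> k \in s -> c1 j != c2 k.
Hypotheses (ia1 : forall j, j \in s -> igns c1 s (a j))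
  (ia2 : forall j, j \in s -> igns c2 s (a j)).

(** The quartic minorant at [r = 2 * K4] is applied to [X * Y / A], then multiplied by [A]. As [Y]
    and [A] ignore the coordinates of [X], the forms can be integrated in turn: the quadratic term
    yields [s2 ^ 2 >= 1 / 4] times the mean of [A], the quartic one at most [K4 ^ 2] times it, and
    [3 / (16 K4) - 1 / (16 K4) = 1 / (8 K4)]. *)
Lemma Ex_linf_linf :
  Ex p (fun w => `|linf val c1 s a w * linf val c2 s a w|) >=
  1 / (8 * K4) * Ex p (fun w => sqf s a w).
Proof.
move: (s2_ge) (K4_ge) => s2h K4h.
have s2sq : 1 / 4 <= s2 ^+ 2.
  rewrite -subr_ge0 (_ : _ - _ = (s2 - 1 / 2) * (s2 + 1 / 2)); last by field.
  by apply: mulr_ge0; lra.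
have K4_gt0 : 0 < K4 by lra.
have s20 : 0 <= s2 by lra.
pose X := linf val c1 s a; pose Y := linf val c2 s a; pose A := sqf s a.
have A0 w : 0 <= A w by apply: sumr_ge0 => j _; exact: sqr_ge0.
(* Division by 0 gives 0, so the identities with [A] in a denominator survive at [A = 0] once [Y]
   vanishes there. *)
have Az w : A w = 0 -> Y w = 0.
  move=> /eqP; rewrite /A /sqf psumr_eq0 => [/allP h|j _]; last exact: sqr_ge0.
  rewrite /Y /linf big_seq big1 // => j /h /=.
  by rewrite sqrf_eq0 => /eqP ->; rewrite mulr0.
pose r := 2 * K4; have r0 : 0 < r by rewrite /r mulr_gt0.
have pt w : 3 / (2 * r) * (X w ^+ 2 * (Y w ^+ 2 / A w)) -
    1 / (2 * r ^+ 3) * (X w ^+ 4 * (Y w ^+ 4 * (A w)^-1 ^+ 3)) <= `|X w * Y w|.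
  have [Aw|Aw] := eqVneq (A w) 0.
    by rewrite Az // !expr0n /= !(mulr0, mul0r) subrr normr0.
  have Aw0 : 0 < A w by rewrite lt_neqAle eq_sym Aw A0.
  have -> : 3 / (2 * r) * (X w ^+ 2 * (Y w ^+ 2 / A w)) -
      1 / (2 * r ^+ 3) * (X w ^+ 4 * (Y w ^+ 4 * (A w)^-1 ^+ 3)) =
      A w * (3 / (2 * r) * (X w * Y w / A w) ^+ 2 - 1 / (2 * r ^+ 3) * (X w * Y w / A w) ^+ 4).
    by field; rewrite Aw /= gt_eqF.
  have -> : `|X w * Y w| = A w * `|X w * Y w / A w|.
    by rewrite [in RHS]normrM normfV (ger0_norm (A0 w)) mulrCA divff ?mulr1.
  by rewrite ler_pM2l // ge_norm_quartic.
have iA c' j : (forall k, k \in s -> igns c' s (a k)) -> j \in s -> ign (c' j) A.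
  move=> h js; apply: ign_sum => k ks _; apply: ign_exp; exact: h.
have iY j : j \in s -> ign (c1 j) Y.
  by move=> js; apply: linf_ign => k ks; [rewrite eq_sym c12 | exact: ia1].
have hF n k j : j \in s -> ign (c1 j) (fun w => Y w ^+ n * (A w)^-1 ^+ k).
  move=> js; apply: ign_mul; first by apply: ign_exp; exact: iY.
  by apply: ign_exp; apply: ign_inv; exact: iA.
apply: le_trans (le_Ex lp pt); rewrite ExB !ExZ.
have -> : Ex p (fun w => X w ^+ 2 * (Y w ^+ 2 / A w)) = s2 ^+ 2 * Ex p A.
  rewrite (Ex_linf2 lp ws1 ia1 (F := fun w => Y w ^+ 2 / A w)); last exact: (hF 2%N 1%N).
  rewrite (eq_Ex p (G := fun w => linf val c2 s a w ^+ 2 * 1)); last first.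
    move=> w; rewrite mulr1 -/(A w) -/(Y w).
    have [Aw|Aw] := eqVneq (A w) 0; first by rewrite Az // Aw expr0n /= mul0r.
    by rewrite mulrCA divff ?mulr1.
  rewrite (Ex_linf2 lp ws2 ia2) // mulrA -expr2; congr (_ * _).
  by apply: eq_Ex => w; rewrite mulr1.
have H4 : Ex p (fun w => X w ^+ 4 * (Y w ^+ 4 * (A w)^-1 ^+ 3)) <= K4 ^+ 2 * Ex p A.
  apply: le_trans (Ex_linf4 lp s20 K4_ge ws1 ia1 (hF 4%N 3%N) _) _.
    by move=> w; apply: mulr_ge0; [rewrite exprn_even_ge0 | rewrite exprn_ge0 // invr_ge0].
  rewrite expr2 -mulrA ler_pM2l //.
  rewrite (eq_Ex p (G := fun w => linf val c2 s a w ^+ 4 * (A w)^-1)); last first.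
    move=> w; rewrite -/(A w) -/(Y w).
    have [Aw|Aw] := eqVneq (A w) 0; first by rewrite Aw Az // !expr0n /= !(mulr0, mul0r).
    by field.
  apply: le_trans (Ex_linf4 lp s20 K4_ge ws2 ia2 _ _) _.
  - by move=> j js; apply: ign_inv; exact: iA.
  - by move=> w; rewrite invr_ge0.
  rewrite ler_pM2l // le_eqVlt; apply/orP; left; apply/eqP; apply: eq_Ex => w.
  rewrite -/(A w).
  have [->|Aw] := eqVneq (A w) 0; first by rewrite expr0n /= mul0r.
  by rewrite expr2 mulfK.
have EA : 0 <= Ex p A by exact: Ex_ge0.
rewrite lerBrDr; apply: le_trans (lerD (lexx _) (ler_wpM2l _ H4)) _.
  by rewrite divr_ge0 // mulr_ge0 // exprn_ge0 // ltW.
rewrite (mulrA _ (s2 ^+ 2)) (mulrA _ (K4 ^+ 2)) -mulrDl ler_wpM2r // /r.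
have -> : 1 / (8 * K4) + 1 / (2 * (2 * K4) ^+ 3) * K4 ^+ 2 = 3 / (16 * K4).
  by field; rewrite gt_eqF.
have -> : 3 / (2 * (2 * K4)) * s2 ^+ 2 = 3 / (16 * K4) * (4 * s2 ^+ 2).
  by field; rewrite gt_eqF.
rewrite -[leLHS]mulr1 ler_wpM2l //; last by lra.
by rewrite divr_ge0 // mulr_ge0 // ltW.
Qed.

End BilinearForm.

(** * Path counts and the test vector *)

Section PartPaths.
Context (R : realType) (I V : finType) (p : I -> V -> R) (val : V -> R).
Context (N m : nat).
Local Notation X := ('I_N * 'I_m)%type.
Context (e : X -> X -> I) (s2 K4 : R).
Hypothesis lp : law p.
Hypothesis e_sym : forall x y, e x y = e y x.
Hypothesis e_inj : forall x y x' y', e x y = e x' y' ->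
  (x = x' /\ y = y') \/ (x = y' /\ y = x').
Hypothesis e_std : forall x y, x != y -> standard p val s2 K4 (e x y).
Implicit Types (S : {set 'I_N}) (x y u t : X) (w : {ffun I -> V}) (b : nat -> R).

Definition edge x y w : R := val (w (e x y)).

(* Weighted count of the paths x = x_0, ..., x_k whose vertices x_1, ..., x_k lie in
   pairwise distinct parts, all of them in [S]. *)
Fixpoint paths k S x w : R :=
  if k is k'.+1 then \sum_(y | y.1 \in S) edge x y w * paths k' (S :\ y.1)%SET y w else 1.

Definition mix L b S x w : R := \sum_(k < L) b k * paths k S x w.

(** Second moment of [paths k S x] for [n = #|S|]: there are [m ^ k * n ^_ k] paths, pairwise
    uncorrelated, each of second moment [s2 ^ k]. *)
Definition mom n k : R := s2 ^+ k * m%:R ^+ k * (n ^_ k)%:R.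

Lemma e_injr x y y' : e x y = e x y' -> y = y'.
Proof. by case/e_inj => [[]|[-> ->]]. Qed.

Lemma edge_ign x y u t : e x y != e u t -> ign (e u t) (edge x y).
Proof. by move=> ne; apply: ign_coord. Qed.

(** A path from [x] meets only [x] and vertices in the parts of [S], hence uses no edge at [u]. *)
Lemma paths_ign_vertex k S x u t : u != x -> u.1 \notin S -> ign (e u t) (paths k S x).
Proof.
elim: k S x => [|k IH] S x ux uS; first exact: ign_cst.
apply: ign_sum => y _ yS.
have uy : u != y by apply: contraNneq uS => ->.
apply: ign_mul; last by apply: IH; rewrite // !inE (negbTE uS) andbF.
apply: edge_ign; apply/eqP => /e_inj[] [E1 E2].
  by rewrite E1 eqxx in ux.
by rewrite E2 eqxx in uy.
Qed.

(** Consecutive vertices of a path lie in distinct parts. This leaves the edges inside parts free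
    for the tilt. *)
Lemma paths_ign_part k S x u t : u.1 = t.1 -> x.1 \notin S -> ign (e u t) (paths k S x).
Proof.
elim: k S x => [|k IH] S x ut xS; first exact: ign_cst.
apply: ign_sum => y _ yS.
apply: ign_mul; last by apply: IH; rewrite // !inE eqxx.
apply: edge_ign; apply/eqP => /e_inj[] [E1 E2].
  by rewrite E1 ut -E2 yS in xS.
by rewrite E1 -ut -E2 yS in xS.
Qed.

Lemma mix_ign (i : I) L b S x : (forall k, ign i (paths k S x)) -> ign i (mix L b S x).
Proof. by move=> h; apply: ign_sum => k _ _; apply: ign_mul => //; exact: ign_cst. Qed.

(** In an off-diagonal term the edge from [x] to [y] occurs once and every other factor ignores it,
    so its zero mean kills the term. *)
Lemma Ex_row (Q Q' : pred X) (a c : X -> {ffun I -> V} -> R) x :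
  (forall y, Q y || Q' y -> x != y) ->
  (forall y t, Q y -> ign (e x t) (a y)) -> (forall y t, Q' y -> ign (e x t) (c y)) ->
  Ex p (fun w => (\sum_(y | Q y) edge x y w * a y w) * (\sum_(y | Q' y) edge x y w * c y w)) =
  \sum_(y | Q y && Q' y) s2 * Ex p (fun w => a y w * c y w).
Proof.
move=> Qx ia ic.
rewrite (eq_Ex p (G := fun w => \sum_(y | Q y) \sum_(y' | Q' y')
   (edge x y w * a y w) * (edge x y' w * c y' w))); last first.
  by move=> w; rewrite mulr_suml; apply: eq_bigr => y _; rewrite mulr_sumr.
rewrite Ex_sum big_mkcondr; apply: eq_bigr => y Qy; rewrite Ex_sum.
have st : standard p val s2 K4 (e x y) by apply: e_std; apply: Qx; rewrite Qy.
have off y' : Q' y' -> y' != y ->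
    Ex p (fun w => (edge x y w * a y w) * (edge x y' w * c y' w)) = 0.
  move=> Qy' yy'.
  rewrite (eq_Ex p (G := fun w => val (w (e x y)) * (a y w * (edge x y' w * c y' w)))); last first.
    by move=> w; rewrite -mulrA.
  apply: (Ex_val1 lp st); apply: ign_mul; first exact: ia.
  apply: ign_mul; last exact: ic.
  by apply: edge_ign; apply: contraNneq yy' => /e_injr ->.
case: ifP => Qy'; last first.
  by apply: big1 => y' Qy''; apply: off => //; apply: contraTneq Qy'' => ->; rewrite Qy'.
rewrite (bigD1 y) //= [X in _ + X]big1 ?addr0; last by move=> y' /andP[]; exact: off.
rewrite -(Ex_val2 lp st); first by apply: eq_Ex => w; rewrite /edge; ring.
by apply: ign_mul; [exact: ia | exact: ic].
Qed.

Lemma Ex_path0 k S x : x.1 \notin S -> (0 < k)%N -> forall F,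
  (forall y, y.1 \in S -> ign (e x y) F) -> Ex p (fun w => paths k S x w * F w) = 0.
Proof.
case: k => // k xS _ F iF.
rewrite (eq_Ex p (G := fun w => \sum_(y | y.1 \in S)
    edge x y w * (paths k (S :\ y.1)%SET y w * F w))); last first.
  by move=> w; rewrite mulr_suml; apply: eq_bigr => y _; rewrite mulrA.
rewrite Ex_sum big1 // => y yS.
have xy : x != y by apply: contraNneq xS => ->.
apply: (Ex_val1 lp (e_std xy)); apply: ign_mul; last exact: iF.
by apply: paths_ign_vertex; rewrite // !inE (negbTE xS) andbF.
Qed.

(** Matching first edges shortens both paths by one step and removes the same part, until one of
    them has length 0; a longer one then has a centered first edge. Two vertex sets are needed
    because paths that avoid two parts get paired with paths that avoid only one. *)
Lemma Ex_paths k l S S' x : S' \subset S -> x.1 \notin S ->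
  Ex p (fun w => paths k S' x w * paths l S x w) = if k == l then mom #|S'| k else 0.
Proof.
elim: k l S S' x => [|k IH] [|l] S S' x SS xS;
  have xS' : x.1 \notin S' by apply: contra xS => /(fintype.subsetP SS).
- by rewrite eqxx /mom !expr0 ffactn0 !mulr1 -[RHS](Ex_cst 1 lp); apply: eq_Ex => w; rewrite /= ?mulr1.
- rewrite (eq_Ex p (G := fun w => paths l.+1 S x w * 1)); last by move=> w; rewrite mulrC.
  by rewrite Ex_path0.
- rewrite (eq_Ex p (G := fun w => paths k.+1 S' x w * 1)) ; last by move=> w; rewrite /= mulr1.
  by rewrite Ex_path0.
rewrite /= Ex_row.
- transitivity (\sum_(y : X | y.1 \in S') s2 * (if k == l then mom #|S'|.-1 k else 0)).
    apply: eq_big => y; first by apply/andb_idr; exact: (fintype.subsetP SS).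
    move=> /andP[yS' yS]; rewrite IH ?finset.setSD //; last by rewrite !inE eqxx.
    by rewrite (cardsD1 y.1 S') yS'.
  rewrite eqSS sumr_const; case: ifP => _; last by rewrite mulr0 mul0rn.
  have -> : #|[pred y : X | y.1 \in S']| = (#|S'| * m)%N.
    rewrite -[in RHS](card_ord m) -cardsT -cardsX -cardsE; apply: eq_card => -[i j].
    by rewrite !inE andbT.
  rewrite /mom ffactnS !exprS -mulr_natl !natrM; ring.
- by move=> y /orP[] yS; apply: contraTneq yS => <-.
- by move=> y t yS; apply: paths_ign_vertex; [apply: contraTneq yS => <- | rewrite !inE (negbTE xS') andbF].
- by move=> y t yS; apply: paths_ign_vertex; [apply: contraTneq yS => <- | rewrite !inE (negbTE xS) andbF].
Qed.

Lemma Ex_mix L L' b b' S S' x : (L <= L')%N -> S' \subset S -> x.1 \notin S ->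
  Ex p (fun w => mix L b S' x w * mix L' b' S x w) =
  \sum_(k < L) b k * b' k * mom #|S'| k.
Proof.
move=> LL SS xS.
rewrite (eq_Ex p (G := fun w => \sum_(k < L) \sum_(l < L')
   (b k * b' l) * (paths k S' x w * paths l S x w))); last first.
  move=> w; rewrite mulr_suml; apply: eq_bigr => k _; rewrite mulr_sumr.
  by apply: eq_bigr => l _; rewrite mulrACA.
rewrite Ex_sum; apply: eq_bigr => k _; rewrite Ex_sum.
rewrite (bigD1 (widen_ord LL k)) //= ExZ Ex_paths // eqxx big1 ?addr0 // => l kl.
rewrite ExZ Ex_paths // ifF ?mulr0 //; apply/eqP => E; move/eqP: kl; apply.
exact/val_inj.
Qed.

Lemma mixS L b S x w : b 0%N = 0 -> mix L.+1 b S x w =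
  \sum_(y | y.1 \in S) edge x y w * mix L (fun k => b k.+1) (S :\ y.1)%SET y w.
Proof.
move=> b0; rewrite /mix big_ord_recl b0 mul0r add0r.
under eq_bigr do rewrite mulr_sumr.
rewrite exchange_big; apply: eq_bigr => y _; rewrite mulr_sumr.
by apply: eq_bigr => k _; rewrite mulrCA.
Qed.

Section TestVector.
Context (L : nat) (b : nat -> R).
Hypotheses (b0 : b 0%N = 0) (b1 : b 1%N = 0).

Definition tvec x w : R := mix L.+1 b [set~ x.1]%SET x w.
Local Notation b' := (fun k => b k.+1).
Local Notation avoid x y := ([set~ x.1] :\ y.1)%SET.

Lemma avoidC x y : avoid x y = avoid y x.
Proof. by apply/finset.setP => i; rewrite !inE andbC. Qed.

Lemma card_avoid1 x : #|[set~ x.1]%SET| = N.-1.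
Proof. by rewrite cardsC1 card_ord. Qed.

Lemma card_avoid x y : x.1 != y.1 -> #|avoid x y| = N.-2.
Proof.
move=> xy; have := card_avoid1 x; rewrite (cardsD1 y.1) !inE eq_sym xy add1n.
by move=> <-.
Qed.

Lemma Ex_tvec2 x : Ex p (fun w => tvec x w ^+ 2) = \sum_(k < L.+1) b k ^+ 2 * mom N.-1 k.
Proof.
rewrite (eq_Ex p (G := fun w => mix L.+1 b [set~ x.1]%SET x w * mix L.+1 b [set~ x.1]%SET x w)) //.
by rewrite Ex_mix ?card_avoid1 // !inE eqxx.
Qed.

Lemma tvec_ign_part x u t : u.1 = t.1 -> ign (e u t) (tvec x).
Proof. by move=> ut; apply: mix_ign => k; apply: paths_ign_part; rewrite // !inE eqxx. Qed.

Lemma tvecE x w : tvec x w =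
  \sum_(y | y.1 != x.1) edge x y w * mix L b' (avoid x y) y w.
Proof. by rewrite /tvec mixS //; apply: eq_bigl => y; rewrite !inE. Qed.

Lemma mix_avoid_ign x y t : x != y -> ign (e x t) (mix L b' (avoid x y) y).
Proof.
move=> xy; apply: mix_ign => k; apply: paths_ign_vertex => //.
by rewrite !inE eqxx /= andbF.
Qed.

(** Here [b1] enters: it removes the path of length 0 on the left, so every path from [x] starts
    with a centered edge that the right factor ignores. Thanks to this the third moment of an entry
    drops out of [Ex_edge_tvec]. *)
Lemma Ex_mix_avoid x y : x.1 != y.1 ->
  Ex p (fun w => mix L b' (avoid x y) x w * mix L b' (avoid x y) y w) = 0.
Proof.
move=> xy.
have xy' : x != y by apply: contraNneq xy => ->.
rewrite (eq_Ex p (G := fun w => \sum_(k < L)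
   b k.+1 * (paths k (avoid x y) x w * mix L b' (avoid x y) y w))); last first.
  by move=> w; rewrite mulr_suml; apply: eq_bigr => k _; rewrite mulrA.
rewrite Ex_sum big1 // => -[[|k] kL] _; rewrite ExZ; first by rewrite b1 mul0r.
rewrite Ex_path0 ?mulr0 //; first by rewrite !inE eqxx /= andbF.
by move=> t _; exact: mix_avoid_ign.
Qed.

Lemma Ex_mix_tvec x y : x.1 != y.1 ->
  Ex p (fun w => mix L b' (avoid x y) x w * tvec x w) =
  \sum_(k < L) b k.+1 * b k * mom N.-2 k.
Proof.
move=> xy; rewrite Ex_mix // ?card_avoid //; last by rewrite !inE eqxx.
exact: finset.subsetDl.
Qed.

(** A path from [x] either starts with the edge to [y] or never uses it, so [tvec x] is
    [edge x y * uy] plus a remainder that ignores the edge, and likewise for [y]. In the expanded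
    product only the terms with the square of the edge survive; the two of them give one copy of the
    sum each, pairing the lengths [k] and [k + 1]. *)
Lemma Ex_edge_tvec x y : x.1 != y.1 ->
  Ex p (fun w => edge x y w * (tvec x w * tvec y w)) =
  2 * s2 * \sum_(k < L) b k.+1 * b k * mom N.-2 k.
Proof.
move=> xy.
have xy' : x != y by apply: contraNneq xy => ->.
pose ux := mix L b' (avoid x y) x; pose uy := mix L b' (avoid x y) y.
pose rest x y w := tvec x w - edge x y w * mix L b' (avoid x y) y w.
have restE x' y' w : x'.1 != y'.1 -> rest x' y' w =
    \sum_(t | (t.1 != x'.1) && (t != y')) edge x' t w * mix L b' (avoid x' t) t w.
  move=> ne; rewrite /rest tvecE (bigD1 y') /=; last by rewrite eq_sym.
  by rewrite addrAC subrr add0r.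
have rest_ign x' y' : x'.1 != y'.1 -> ign (e x' y') (rest x' y').
  move=> ne w v; rewrite !restE //.
  suff : ign (e x' y') (fun w => \sum_(t | (t.1 != x'.1) && (t != y')) edge x' t w * mix L b' (avoid x' t) t w) by [].
  apply: ign_sum => t _ /andP[tx ty]; apply: ign_mul.
    by apply: edge_ign; apply: contraNneq ty => /e_injr ->.
  by apply: mix_avoid_ign; apply: contraNneq tx => ->.
have iX : ign (e x y) (rest x y) by exact: rest_ign.
have iY : ign (e x y) (rest y x) by rewrite e_sym; apply: rest_ign; rewrite eq_sym.
have iuy : ign (e x y) uy by exact: mix_avoid_ign.
have iux : ign (e x y) ux.
  by rewrite e_sym /ux avoidC; apply: mix_avoid_ign; rewrite eq_sym.
rewrite (eq_Ex p (G := fun w => val (w (e x y)) ^+ 3 * (ux w * uy w) +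
   (val (w (e x y)) ^+ 2 * (uy w * rest y x w + ux w * rest x y w) +
    val (w (e x y)) * (rest x y w * rest y x w)))); last first.
  move=> w; rewrite /rest (avoidC y x) -/(ux w) -/(uy w).
  by rewrite /edge (e_sym y x); ring.
rewrite !ExD (Ex_coord (fun v => val v ^+ 3)) //; last exact: ign_mul.
rewrite Ex_mix_avoid // mulr0 add0r.
rewrite (Ex_val1 lp (e_std xy')) ?addr0; last exact: ign_mul.
rewrite (Ex_val2 lp (e_std xy')); last by apply: ign_add; apply: ign_mul.
set c := \sum_(k < L) _.
have -> : 2 * s2 * c = s2 * (c + c) by ring.
congr (_ * _); rewrite ExD.
(* What [rest] removes from [tvec] is linear in an edge that its cofactors ignore, so it can be put
   back without changing the mean. *)
have half x' y' : x'.1 != y'.1 -> 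
    ign (e x' y') (mix L b' (avoid x' y') x') -> ign (e x' y') (mix L b' (avoid x' y') y') ->
    Ex p (fun w => mix L b' (avoid x' y') x' w * rest x' y' w) =
    \sum_(k < L) b k.+1 * b k * mom N.-2 k.
  move=> ne i1 i2.
  have ne' : x' != y' by apply: contraNneq ne => ->.
  rewrite -(Ex_mix_tvec ne) [RHS](eq_Ex p (G := fun w => mix L b' (avoid x' y') x' w * rest x' y' w +
    val (w (e x' y')) * (mix L b' (avoid x' y') x' w * mix L b' (avoid x' y') y' w))); last first.
    by move=> w; rewrite /rest /edge; ring.
  by rewrite ExD (Ex_val1 lp (e_std ne')) ?addr0 //; exact: ign_mul.
congr (_ + _); rewrite /c; last exact: half.
  rewrite -(half y x); rewrite ?(eq_sym y.1) //.
  - by apply: eq_Ex => w; rewrite /uy avoidC.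
  - by rewrite avoidC e_sym.
  - by rewrite avoidC e_sym.
Qed.

(** Since [avoid x t] depends on [x] only through its part, [tvec x] and [tvec y] have the same
    coefficients, over the disjoint sets of edges at [x] and at [y]: the situation of
    [Ex_linf_linf]. *)
Lemma Ex_norm_tvec x y : 1 / 2 <= s2 -> 3 * s2 ^+ 2 <= K4 -> x.1 = y.1 -> x != y ->
  1 / (8 * K4) * ((N.-1 * m)%:R * \sum_(k < L) b k.+1 ^+ 2 * mom N.-2 k) <=
  Ex p (fun w => `|tvec x w * tvec y w|).
Proof.
move=> s2h K4h xy1 xy.
pose s := [seq t <- enum {: X} | t.1 != x.1].
have sx t : t \in s -> t.1 != x.1 by rewrite mem_filter => /andP[].
have nx t : t \in s -> x != t by move=> /sx; apply: contraNneq => ->.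
have ny t : t \in s -> y != t by move=> /sx; rewrite xy1; apply: contraNneq => ->.
have lin u w : u.1 = x.1 -> tvec u w = linf val (e u) s (fun t => mix L b' (avoid x t) t) w.
  move=> ux; rewrite tvecE /linf /s big_filter big_enum_cond.
  by apply: eq_big => t; rewrite ?ux // => _; rewrite ux.
have us : uniq s by rewrite filter_uniq // enum_uniq.
rewrite (eq_Ex p (G := fun w => `|linf val (e x) s (fun t => mix L b' (avoid x t) t) w *
    linf val (e y) s (fun t => mix L b' (avoid x t) t) w|)); last first.
  by move=> w; rewrite -!lin.
apply: le_trans (Ex_linf_linf (K4 := K4) lp s2h K4h _ _ _ _ _) => //; last first.
- move=> t ts t' _; have -> : avoid x t = avoid y t by rewrite xy1.
  by apply: mix_avoid_ign; exact: ny.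
- by move=> t ts t' _; apply: mix_avoid_ign; exact: nx.
- move=> t t' ts _; apply/eqP => /e_inj[] [E1 E2]; first by rewrite E1 eqxx in xy.
  by have := ny _ ts; rewrite E2 eqxx.
- by split=> // [t t' _ _ /e_injr|t /ny /e_std].
- by split=> // [t t' _ _ /e_injr|t /nx /e_std].
rewrite le_eqVlt; apply/orP; left; apply/eqP; congr (_ * _).
rewrite /sqf Ex_sum big_filter big_enum_cond /=.
transitivity (\sum_(t : X | t.1 != x.1) \sum_(k < L) b k.+1 ^+ 2 * mom N.-2 k); last first.
  apply: eq_bigr => t tx.
  rewrite (eq_Ex p (G := fun w => mix L b' (avoid x t) t w * mix L b' (avoid x t) t w)) //.
  rewrite Ex_mix ?card_avoid //; first by rewrite eq_sym.
  by rewrite !inE eqxx.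
rewrite sumr_const -[RHS]mulr_natl; congr (_%:R * _).
have -> : (N.-1 * m)%N = #|finset.setX [set~ x.1]%SET [set: 'I_m]%SET|.
  by rewrite cardsX cardsC1 cardsT !card_ord.
rewrite -[RHS]cardsE.
by apply: eq_card => -[i j]; rewrite !inE andbT.
Qed.

End TestVector.
End PartPaths.

(** * Large deviations for one clique *)

Lemma Ex_CauchySchwarz (R : realType) (I V : finType) (p : I -> V -> R)
    (F G : {ffun I -> V} -> R) : law p -> 0 < Ex p (fun w => G w ^+ 2) ->
  Ex p (fun w => F w * G w) ^+ 2 <= Ex p (fun w => F w ^+ 2) * Ex p (fun w => G w ^+ 2).
Proof.
move=> lp; set A := Ex p (fun w => F w ^+ 2); set C := Ex p (fun w => G w ^+ 2).
set B := Ex p _ => C0.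
have : 0 <= Ex p (fun w => (C * F w - B * G w) ^+ 2) by apply: Ex_ge0 => // w; exact: sqr_ge0.
rewrite (eq_Ex p (G := fun w => C ^+ 2 * F w ^+ 2 + ((- 2 * C * B) * (F w * G w) + B ^+ 2 * G w ^+ 2))).
  rewrite !ExD !ExZ -/A -/B -/C.
  have -> : C ^+ 2 * A + (- 2 * C * B * B + B ^+ 2 * C) = C * (A * C - B ^+ 2) by ring.
  by rewrite pmulr_rge0 // subr_ge0.
by move=> w; ring.
Qed.

Section TiltedBlock.
Context (R : realType) (I V : finType) (p : I -> V -> R) (val : V -> R).
Context (N m : nat).
Local Notation X := ('I_N * 'I_m)%type.
Local Notation J := ('I_N * ('I_m * 'I_m))%type.
Context (e : X -> X -> I) (s2 K4 th Z : R) (L : nat) (b : nat -> R).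
Hypothesis lp : law p.
Hypothesis e_sym : forall x y, e x y = e y x.
Hypothesis e_inj : forall x y x' y', e x y = e x' y' ->
  (x = x' /\ y = y') \/ (x = y' /\ y = x').
Hypothesis e_std : forall x y, x != y -> standard p val s2 K4 (e x y).
Hypotheses (b0 : b 0%N = 0) (b1 : b 1%N = 0) (b_le1 : forall k, `|b k| <= 1).
Hypotheses (s2_ge : 1 / 2 <= s2) (K4_ge : 3 * s2 ^+ 2 <= K4).
Hypotheses (th_ge0 : 0 <= th) (val_le : forall v, `|val v| <= Z) (thZ : th * Z <= 1).
Hypothesis ZX_ge1 : 1 <= Z * (N * m)%:R.
Implicit Types (x y : X) (w : {ffun I -> V}) (j : J).

Local Notation edge := (edge val e).
Local Notation tvec := (tvec val e L b).

Definition qform w (u : X -> R) : R := \sum_x \sum_(y | y != x) edge x y w * (u x * u y).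

Let c j := e (j.1, j.2.1) (j.1, j.2.2).
(** With [Num.sg], the product of [tau] and the two entries is [th] times their absolute value, also
    where it vanishes. *)
Let tau j w : R := th * Num.sg (tvec (j.1, j.2.1) w * tvec (j.1, j.2.2) w).
Let pairs : seq J := [seq j : J <- enum {: J} | (j.2.1 < j.2.2)%N].
Let T := tilt val c pairs tau.

Let wpairs : wellposed p val c s2 K4 pairs.
Proof.
split; first by rewrite filter_uniq // enum_uniq.
- move=> [i [a a']] [k [d d']]; rewrite !mem_filter /= => /andP[aa _] /andP[dd _].
  rewrite /c /= => /e_inj[] [[E1 E2] [_ E3]]; first by rewrite E1 E2 E3.
  by move: aa; rewrite E2 E3 => /(ltn_trans dd); rewrite ltnn.
- move=> [i [a a']]; rewrite mem_filter /= => /andP[aa _]; apply: e_std.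
  by apply: contraTneq aa => -[->]; rewrite ltnn.
Qed.

Let tvec_ign x j : ign (c j) (tvec x).
Proof. exact: tvec_ign_part. Qed.

Let tau_ign j k : ign (c j) (tau k).
Proof.
apply: (ign_comp (fun t => th * Num.sg t)); apply: ign_mul; exact: tvec_ign.
Qed.

Let size_pairs : (size pairs <= N * m * m)%N.
Proof.
rewrite size_filter (leq_trans (count_size _ _)) // -cardT card_prod card_ord.
by rewrite card_prod !card_ord mulnA.
Qed.

Let tau_le j w : `|tau j w| <= th.
Proof.
rewrite normrM ger0_norm // -[leRHS]mulr1 ler_wpM2l // normr_sg.
by case: (_ != 0).
Qed.

Let T_ge0 w : 0 <= T w.
Proof.
apply: prodr_ge0 => j _.
have : `|tau j w * val (w (c j))| <= 1.
  rewrite normrM; apply: le_trans thZ.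
  by apply: ler_pM; [exact: normr_ge0 | exact: normr_ge0 | exact: tau_le | exact: val_le].
by rewrite ler_norml => /andP[]; lra.
Qed.

Let ExT F : (forall j, ign (c j) F) -> Ex p (fun w => T w * F w) = Ex p F.
Proof.
move=> iF; apply: (Ex_tilt lp wpairs) => [j _ k _|j _]; [exact: tau_ign | exact: iF].
Qed.

Let ExT_cross x y : x.1 != y.1 ->
  Ex p (fun w => T w * (edge x y w * (tvec x w * tvec y w))) =
  2 * s2 * \sum_(k < L) b k.+1 * b k * mom m s2 N.-2 k.
Proof.
move=> xy; rewrite ExT; first exact (Ex_edge_tvec lp e_sym e_inj e_std L b0 b1 xy).
move=> j; apply: ign_mul; last by apply: ign_mul; exact: tvec_ign.
apply: edge_ign; apply: contraNneq xy => /e_inj[] [-> ->] //.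
Qed.

Let ExT_same x y : x.1 = y.1 -> x != y ->
  s2 * th * (1 / (8 * K4) * ((N.-1 * m)%:R * \sum_(k < L) b k.+1 ^+ 2 * mom m s2 N.-2 k)) <=
  Ex p (fun w => T w * (edge x y w * (tvec x w * tvec y w))).
Proof.
move=> xy1 xy.
wlog lt_xy : x y xy1 xy / (x.2 < y.2)%N.
  move=> H; have [/H|yx|E] := ltngtP x.2 y.2; first exact.
    have := H y x (esym xy1) _ yx; rewrite eq_sym => /(_ xy) /le_trans; apply.
    rewrite le_eqVlt; apply/orP; left; apply/eqP; apply: eq_Ex => w.
    by rewrite /edge e_sym (mulrC (tvec y w)).
  by case/eqP: xy; case: x y xy1 E => [i a] [i' a'] /= -> /val_inj ->.
pose j : J := (x.1, (x.2, y.2)).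
have jx : (j.1, j.2.1) = x by rewrite /= -surjective_pairing.
have jy : (j.1, j.2.2) = y by rewrite /= xy1 -surjective_pairing.
have cj : c j = e x y by rewrite /c jx jy.
rewrite (eq_Ex p (G := fun w => T w * (val (w (c j)) * (tvec x w * tvec y w)))); last first.
  by move=> w; rewrite cj.
rewrite (Ex_tilt_val lp wpairs).
- rewrite -mulrA ler_wpM2l //; first by move: s2_ge; lra.
  rewrite (eq_Ex p (G := fun w => th * `|tvec x w * tvec y w|)); last first.
    by move=> w; rewrite /tau jx jy -mulrA -normrEsg.
  by rewrite ExZ ler_wpM2l // (Ex_norm_tvec lp e_inj e_std L b0 s2_ge K4_ge xy1 xy).
- by move=> k _ l _; exact: tau_ign.
- by move=> k _; apply: ign_mul; exact: tvec_ign.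
- by rewrite mem_filter lt_xy mem_enum.
Qed.

Let Z_ge0 : 0 <= Z.
Proof.
rewrite leNgt; apply/negP => Z0; have := ltr01 (R := R); rewrite ltNge => /negP; apply.
by apply: le_trans ZX_ge1 _; rewrite mulr_le0_ge0 // ltW.
Qed.

Let paths_le k (S : {set 'I_N}) x w : `|paths val e k S x w| <= (Z * (N * m)%:R) ^+ k.
Proof.
elim: k S x => [|k IH] S x; first by rewrite normr1.
rewrite (le_trans (ler_norm_sum _ _ _)) // big_mkcond /=.
have B0 : 0 <= Z * (Z * (N * m)%:R) ^+ k by rewrite mulr_ge0 // exprn_ge0 // (le_trans _ ZX_ge1).
apply: le_trans (_ : \sum_(y : X) Z * (Z * (N * m)%:R) ^+ k <= _).
  apply: ler_sum => y _; case: ifP => // _; rewrite normrM.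
  by apply: ler_pM; [exact: normr_ge0 | exact: normr_ge0 | exact: val_le | exact: IH].
rewrite sumr_const card_prod !card_ord -mulr_natr exprS; lra.
Qed.

(** By [ZX_ge1] the largest length dominates, so a single power bounds the paths of all lengths. *)
Let tmax : R := L.+1%:R * (Z * (N * m)%:R) ^+ L.

Let tvec_le x w : `|tvec x w| <= tmax.
Proof.
rewrite (le_trans (ler_norm_sum _ _ _)) //.
apply: le_trans (_ : \sum_(k < L.+1) (Z * (N * m)%:R) ^+ L <= _); last first.
  by rewrite sumr_const card_ord /tmax mulr_natl.
apply: ler_sum => k _; rewrite normrM -[leRHS]mul1r; apply: ler_pM => //.
by apply: le_trans (paths_le _ _ _ _) _; rewrite ler_weXn2l // -ltnS.
Qed.

Let qform_le w : qform w (tvec^~ w) <= (N * m)%:R ^+ 2 * (Z * tmax ^+ 2).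
Proof.
apply: le_trans (_ : \sum_(x : X) \sum_(y : X) Z * tmax ^+ 2 <= _); last first.
  by rewrite !sumr_const card_prod !card_ord -mulrnA mulnn -[leLHS]mulr_natl natrX.
apply: ler_sum => x _; rewrite big_mkcond /=; apply: ler_sum => y _.
case: ifP => _; last by rewrite mulr_ge0 // sqr_ge0.
rewrite (le_trans (ler_norm _)) // !normrM expr2; apply: ler_pM; rewrite ?mulr_ge0 //; first exact: val_le.
by apply: ler_pM; rewrite // tvec_le.
Qed.

(** [delta] bounds from below the tilted mean of [Y], the form minus [lam] times the squared norm at
    the test vector. Off the good event [Y <= 0]; on it a crude bound on [Y] is enough.
    Cauchy-Schwarz then separates the indicator from the density, whose second moment has one factor
    for each of the at most [N * m * m] edges inside parts. *)
Lemma Ex_good_event (lam : R) : 0 <= lam ->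
  let B1 := \sum_(k < L.+1) b k ^+ 2 * mom m s2 N.-1 k in
  let B2 := \sum_(k < L) b k.+1 * b k * mom m s2 N.-2 k in
  let B3 := \sum_(k < L) b k.+1 ^+ 2 * mom m s2 N.-2 k in
  let delta := (N * m)%:R * ((N.-1 * m)%:R * (2 * s2 * B2) +
     m.-1%:R * (s2 * th * (1 / (8 * K4) * ((N.-1 * m)%:R * B3))) - lam * B1) in
  0 <= delta ->
  delta ^+ 2 <= ((N * m)%:R ^+ 2 * (Z * tmax ^+ 2)) ^+ 2 * (1 + th ^+ 2 * s2) ^+ (N * m * m) *
    Ex p (fun w => `[< exists u : X -> R, lam * (\sum_x u x ^+ 2) < qform w u >]%:R).
Proof.
move=> lam0 B1 B2 B3 delta delta0.
set Ym := _ * (Z * _).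
pose good w := `[< exists u : X -> R, lam * (\sum_x u x ^+ 2) < qform w u >].
pose Y w := qform w (tvec^~ w) - lam * \sum_x tvec x w ^+ 2.
have EY : delta <= Ex p (fun w => T w * Y w).
  rewrite (eq_Ex p (G := fun w => \sum_(x : X) \sum_(y | y != x) T w * (edge x y w * (tvec x w * tvec y w))
     - lam * \sum_(x : X) T w * tvec x w ^+ 2)); last first.
    move=> w; rewrite /Y /qform mulrBr; congr (_ - _).
      by rewrite mulr_sumr; apply: eq_bigr => x _; rewrite mulr_sumr.
    by rewrite mulrCA mulr_sumr.
  have -> : delta = (N * m)%:R * ((N.-1 * m)%:R * (2 * s2 * B2) +
     m.-1%:R * (s2 * th * (1 / (8 * K4) * ((N.-1 * m)%:R * B3)))) -
     lam * \sum_(x : X) Ex p (fun w => T w * tvec x w ^+ 2).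
    rewrite (eq_bigr (fun=> B1)); last first.
      move=> x _; rewrite ExT; first exact: (Ex_tvec2 lp e_inj e_std).
      by move=> j; apply: ign_exp; exact: tvec_ign.
    rewrite sumr_const card_prod !card_ord -(mulr_natl B1) /delta; ring.
  rewrite ExB ExZ !Ex_sum lerD2r.
  set Q := (_ + _); apply: le_trans (_ : \sum_(x : X) Q <= _).
    by rewrite sumr_const card_prod !card_ord mulr_natl.
  apply: ler_sum => x _; rewrite Ex_sum (bigID (fun y => y.1 == x.1)) /= addrC.
  rewrite /Q; apply: lerD.
    rewrite (eq_bigl (fun y => y.1 != x.1)); last first.
      by move=> y; apply: andb_idl; apply: contraNneq => ->.
    rewrite (eq_bigr (fun=> 2 * s2 * B2)); last by move=> y yx; rewrite ExT_cross // eq_sym.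
    rewrite sumr_const -[leRHS]mulr_natl le_eqVlt; apply/orP; left; apply/eqP; congr (_%:R * _).
    have -> : (N.-1 * m)%N = #|finset.setX [set~ x.1]%SET [set: 'I_m]%SET|.
      by rewrite cardsX cardsC1 cardsT !card_ord.
    by rewrite -[RHS]cardsE; apply: eq_card => -[i k]; rewrite !inE andbT.
  apply: le_trans (_ : \sum_(y : X | (y != x) && (y.1 == x.1))
     s2 * th * (1 / (8 * K4) * ((N.-1 * m)%:R * B3)) <= _); last first.
    apply: ler_sum => y /andP[yx /eqP yx1]; apply: ExT_same => //; by rewrite eq_sym.
  rewrite sumr_const -[leRHS]mulr_natl le_eqVlt; apply/orP; left; apply/eqP; congr (_%:R * _).
  have -> : m.-1 = #|finset.setX [set x.1]%SET [set~ x.2]%SET|.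
    by rewrite cardsX cardsC1 cards1 mul1n card_ord.
  rewrite -[RHS]cardsE; apply: eq_card => -[i k]; rewrite !inE /= andbC; case: x => i' k' /=.
  by rewrite unfold_in /= xpair_eqE; case: (i == i'); rewrite ?andbF ?andbT.
have Y_le : delta <= Ym * Ex p (fun w => T w * (good w)%:R).
  apply: le_trans EY _; rewrite -ExZ; apply: le_Ex => // w.
  have [Yw|Yw] := ltP 0 (Y w).
    have -> : good w = true.
      by apply/asboolP; exists (tvec^~ w); rewrite -subr_gt0.
    rewrite mulr1 mulrC ler_wpM2r //; apply: le_trans (qform_le w).
    by rewrite lerBlDr lerDl; apply: mulr_ge0 => //; apply: sumr_ge0 => x _; exact: sqr_ge0.
  apply: le_trans (_ : 0 <= _); first by apply: mulr_ge0_le0 => //; exact: T_ge0.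
  apply: mulr_ge0; last by apply: mulr_ge0; [exact: T_ge0 | case: (good w)].
  apply: mulr_ge0; first exact: sqr_ge0.
  apply: mulr_ge0; last exact: sqr_ge0.
  exact: Z_ge0.
have T1 : Ex p (fun w => T w ^+ 2) <= (1 + th ^+ 2 * s2) ^+ (N * m * m).
  rewrite (eq_Ex p (G := fun w => T w ^+ 2 * 1)); last by move=> w; rewrite mulr1.
  have s20 : 0 <= s2 by move: s2_ge; lra.
  apply: le_trans (_ : (1 + th ^+ 2 * s2) ^+ size pairs <= _); last first.
    by rewrite ler_weXn2l // lerDl mulr_ge0 // sqr_ge0.
  rewrite -[leRHS]mulr1 -[X in _ * X](Ex_cst (p := p)) //.
  apply: (Ex_tilt2 (K4 := K4) lp) => //; last by move=> j _ k _; exact: tau_ign.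
  by move=> j w; rewrite -real_normK ?num_real // ler_sqr ?nnegrE.
have T0 : 0 < Ex p (fun w => T w ^+ 2).
  have : 0 <= Ex p (fun w => (T w - 1) ^+ 2) by apply: Ex_ge0 => // w; exact: sqr_ge0.
  rewrite (eq_Ex p (G := fun w => T w ^+ 2 + ((-2) * (T w * 1) + 1))); last by move=> w; ring.
  rewrite !ExD ExZ ExT // !Ex_cst //; lra.
have CS := Ex_CauchySchwarz (fun w => (good w)%:R) lp T0.
apply: (@le_trans _ _ ((Ym * Ex p (fun w => T w * (good w)%:R)) ^+ 2)).
  by rewrite ler_sqr ?nnegrE // (le_trans delta0).
rewrite exprMn -mulrA ler_wpM2l ?sqr_ge0 //.
rewrite (eq_Ex p (G := fun w => (good w)%:R * T w)); last by move=> w; rewrite mulrC.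
apply: le_trans CS _; rewrite mulrC; apply: ler_pM => //.
- exact: ltW.
- by apply: Ex_ge0 => // w; exact: sqr_ge0.
by apply: le_Ex => // w; rewrite /good; case: `[< _ >]; rewrite ?expr1n ?expr0n.
Qed.

End TiltedBlock.

(** * Growth estimates and the weights of the path lengths *)

Section Asymptotics.
Context (R : realType).

(** The Taylor term of degree [B + 1] of the exponential alone suffices. *)
Lemma expR_dominates_pow (A t : R) (B : nat) : 0 < t ->
  exists d0 : nat, forall d : nat, (d0 <= d)%N -> A * d%:R ^+ B <= expR (t * d%:R).
Proof.
move=> t0; pose Q := `|A| * B.+1`!%:R / t ^+ B.+1.
exists (Num.bound Q).+1 => d dd.
have dQ : Q <= d%:R.
  apply: le_trans (ltW (archi_boundP _)) _; last by rewrite ler_nat ltnW.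
  by rewrite divr_ge0 ?mulr_ge0 // exprn_ge0 // ltW.
have td : 0 <= t * d%:R by rewrite mulr_ge0 // ltW.
apply: (@le_trans _ _ (1 + (t * d%:R) ^+ B.+1 / B.+1`!%:R)); last exact: expR_ge1Dxn.
apply: (@le_trans _ _ (Q * t ^+ B.+1 / B.+1`!%:R * d%:R ^+ B)).
  rewrite ler_wpM2r ?exprn_ge0 // /Q divfK ?expf_neq0 ?gt_eqF //.
  by rewrite mulfK ?ler_norm // pnatr_eq0 -lt0n fact_gt0.
apply: (@le_trans _ _ ((t * d%:R) ^+ B.+1 / B.+1`!%:R)); last by rewrite lerDr ler01.
have -> : Q * t ^+ B.+1 / B.+1`!%:R * d%:R ^+ B = t ^+ B.+1 / B.+1`!%:R * (Q * d%:R ^+ B) by ring.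
have -> : (t * d%:R) ^+ B.+1 / B.+1`!%:R = t ^+ B.+1 / B.+1`!%:R * (d%:R * d%:R ^+ B).
  by rewrite exprMn (exprS d%:R); ring.
rewrite ler_wpM2l ?divr_ge0 ?exprn_ge0 ?(ltW t0) //.
by rewrite ler_wpM2r // exprn_ge0.
Qed.

(** Polynomial substitute for the sine, the top eigenvector of a path graph. Its Rayleigh quotient
    [2 - 10 / (L ^ 2 + 1)] nearly attains the optimum, about [2 - pi ^ 2 / L ^ 2], and its sums have
    closed forms provable by induction. *)
Definition parab (L j : nat) : R := j%:R * (L%:R - j%:R).

Lemma sum_parab_sqr (L n : nat) : \sum_(j < n) parab L j ^+ 2 =
  n%:R * (n%:R - 1) * (2 * n%:R - 1) * (L%:R ^+ 2 / 6 + (3 * n%:R ^+ 2 - 3 * n%:R - 1) / 30)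
  - L%:R / 2 * (n%:R * (n%:R - 1)) ^+ 2.
Proof.
elim: n => [|n IH]; first by rewrite big_ord0; field.
by rewrite big_ord_recr IH /parab /= -natr1; field.
Qed.

Lemma sum_parab_next (L n : nat) : \sum_(j < n) parab L j.+1 * parab L j =
  \sum_(j < n) parab L j ^+ 2
  + n%:R * (n%:R - 1) * (L%:R * (L%:R - 1) / 2 - (3 * L%:R - 1) * (2 * n%:R - 1) / 6
    + n%:R * (n%:R - 1) / 2).
Proof.
elim: n => [|n IH]; first by rewrite !big_ord0; field.
by rewrite !big_ord_recr IH /parab /= -!natr1; field.
Qed.

Lemma sum_parab_sqrE (L : nat) : \sum_(j < L) parab L j ^+ 2 = (L%:R ^+ 5 - L%:R) / 30.
Proof. by rewrite sum_parab_sqr; field. Qed.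

Lemma sum_parab_nextE (L : nat) : \sum_(j < L) parab L j.+1 * parab L j =
  (L%:R ^+ 5 - L%:R) / 30 - (L%:R ^+ 3 - L%:R) / 6.
Proof. by rewrite sum_parab_next sum_parab_sqrE; field. Qed.

(** Shifted by one step, so as to vanish at both 0 and 1, as [b0] and [b1] demand. *)
Definition profile (L k : nat) : R := if k is j.+1 then parab L j / L%:R ^+ 2 else 0.

Lemma profile_ge0 L k : (k <= L.+1)%N -> 0 <= profile L k.
Proof.
case: k => // j; rewrite ltnS => jL; rewrite /profile /parab.
by rewrite divr_ge0 // ?exprn_ge0 // mulr_ge0 // subr_ge0 ler_nat.
Qed.

Lemma profile_le1 L k : (k <= L.+1)%N -> profile L k <= 1.
Proof.
case: k => [|j]; rewrite ?ler01 // ltnS => jL; rewrite /profile /parab.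
have [->|L0] := posnP L; first by rewrite expr0n /= invr0 mulr0 ler01.
rewrite ler_pdivrMr ?exprn_gt0 ?ltr0n // mul1r expr2 ler_pM // ?ler_nat //.
  by rewrite subr_ge0 ler_nat.
by rewrite gerBl.
Qed.

Lemma sum_profile_sqr L : \sum_(k < L.+1) profile L k ^+ 2 =
  (L%:R ^+ 5 - L%:R) / 30 / L%:R ^+ 4.
Proof.
rewrite big_ord_recl expr0n add0r -sum_parab_sqrE mulr_suml.
by apply: eq_bigr => j _; rewrite /= expr_div_n -exprM.
Qed.

Lemma sum_profile_next L : (0 < L)%N ->
  (2 - 10 / L%:R ^+ 2) * \sum_(k < L.+1) profile L k ^+ 2 <=
  2 * \sum_(k < L) profile L k.+1 * profile L k.
Proof.
case: L => // L _; rewrite sum_profile_sqr big_ord_recl mulr0 add0r.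
rewrite (eq_bigr (fun j : 'I_L => parab L.+1 j.+1 * parab L.+1 j / L.+1%:R ^+ 4)); last first.
  by move=> j _; rewrite /= mulf_div -exprD.
rewrite -mulr_suml.
(* The term added on the right is 0: it contains the right zero of the parabola. *)
have -> : \sum_(j < L) parab L.+1 j.+1 * parab L.+1 j = \sum_(j < L.+1) parab L.+1 j.+1 * parab L.+1 j.
  by rewrite [RHS]big_ord_recr /= /parab subrr mulr0 mul0r addr0.
rewrite sum_parab_nextE.
have : 1 <= L.+1%:R :> R by rewrite ler1n.
set x : R := _%:R => x1; have x0 : 0 < x by lra.
rewrite -subr_ge0.
have -> : 2 * (((x ^+ 5 - x) / 30 - (x ^+ 3 - x) / 6) / x ^+ 4) -
   (2 - 10 / x ^+ 2) * ((x ^+ 5 - x) / 30 / x ^+ 4) = (x ^+ 2 - 1) / (3 * x ^+ 5).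
  by field; rewrite gt_eqF.
rewrite divr_ge0 // ?subr_ge0 ?exprn_ege1 //.
by rewrite mulr_ge0 // exprn_ge0 // ltW.
Qed.

Lemma momS (m n k : nat) (s2 : R) :
  mom m s2 n.+1 k.+1 = (n.+1 * m)%:R * s2 * mom m s2 n k.
Proof. by rewrite /mom ffactSS !exprS !natrM; ring. Qed.

Lemma momSr (m n k : nat) (s2 : R) :
  mom m s2 n k.+1 = s2 * m%:R * (n - k)%:R * mom m s2 n k.
Proof. by rewrite /mom ffactnSr !exprS natrM; ring. Qed.

Lemma mom_gt0 (m n k : nat) (s2 : R) : (0 < m)%N -> 0 < s2 -> (k <= n)%N -> 0 < mom m s2 n k.
Proof.
by move=> m0 s0 kn; rewrite /mom !mulr_gt0 ?exprn_gt0 ?ltr0n // ffact_gt0.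
Qed.

Section Profile.
Context (N m L : nat) (s2 q : R).
Hypotheses (L_gt0 : (0 < L)%N) (LN : (L < N)%N) (m_gt0 : (0 < m)%N) (s2_gt0 : 0 < s2) (q_ge0 : 0 <= q).
Hypothesis s2m_ge1 : 1 <= s2 * m%:R.
Hypothesis q_le : q ^+ 2 <= s2 * m%:R * (N - L)%:R.

(** Dividing by the root mean square of the path count makes the scaled counts orthonormal, so that
    sums over lengths become sums of [profile]. The cutoff restricts the bound [coeff_le1] to
    [k <= L], where [profile] lies between 0 and 1. *)
Definition coeff k : R := if (k <= L)%N then profile L k / Num.sqrt (mom m s2 N.-1 k) else 0.

Let kN k : (k <= L)%N -> (k <= N.-1)%N.
Proof. by move=> kL; rewrite -ltnS prednK; [exact: leq_ltn_trans kL LN | exact: leq_ltn_trans LN]. Qed.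

Let momk k : (k <= L)%N -> 0 < mom m s2 N.-1 k.
Proof. by move=> /kN; exact: mom_gt0. Qed.

Let momN k : mom m s2 N.-1 k.+1 = (N.-1 * m)%:R * s2 * mom m s2 N.-2 k.
Proof.
have N1 : (0 < N.-1)%N by rewrite -subn1 subn_gt0 (leq_ltn_trans L_gt0 LN).
by have := momS m N.-2 k s2; rewrite prednK.
Qed.

Lemma coeff0 : coeff 0 = 0.
Proof. by rewrite /coeff mul0r. Qed.

Lemma coeff1 : coeff 1 = 0.
Proof. by rewrite /coeff; case: ifP => // _; rewrite /profile /parab !mul0r. Qed.

Lemma coeff_le1 k : `|coeff k| <= 1.
Proof.
rewrite /coeff; case: ifP => [kL|_]; last by rewrite normr0.
have kL1 : (k <= L.+1)%N by exact: leqW.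
rewrite ger0_norm ?divr_ge0 ?profile_ge0 ?sqrtr_ge0 //.
have m0 := momk kL.
rewrite ler_pdivrMr ?sqrtr_gt0 // mul1r.
apply: (@le_trans _ _ 1); first exact: profile_le1.
rewrite -[leLHS]sqrtr1 ler_sqrt // ?(ltW m0) //.
rewrite /mom -exprMn -[leLHS]mulr1; apply: ler_pM => //; first exact: exprn_ege1.
by rewrite ler1n ffact_gt0 kN.
Qed.

Lemma coeff_sqr k : (k <= L)%N -> coeff k ^+ 2 * mom m s2 N.-1 k = profile L k ^+ 2.
Proof.
move=> kL; have m0 := momk kL.
by rewrite /coeff kL expr_div_n sqr_sqrtr ?ltW // divfK // gt_eqF.
Qed.

Lemma coeff_sum1 : \sum_(k < L.+1) coeff k ^+ 2 * mom m s2 N.-1 k = \sum_(k < L.+1) profile L k ^+ 2.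
Proof. by apply: eq_bigr => k _; rewrite coeff_sqr // -ltnS. Qed.

Lemma coeff_sum3 : s2 * ((N.-1 * m)%:R * \sum_(k < L) coeff k.+1 ^+ 2 * mom m s2 N.-2 k) =
  \sum_(k < L.+1) profile L k ^+ 2.
Proof.
rewrite big_ord_recl expr0n add0r !mulr_sumr; apply: eq_bigr => k _.
transitivity (coeff k.+1 ^+ 2 * mom m s2 N.-1 k.+1); last by rewrite coeff_sqr.
by rewrite momN; ring.
Qed.

(** One more step multiplies the root mean square of the path count by
    [sqrt (s2 * m * (N - 1 - k))], which is at least [q]. With [q] close to [sqrt d], this is the
    source of the value [2 sqrt d]. *)
Lemma coeff_sum2 : 2 * q * (\sum_(k < L) profile L k.+1 * profile L k) <=
  (N.-1 * m)%:R * (2 * s2 * \sum_(k < L) coeff k.+1 * coeff k * mom m s2 N.-2 k).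
Proof.
set T := \sum_(k < L) coeff k.+1 * coeff k * _.
have -> : (N.-1 * m)%:R * (2 * s2 * T) = 2 * ((N.-1 * m)%:R * (s2 * T)) by ring.
rewrite -[2 * q * _]mulrA ler_pM2l // /T !mulr_sumr; apply: ler_sum => k _.
have kL : (k <= L)%N by exact: ltnW.
have kL' : (k.+1 <= L)%N by [].
have m0 := momk kL; have m1 := momk kL'.
have -> : (N.-1 * m)%:R * (s2 * (coeff k.+1 * coeff k * mom m s2 N.-2 k)) =
    coeff k.+1 * coeff k * mom m s2 N.-1 k.+1.
  by rewrite momN; ring.
rewrite /coeff kL kL'.
have p0 : 0 <= profile L k.+1 * profile L k by rewrite mulr_ge0 ?profile_ge0 // leqW.
have E : profile L k.+1 / Num.sqrt (mom m s2 N.-1 k.+1) *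
   (profile L k / Num.sqrt (mom m s2 N.-1 k)) * mom m s2 N.-1 k.+1 =
   profile L k.+1 * profile L k * (Num.sqrt (mom m s2 N.-1 k.+1) / Num.sqrt (mom m s2 N.-1 k)).
  rewrite -[X in _ * X = _](sqr_sqrtr (ltW m1)).
  by field; rewrite !gt_eqF ?sqrtr_gt0.
rewrite E mulrC ler_wpM2l // ler_pdivlMr ?sqrtr_gt0 //.
rewrite -(ger0_norm q_ge0) -sqrtr_sqr -sqrtrM ?sqr_ge0 // ler_sqrt ?(ltW m1) //.
rewrite momSr ler_wpM2r ?(ltW m0) //; apply: le_trans q_le _.
rewrite ler_wpM2l ?mulr_ge0 ?(ltW s2_gt0) // ler_nat.
by rewrite -subn1 -subnDA add1n leq_sub2l.
Qed.

End Profile.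
End Asymptotics.

(** * Choice of the parameters for one clique *)

Section BlockLargeDeviation.
Context (R : realType).

Lemma nat_above (y : R) : exists n : nat, forall d : nat, (n <= d)%N -> y <= d%:R.
Proof.
exists (Num.bound `|y|) => d; rewrite -(ler_nat R); apply: le_trans.
by apply: le_trans (ler_norm _) (ltW (archi_boundP _)).
Qed.

Lemma lt_sum4 (a b c e d : nat) : (a + b + c + e < d)%N ->
  [/\ (a <= d)%N, (b <= d)%N, (c <= d)%N, (e <= d)%N & (0 < d)%N].
Proof. by move=> h; split; lia. Qed.

Lemma profile_sum_ge (L : nat) : (2 <= L)%N -> 1 / 30 <= \sum_(k < L.+1) profile R L k ^+ 2.
Proof.
move=> L2; rewrite sum_profile_sqr.
have : 2 <= L%:R :> R by rewrite ler_nat.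
set y : R := L%:R => y2; have y0 : 0 < y by lra.
have y3 : 1 <= y ^+ 3 by rewrite exprn_ege1 //; lra.
rewrite ler_pdivlMr ?exprn_gt0 //.
have : 0 <= y ^+ 4 * (y - 2) by rewrite mulr_ge0 ?exprn_ge0 //; lra.
have -> : y ^+ 4 * (y - 2) = y ^+ 5 - 2 * y ^+ 4 by ring.
have : 0 <= y * (y ^+ 3 - 1) by rewrite mulr_ge0 //; lra.
have -> : y * (y ^+ 3 - 1) = y ^+ 4 - y by ring.
by lra.
Qed.

(* With [a = 1 / x ^ 4] the losses are at most [16 a] while the gain is at least [18 a]. *)
Lemma gain_beats_loss (x a K4 r s N th m q : R) :
  2 <= x -> a * x ^+ 4 = 1 -> N = x ^+ 6 -> 0 < K4 -> 0 < r -> 0 < s -> 18 * 64 * K4 <= r * x ->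
  th * s = r * x ^+ 3 / 4 -> s ^+ 2 / (2 * N) <= m - 1 -> q = (1 - 3 * a) * s ->
  a * s <= q * (2 - 10 * a) + (m - 1) * (th / (8 * K4)) - (2 + a) * s.
Proof.
move=> x2 ax NE K0 r0 s0 xr ths mN qE.
have x0 : 0 < x by lra.
have a0 : 0 < a by rewrite -(pmulr_lgt0 _ (exprn_gt0 4 x0)) ax.
have N0 : 0 < N by rewrite NE exprn_gt0.
have th0 : 0 < th by rewrite -(pmulr_lgt0 _ s0) ths; rewrite !mulr_gt0 ?exprn_gt0 ?invr_gt0.
have gain : 18 * a * s <= (m - 1) * (th / (8 * K4)).
  apply: (@le_trans _ _ (s ^+ 2 / (2 * N) * (th / (8 * K4)))); last first.
    by rewrite ler_wpM2r // divr_ge0 ?mulr_ge0 // ltW.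
  have -> : s ^+ 2 / (2 * N) * (th / (8 * K4)) = s * (th * s) / (16 * N * K4).
    by field; rewrite !gt_eqF.
  rewrite ths ler_pdivlMr ?mulr_gt0 // NE.
  have -> : 18 * a * s * (16 * x ^+ 6 * K4) = s * x ^+ 2 / 4 * (a * x ^+ 4) * (18 * 64 * K4) by field.
  have -> : s * (r * x ^+ 3 / 4) = s * x ^+ 2 / 4 * (r * x) by field.
  by rewrite ax mulr1 ler_wpM2l // divr_ge0 ?mulr_ge0 ?exprn_ge0 // ltW.
have : 0 <= s * a ^+ 2 by rewrite mulr_ge0 ?exprn_ge0 // ltW.
have -> : q * (2 - 10 * a) = 2 * s - 16 * a * s + 30 * (s * a ^+ 2) by rewrite qE; ring.
by lra.
Qed.

(** Three factors [1 - a] are lost: to the variance, to the visited parts, and to the vertices left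
    over when the clique is cut into equal parts. Their product is at least [1 - 3 * a], hence at
    least its square. *)
Lemma q_bound (a s2 d M N : R) : 0 < a -> a <= 1 / 16 -> 1 - a <= s2 -> 0 < d ->
  d <= M + N -> N <= a * d -> (1 - 3 * a) ^+ 2 * d <= s2 * (1 - a) * M.
Proof.
move=> a0 a16 s2a d0 dM Nad.
apply: (@le_trans _ _ ((1 - a) * (1 - a) * ((1 - a) * d))).
  rewrite mulrA ler_wpM2r ?(ltW d0) //.
  have : 0 <= a * (1 - 3 * a) by apply: mulr_ge0; lra.
  have : 0 <= a ^+ 2 * (3 - a) by rewrite mulr_ge0 ?sqr_ge0 //; lra.
  have -> : (1 - a) * (1 - a) * (1 - a) = (1 - 3 * a) + a ^+ 2 * (3 - a) by ring.
  have -> : (1 - 3 * a) ^+ 2 = (1 - 3 * a) - 3 * (a * (1 - 3 * a)) by ring.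
  by lra.
have dd : (1 - a) * d <= M by lra.
apply: ler_pM => //; first by apply: mulr_ge0; lra.
  by apply: mulr_ge0; lra.
by rewrite ler_wpM2r //; lra.
Qed.

Lemma mul_ge1 (s m : R) : 1 / 2 <= s -> 2 <= m -> 1 <= s * m.
Proof.
move=> sh mh; have : 0 <= (s - 1 / 2) * (m - 2) by apply: mulr_ge0; lra.
have -> : (s - 1 / 2) * (m - 2) = s * m - 2 * s - m / 2 + 1 by field.
by lra.
Qed.

(** By [1 + u <= exp u] the exponent is at most [(N * m) ^ 2 * s2 * th ^ 2 / N], and
    [th ^ 2 * d = r ^ 2 * N / 16] cancels [N]: the cost per unit of [d] depends on [r] alone. *)
Lemma tilt_cost (x r d th s s2 : R) (N m : nat) : 0 < x -> N%:R = x ^+ 6 -> 0 < r ->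
  1 <= d -> s ^+ 2 = d -> 0 < s -> th * s = r * x ^+ 3 / 4 -> 0 <= s2 -> s2 <= 2 ->
  N%:R * m%:R <= d + 1 -> (1 + th ^+ 2 * s2) ^+ (N * m * m) <= expR (r ^+ 2 / 2 * d).
Proof.
move=> x0 NE r0 d1 sE s0 ths s20 s22 Nm.
have d0 : 0 < d by lra.
have N0 : 0 < N%:R :> R by rewrite NE exprn_gt0.
apply: (@le_trans _ _ (expR (th ^+ 2 * s2) ^+ (N * m * m))).
  apply: lerXn2r; rewrite ?nnegrE ?expR_ge0 ?expR_ge1Dx //.
  by apply: addr_ge0 => //; apply: mulr_ge0 => //; exact: sqr_ge0.
rewrite -expRM_natl ler_expR.
have thE : th ^+ 2 * d = r ^+ 2 * N%:R / 16 by rewrite NE -sE -exprMn ths; field.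
have N_neq0 : N%:R != 0 :> R by rewrite gt_eqF.
have d_neq0 : d != 0 by rewrite gt_eqF.
have -> : (N * m * m)%:R * (th ^+ 2 * s2) = (N%:R * m%:R) ^+ 2 * s2 * (th ^+ 2 * d) / (N%:R * d).
  by rewrite !natrM; field; rewrite N_neq0 d_neq0.
have -> : (N%:R * m%:R) ^+ 2 * s2 * (th ^+ 2 * d) / (N%:R * d) =
    r ^+ 2 / (16 * d) * ((N%:R * m%:R) ^+ 2 * s2).
  by rewrite thE; field; rewrite N_neq0 d_neq0.
have -> : r ^+ 2 / 2 * d = r ^+ 2 / (16 * d) * ((2 * d) ^+ 2 * 2) by field.
rewrite ler_wpM2l ?divr_ge0 ?sqr_ge0 ?mulr_ge0 ?(ltW d0) //.
apply: ler_pM; rewrite ?sqr_ge0 // lerXn2r ?nnegrE ?mulr_ge0 ?(ltW d0) //.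
by lra.
Qed.

(** As [L] is fixed, the crude bounds on the test vector cost only a power of [d]. *)
Lemma test_vector_bound (d Y Z : R) (L : nat) : 1 <= d -> 0 <= Y -> Y <= 2 * d -> 0 <= Z -> Z <= d ->
  (Y ^+ 2 * (Z * (L.+1%:R * (Z * Y) ^+ L) ^+ 2)) ^+ 2 <=
  (4 * L.+1%:R ^+ 2 * 4 ^+ L) ^+ 2 * d ^+ ((4 * L + 3) * 2).
Proof.
move=> d1 Y0 Yd Z0 Zd; have d0 : 0 <= d by lra.
have d20 : 0 <= 2 * d by rewrite mulr_ge0.
rewrite exprM -exprMn lerXn2r ?nnegrE ?mulr_ge0 ?exprn_ge0 ?mulr_ge0 ?exprn_ge0 ?mulr_ge0 //.
have -> : 4 * L.+1%:R ^+ 2 * 4 ^+ L * d ^+ (4 * L + 3) =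
    (2 * d) ^+ 2 * (d * (L.+1%:R * (d * (2 * d)) ^+ L) ^+ 2).
  have -> : (4 : R) ^+ L = (2 ^+ L) ^+ 2.
    by rewrite -exprM mulnC exprM; congr (_ ^+ L); ring.
  have -> : d ^+ (4 * L + 3) = (d ^+ L) ^+ 4 * d ^+ 3 by rewrite exprD mulnC exprM.
  have -> : (d * (2 * d)) ^+ L = 2 ^+ L * (d ^+ L) ^+ 2.
    by rewrite mulrCA exprMn -exprM mulnC exprM expr2.
  by ring.
have ZY : (Z * Y) ^+ L <= (d * (2 * d)) ^+ L.
  by apply: lerXn2r; rewrite ?nnegrE ?mulr_ge0 // ler_pM.
apply: ler_pM; first exact: sqr_ge0.
- by apply: mulr_ge0 => //; exact: sqr_ge0.
- by apply: lerXn2r; rewrite ?nnegrE.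
apply: ler_pM => //; first exact: sqr_ge0.
by apply: lerXn2r; rewrite ?nnegrE ?mulr_ge0 ?exprn_ge0 ?mulr_ge0 // ler_wpM2l.
Qed.

(** One factor [E] pays for the second moment of the density, the other for the polynomial
    bounds. *)
Lemma final_bound (del del0 Y2 P G A D E : R) : 0 < del0 -> del0 <= del ->
  del ^+ 2 <= Y2 * P * G -> 0 <= G -> 0 <= Y2 -> Y2 <= A * D -> 0 <= P -> P <= E -> 0 < E ->
  A / del0 ^+ 2 * D <= E -> E^-1 ^+ 2 <= G.
Proof.
move=> d0 dd H G0 Y0 YA P0 PE E0 AE.
have E2 : 0 < E ^+ 2 by rewrite exprn_gt0.
rewrite exprVn -div1r ler_pdivrMr // -(ler_pM2l (exprn_gt0 2 d0)) mulr1.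
have dd2 : del0 ^+ 2 <= del ^+ 2 by rewrite lerXn2r ?nnegrE ?(le_trans (ltW d0)) // ltW.
apply: le_trans dd2 _; apply: le_trans H _.
have -> : del0 ^+ 2 * (G * E ^+ 2) = del0 ^+ 2 * E * E * G by ring.
rewrite ler_wpM2r //; apply: ler_pM => //; apply: le_trans YA _.
have -> : A * D = del0 ^+ 2 * (A / del0 ^+ 2 * D) by field; rewrite gt_eqF.
by rewrite ler_wpM2l ?exprn_ge0 // ltW.
Qed.

(** All parameters derive from one integer [l]: [L = l ^ 2], [N = l ^ 6], and [a = l ^ -4] serves as
    both [eps] and [eta]. They are fixed before the discrete law, which varies with [d] and has to
    comply with [kappa] and [eta]. *)
Lemma block_large_deviation (K4 r : R) : 12 <= K4 -> 0 < r ->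
  exists (N : nat) (eps kappa eta : R) (d0 : nat),
  [/\ (0 < N)%N, 0 < eps, 0 < kappa, 0 < eta &
  forall d, (d0 <= d)%N ->
  forall (I V : finType) (p : I -> V -> R) (val : V -> R)
    (e : 'I_N * 'I_(d.+1 %/ N) -> 'I_N * 'I_(d.+1 %/ N) -> I) (s2 : R),
  law p -> (forall x y, e x y = e y x) ->
  (forall x y x' y', e x y = e x' y' -> (x = x' /\ y = y') \/ (x = y' /\ y = x')) ->
  (forall x y, x != y -> standard p val s2 K4 (e x y)) ->
  1 - eta <= s2 -> s2 <= 2 -> (forall v, `|val v| <= kappa * Num.sqrt d%:R) ->
  expR (- (r ^+ 2 * d%:R)) <= Ex p (fun w => `[< exists u,
     (2 + eps) * Num.sqrt d%:R * (\sum_x u x ^+ 2) < qform val e w u >]%:R)].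
Proof.
move=> K12 r0.
have K0 : 0 < K4 by lra.
(* 64 is [2 * 4 * 8], from [m - 1 >= d / (2 N)], from [theta] and from the constant [1 / (8 K4)] of
   [Ex_norm_tvec]; 18 is the gain required, in units of [a]. *)
have [l l2 lr] : exists2 l : nat, (2 <= l)%N & 18 * 64 * K4 <= r * l%:R.
  have [n Hn] := nat_above (18 * 64 * K4 / r); exists n.+2 => //.
  by rewrite (mulrC r) -ler_pdivrMr // Hn // ltnW // ltnW.
have x2 : 2 <= l%:R :> R by rewrite ler_nat.
have natX k : (l ^ k)%:R = l%:R ^+ k :> R by rewrite natrX.
move: (l%:R) lr x2 natX => x xr x2 natX.
have x0 : 0 < x by lra.
have [a a0 ax] : exists2 a, 0 < a & a * x ^+ 4 = 1.
  by exists (x ^+ 4)^-1; rewrite ?invr_gt0 ?exprn_gt0 // mulVf // gt_eqF // exprn_gt0.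
have a16 : a <= 1 / 16.
  have : a * 2 ^+ 4 <= a * x ^+ 4 by rewrite ler_wpM2l ?(ltW a0) // lerXn2r // nnegrE; lra.
  by rewrite ax; lra.
have [L L2 LE] : exists2 L : nat, (2 <= L)%N & L%:R = x ^+ 2 :> R.
  by exists (l ^ 2)%N; rewrite ?natX // (leq_trans l2) // -mulnn leq_pmulr // ltnW.
have NE : (L ^ 3)%:R = x ^+ 6 :> R by rewrite natrX LE -exprM.
have LN : (L < L ^ 3)%N by rewrite -[X in (X < _)%N]expn1 ltn_exp2l.
have N_gt0 : (0 < L ^ 3)%N by rewrite expn_gt0 ltnW.
move: (L ^ 3)%N NE LN N_gt0 => N NE LN N_gt0.
pose theta := r * x ^+ 3 / 4.
have theta0 : 0 < theta by rewrite /theta !mulr_gt0 ?exprn_gt0 ?invr_gt0.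
(* The tilt is [theta / sqrt d], so entries up to [sqrt d / theta] keep the density nonnegative. *)
pose kappa := theta^-1.
have kappa0 : 0 < kappa by rewrite invr_gt0.
have [|d1 Hd1] := @expR_dominates_pow R ((4 * L.+1%:R ^+ 2 * 4 ^+ L) ^+ 2 / (a / 30) ^+ 2)
  (r ^+ 2 / 2) ((4 * L + 3) * 2).
  by rewrite divr_gt0 // exprn_gt0.
have [d2 Hd2] := nat_above (kappa ^+ 2).
have [d3 Hd3] := nat_above (2 / kappa).
(* The last summand gives [4 * N <= d], hence [m >= 2], and [N * L ^ 2 <= d], that is
   [N <= a * d]. *)
exists N, a, kappa, a, (d1 + d2 + d3 + 4 * N * L ^ 2).+1; split=> // d dd.
have [dd1 dd2 dd3 DN d_gt0] := lt_sum4 dd.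
have D2 : kappa ^+ 2 <= d%:R by exact: Hd2.
have D3 : 2 / kappa <= d%:R by exact: Hd3.
have L_gt0 : (0 < L)%N by exact: ltnW.
have DN4 : (4 * N <= d)%N by apply: leq_trans DN; rewrite leq_pmulr // expn_gt0 L_gt0.
set m := (d.+1 %/ N)%N.
have mN : (N * m <= d.+1)%N by rewrite mulnC leq_trunc_div.
have mN' : (d.+1 < N * m + N)%N by rewrite addnC -mulnS mulnC ltn_ceil.
have m2 : (2 <= m)%N by rewrite leq_divRL // (leq_trans _ (leqW DN4)) // leq_mul2r orbT.
move=> I V p val e s2 lp e_sym e_inj e_std s2_lo s2_hi val_le.
pose s : R := Num.sqrt d%:R.
have dR0 : 0 < d%:R :> R by rewrite ltr0n.
have s0 : 0 < s by rewrite sqrtr_gt0.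
have sE : s ^+ 2 = d%:R by rewrite sqr_sqrtr // ltW.
have dR1 : 1 <= d%:R :> R by rewrite ler1n.
have s1 : 1 <= s by rewrite -[leLHS]sqrtr1 ler_sqrt // ltW.
pose th := theta / s.
have th0 : 0 < th by rewrite divr_gt0.
have s2_gt0 : 0 < s2 by lra.
pose q := (1 - 3 * a) * s.
have q0 : 0 <= q by rewrite mulr_ge0 ?(ltW s0) //; lra.
have NR0 : 0 < N%:R :> R by rewrite ltr0n.
have mNR : N%:R * m%:R <= d%:R + 1 :> R by rewrite -natrM natr1 ler_nat.
have mNR' : d%:R <= N%:R * m%:R + N%:R :> R by rewrite -natrM -natrD ler_nat ltnW // ltnW.
have DNR : 4 * N%:R <= d%:R :> R by rewrite -natrM ler_nat.
have DNa : N%:R <= a * d%:R.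
  have : (N * L ^ 2)%:R <= d%:R :> R by rewrite ler_nat (leq_trans _ DN) // leq_mul2r leq_pmull ?orbT.
  rewrite natrM natrX LE -exprM => H.
  have : a * (N%:R * x ^+ (2 * 2)) <= a * d%:R by rewrite ler_wpM2l // ltW.
  by rewrite mulrCA ax mulr1.
have LNa : L%:R = a * N%:R.
  have -> : a * N%:R = a * x ^+ 4 * x ^+ 2 by rewrite NE; ring.
  by rewrite ax mul1r.
have s2h : 1 / 2 <= s2 by lra.
have s2m1 : 1 <= s2 * m%:R by rewrite mul_ge1 // ler_nat.
have q_le : q ^+ 2 <= s2 * m%:R * (N - L)%:R.
  rewrite natrB ?(ltnW LN) // LNa exprMn sE.
  have -> : s2 * m%:R * (N%:R - a * N%:R) = s2 * (1 - a) * (N%:R * m%:R) by ring.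
  exact: (@q_bound a s2 _ _ N%:R).
pose b := coeff N m L s2.
have m_gt0 : (0 < m)%N by exact: ltnW.
pose Z := kappa * s.
have Z0 : 0 < Z by rewrite mulr_gt0.
have ZX : 1 <= Z * (N * m)%:R.
  rewrite natrM; apply: (@le_trans _ _ (kappa * (d%:R / 2))).
    by rewrite -ler_pdivrMl // mulr1 ler_pdivlMr // mulrC.
  rewrite /Z -mulrA ler_wpM2l ?(ltW kappa0) //.
  apply: (@le_trans _ _ (1 * (N%:R * m%:R))); first by lra.
  by rewrite ler_wpM2r // mulr_ge0.
have [K4h thZ] : 3 * s2 ^+ 2 <= K4 /\ th * Z <= 1.
  split; last by rewrite /th /Z mulrACA mulfV ?mulVf ?mulr1 // gt_eqF.
  apply: le_trans K12; have : s2 ^+ 2 <= 2 ^+ 2 by apply: lerXn2r; rewrite ?nnegrE // ltW.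
  by rewrite -(ler_pM2l (ltr0Sn R 2)) => /le_trans; apply; rewrite expr2 -!natrM ler_nat.
have lam0 : 0 <= (2 + a) * s by apply: mulr_ge0; rewrite ?ltW // addr_gt0.
have := @Ex_good_event R I V p val N m e s2 K4 th Z L b lp e_sym e_inj e_std
  (coeff0 _ _ _ _) (coeff1 _ _ _ _) (coeff_le1 LN m_gt0 s2_gt0 s2m1)
  s2h K4h (ltW th0) val_le thZ ZX ((2 + a) * s) lam0.
rewrite /= /b (coeff_sum1 LN m_gt0 s2_gt0).
have := coeff_sum2 L_gt0 LN m_gt0 s2_gt0 q0 q_le.
have := coeff_sum3 L_gt0 LN m_gt0 s2_gt0.
have := sum_profile_next R L_gt0.
have := profile_sum_ge L2.
set F := \sum_(k < L.+1) profile R L k ^+ 2.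
set T2 := (N.-1 * m)%:R * (2 * s2 * _); set T3 := (N.-1 * m)%:R * _.
set S := \sum_(k < L) _; set G := Ex p _ => F30 FS T3E T2S.
have mp : m.-1%:R = m%:R - 1 :> R by rewrite -subn1 natrB.
have -> : m.-1%:R * (s2 * th * (1 / (8 * K4) * T3)) = (m%:R - 1) * (th / (8 * K4)) * F.
  by rewrite mp -T3E; field; rewrite gt_eqF.
have La : 10 / L%:R ^+ 2 = 10 * a.
  have x4 : x ^+ 4 != 0 by rewrite expf_neq0 // gt_eqF.
  by rewrite LE -exprM -[a](mulfK x4) ax mul1r.
have F0 : 0 < F by apply: lt_le_trans F30; rewrite divr_gt0.
have ths : th * s = r * x ^+ 3 / 4 by rewrite /th divfK // gt_eqF.
have mlow : s ^+ 2 / (2 * N%:R) <= m%:R - 1.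
  rewrite sE ler_pdivrMr ?mulr_gt0 //.
  have -> : (m%:R - 1) * (2 * N%:R) = 2 * (N%:R * m%:R) - 2 * N%:R :> R by ring.
  by move: mNR' DNR; clear; lra.
have NM0 : 1 <= (N * m)%:R :> R by rewrite ler1n muln_gt0 N_gt0.
set del := (N * m)%:R * _.
have del_ge : a / 30 <= del.
  have br : a * s * F <= T2 + (m%:R - 1) * (th / (8 * K4)) * F - (2 + a) * s * F.
    have h := gain_beats_loss x2 ax NE K0 r0 s0 xr ths mlow (erefl q).
    rewrite -(ler_pM2r F0) in h; apply: le_trans h _.
    rewrite mulrBl mulrDl lerD2r lerD2r; apply: le_trans T2S.
    rewrite La in FS; have -> : 2 * q * S = q * (2 * S) by ring.
    by rewrite -mulrA; exact: ler_wpM2l.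
  rewrite /del; apply: (@le_trans _ _ (1 * (a * s * F))); last first.
    by apply: ler_pM => //; rewrite !mulr_ge0 // ltW.
  rewrite mul1r -mulrA ler_pM2l //; apply: le_trans (_ : 1 * (1 / 30) <= _); first by rewrite mul1r div1r.
  by apply: ler_pM.
have a30 : 0 < a / 30 by rewrite divr_gt0.
move=> /(_ (le_trans (ltW a30) del_ge)) Hdel.
have -> : expR (- (r ^+ 2 * d%:R)) = (expR (r ^+ 2 / 2 * d%:R))^-1 ^+ 2 :> R.
  by rewrite -expRN -expRM_natl; congr expR; field.
have G0 : 0 <= G by apply: Ex_ge0 => // w; case: `[< _ >].
have Zd : Z <= d%:R.
  rewrite /Z -sE expr2 ler_pM2r // -(ler_pXn2r (n := 2)) ?nnegrE ?(ltW kappa0) ?(ltW s0) //.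
  by rewrite sE.
have Nmd : (N * m)%:R <= 2 * d%:R :> R by rewrite natrM; move: mNR dR1; clear; lra.
apply: (final_bound a30 del_ge Hdel G0 _ _ _ _ (expR_gt0 _) (Hd1 _ dd1)).
- exact: sqr_ge0.
- by apply: test_vector_bound => //; exact: ltW.
- by rewrite exprn_ge0 // addr_ge0 // mulr_ge0 ?sqr_ge0 // ltW.
- exact: (tilt_cost x0 NE r0 dR1 sE s0 ths (ltW s2_gt0) s2_hi mNR).
Qed.
End BlockLargeDeviation.

(** * Truncation and rounding of the entries *)

Section Discretization.
Context (dT : measure_display) (T : measurableType dT) (R : realType) (P : probability T R).

Local Notation Rint f := (Rintegral P setT f).

Lemma integrable_EFinD (f g : T -> R) : P.-integrable setT (EFin \o f) ->
  P.-integrable setT (EFin \o g) -> P.-integrable setT (EFin \o (fun w => f w + g w)).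
Proof.
move=> i1 i2; have -> : EFin \o (fun w => f w + g w) = ((EFin \o f) \+ (EFin \o g))%E.
  by apply/funext => w /=; rewrite EFinD.
exact: integrableD.
Qed.

Lemma Rint_simple (V : finType) (A : V -> set T) (h : V -> R) : (forall v, measurable (A v)) ->
  P.-integrable setT (EFin \o (fun w => \sum_v h v * \1_(A v) w)) /\
  Rint (fun w => \sum_v h v * \1_(A v) w) = \sum_v fine (P (A v)) * h v.
Proof.
move=> mA.
have i1 v : P.-integrable setT (EFin \o (fun w => h v * \1_(A v) w)).
  have -> : EFin \o (fun w => h v * \1_(A v) w) = (fun w => (h v)%:E * (EFin \o \1_(A v)) w)%E.
    by apply/funext => w /=; rewrite EFinM.
  by apply: integrableZl => //; exact: integrable_indic.
suff H (s : seq V) : P.-integrable setT (EFin \o (fun w => \sum_(v <- s) h v * \1_(A v) w)) /\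
  Rint (fun w => \sum_(v <- s) h v * \1_(A v) w) = \sum_(v <- s) fine (P (A v)) * h v.
  exact: H.
elim: s => [|v s [IH1 IH2]].
  have -> : (fun w : T => \sum_(v <- [::]) h v * \1_(A v) w) = cst 0.
    by apply/funext => w; rewrite big_nil.
  rewrite big_nil; split; first exact: finite_measure_integrable_cst.
  by rewrite Rintegral_cst // mul0r.
have E : (fun w => \sum_(k <- v :: s) h k * \1_(A k) w) =
   (fun w => h v * \1_(A v) w + \sum_(k <- s) h k * \1_(A k) w).
  by apply/funext => w; rewrite big_cons.
rewrite E big_cons; split; first exact: integrable_EFinD.
rewrite RintegralD // IH2; congr (_ + _).
rewrite RintegralZl //; last exact: integrable_indic.
by rewrite /Rintegral integral_indic // setIT mulrC.
Qed.

Lemma fiber_prob_sum (V : finType) (X : T -> R) (f : R -> V) : measurable_fun setT X ->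
  (forall v, measurable (f @^-1` [set v])) -> \sum_v fine (P (X @^-1` (f @^-1` [set v]))) = 1.
Proof.
move=> mX mf; have mc v : measurable (X @^-1` (f @^-1` [set v])).
  by rewrite -[Y in measurable Y]setTI; exact: mX.
have [_] := Rint_simple (fun=> 1) mc.
under [RHS]eq_bigr do rewrite mulr1.
move=> <-.
rewrite (_ : (fun w : T => _) = cst 1).
  rewrite Rintegral_cst // mul1r.
  by rewrite [Y in fine Y](_ : _ = 1%E) //; exact: probability_setT.
apply/funext => w; rewrite (bigD1 (f (X w))) //= big1 ?addr0 => [|v vi]; last first.
  by rewrite indicE memNset ?mulr0 // => E; case/eqP: vi; exact/esym.
by rewrite indicE mem_set // mulr1.
Qed.

Section Moments.
Context (xi : T -> R).
Hypotheses (xi_meas : measurable_fun setT xi)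
  (xi_4 : ('E_P[fun w => (xi w ^+ 4)%R] < +oo)%E)
  (xi_mean : ('E_P[xi] = 0)%E) (xi_var : ('V_P[xi] = 1)%E).

Let mX n : measurable_fun [set: T] (fun w => xi w ^+ n : R).
Proof. exact: measurable_funX. Qed.

Lemma integrable_moment4 : P.-integrable setT (EFin \o (fun w => xi w ^+ 4)).
Proof.
apply/integrableP; split; first exact/measurable_EFinP.
move: xi_4; rewrite unlock; congr (_ < _)%E; apply: eq_integral => w _ /=.
by rewrite ger0_norm // exprn_even_ge0.
Qed.

Lemma integrable_moment n : (n <= 4)%N -> P.-integrable setT (EFin \o (fun w => xi w ^+ n)).
Proof.
move=> n4.
apply: (@le_integrable _ _ _ P setT _ _ (EFin \o (fun w => 1 + xi w ^+ 4))) => //.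
- exact/measurable_EFinP.
- move=> w _ /=; rewrite lee_fin normrX.
  rewrite [leRHS]ger0_norm; last by rewrite addr_ge0 // exprn_even_ge0.
  have -> : xi w ^+ 4 = `|xi w| ^+ 4 by rewrite -normrX ger0_norm // exprn_even_ge0.
  have [h|h] := leP `|xi w| 1.
    by apply: (@le_trans _ _ 1); [exact: exprn_ile1 | rewrite lerDl exprn_ge0].
  by apply: (@le_trans _ _ (`|xi w| ^+ 4)); [rewrite ler_weXn2l // ltW | rewrite lerDr].
- apply: integrable_EFinD; last exact: integrable_moment4.
  exact: finite_measure_integrable_cst.
Qed.

Lemma Rint_moment1 : Rint (fun w => xi w ^+ 1) = 0.
Proof.
by move: xi_mean; rewrite unlock /Rintegral => ->.
Qed.

Lemma Rint_moment2 : Rint (fun w => xi w ^+ 2) = 1.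
Proof.
move: xi_var; rewrite /variance unlock xi_mean /= unlock => h.
rewrite /Rintegral -[RHS]/(fine 1%:E) -h; congr fine; apply: eq_integral => w _.
by congr (_%:E); rewrite -[RHS]/((xi w - 0) * (xi w - 0)) subr0 expr2.
Qed.

Let K := Rint (fun w => xi w ^+ 4).

Lemma moment4_ge0 : 0 <= K.
Proof. by apply: Rintegral_ge0 => w _; rewrite exprn_even_ge0. Qed.

(** The common source of the estimates for the rounded variable: a majorant in [x], [x ^ 2], [x ^ 4]
    integrates to the right-hand side, because [xi] has mean 0 and variance 1. *)
Lemma discrete_moment_le (V : finType) (idx : R -> V) (h : V -> R) (a b c e : R) :
  (forall v, measurable (idx @^-1` [set v])) ->
  (forall x, h (idx x) <= a * x + b * x ^+ 2 + c * x ^+ 4 + e) ->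
  \sum_v fine (P (xi @^-1` (idx @^-1` [set v]))) * h v <= b + c * K + e.
Proof.
move=> mi hle.
have mA v : measurable (xi @^-1` (idx @^-1` [set v])).
  by rewrite -[X in measurable X]setTI; exact: xi_meas.
have [I1 E1] := Rint_simple h mA; rewrite -E1.
have iZ (n : nat) (k : R) : (n <= 4)%N -> P.-integrable setT (EFin \o (fun w => k * xi w ^+ n)).
  move=> n4; have -> : EFin \o (fun w => k * xi w ^+ n) = (fun w => k%:E * (xi w ^+ n)%:E)%E.
    by apply/funext => w /=; rewrite EFinM.
  by apply: integrableZl => //; exact: integrable_moment.
have ic : P.-integrable setT (EFin \o (fun=> e)) by exact: finite_measure_integrable_cst.
have -> : b + c * K + e = Rint (fun w => a * xi w ^+ 1 + b * xi w ^+ 2 + c * xi w ^+ 4 + e).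
  rewrite !RintegralD //; do ?[apply: integrable_EFinD | exact: iZ | by []].
  rewrite !RintegralZl //; do ?exact: integrable_moment.
  rewrite Rint_moment1 Rint_moment2 -/K mulr0 add0r mulr1 Rintegral_cst //.
  by rewrite [X in fine X](_ : _ = 1%E) ?mulr1 //; exact: probability_setT.
apply: le_Rintegral => //; first by do ?[apply: integrable_EFinD | exact: iZ | by []].
move=> w _.
rewrite (bigD1 (idx (xi w))) //= big1 ?addr0 => [|v vi]; last first.
  rewrite indicE memNset ?mulr0 // => E; case/eqP: vi; exact/esym.
by rewrite indicE mem_set // mulr1; exact: hle.
Qed.

End Moments.
End Discretization.

Section Discretize.
Context (dT : measure_display) (T : measurableType dT) (R : realType) (P : probability T R).
Context (xi : T -> R).
Hypotheses (xi_meas : measurable_fun setT xi)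
  (xi_4 : ('E_P[fun w => (xi w ^+ 4)%R] < +oo)%E)
  (xi_mean : ('E_P[xi] = 0)%E) (xi_var : ('V_P[xi] = 1)%E).

Let K := Rintegral P setT (fun w => xi w ^+ 4).

Section Grid.
Context (r : nat) (Tr del : R).

Definition grid (i : nat) : R := i%:R * del - Tr.

Definition cell (x : R) : option 'I_r := [pick i : 'I_r | grid i <= x < grid i.+1].

Definition rep (v : option 'I_r) : R := if v is Some i then grid i else 0.

Definition mass (v : option 'I_r) : R := fine (P (xi @^-1` (cell @^-1` [set v]))).

Hypotheses (Tr_gt0 : 0 < Tr) (del_gt0 : 0 < del).
Hypotheses (r_lo : 2 * Tr < r%:R * del) (r_hi : r%:R * del <= 2 * Tr + del).

Lemma gridS i : grid i.+1 = grid i + del.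
Proof. by rewrite /grid -natr1; ring. Qed.

Lemma cell_Some x i : cell x = Some i <-> grid i <= x < grid i.+1.
Proof.
rewrite /cell; split; first by case: pickP => // j gj [<-].
move=> gi; case: pickP => [j gj|/(_ i)]; last by rewrite gi.
congr Some; apply/val_inj/eqP => /=.
have lt_S (k l : nat) : grid k <= x < grid k.+1 -> grid l <= x < grid l.+1 -> (k <= l)%N.
  move=> /andP[kx _] /andP[_ xl]; rewrite -ltnS -(ltr_nat R) -(ltr_pM2r del_gt0).
  by rewrite -(ltrD2r (- Tr)); exact: le_lt_trans kx xl.
by rewrite eqn_leq !lt_S.
Qed.

Lemma cell_dist x : cell x != None -> `|x - rep (cell x)| <= del.
Proof.
case E: (cell x) => [i|] // _; move/cell_Some: E; rewrite gridS /= => /andP[h1 h2].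
by rewrite ger0_norm; lra.
Qed.

Lemma cell_None x : cell x = None -> Tr <= `|x|.
Proof.
move=> xN; rewrite leNgt; apply/negP; rewrite ltr_norml => /andP[xl xr].
have xT : 0 <= (x + Tr) / del by rewrite divr_ge0 // ?(ltW del_gt0) // -lerBlDr sub0r ltW.
pose i := Num.trunc ((x + Tr) / del).
have /andP[i1 i2] := truncn_itv xT.
have ir : (i < r)%N.
  rewrite -(ltr_nat R); apply: le_lt_trans i1 _; rewrite ltr_pdivrMr //; move: r_lo xr; lra.
have : cell x = Some (Ordinal ir).
  apply/cell_Some => /=; rewrite /grid lerBlDr ltrBrDr -ler_pdivlMr // -ltr_pdivrMr //.
  by rewrite i1 i2.
by rewrite xN.
Qed.

Lemma rep_le v : `|rep v| <= Tr + del.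
Proof.
case: v => [i|] /=; last by rewrite normr0 addr_ge0 ?ltW.
have : i.+1%:R * del <= r%:R * del by rewrite ler_pM2r // ler_nat.
have : 0 <= i%:R * del by rewrite mulr_ge0 // ltW.
rewrite ler_norml /grid -natr1 mulrDl mul1r => h1 h2.
by apply/andP; split; move: Tr_gt0 del_gt0 r_lo r_hi; lra.
Qed.

Lemma measurable_cell v : measurable (cell @^-1` [set v]).
Proof.
have mS i : measurable (cell @^-1` [set Some i]).
  rewrite (_ : cell @^-1` _ = `[grid i, grid i.+1[%classic); first exact: measurable_itv.
  by apply/seteqP; split => x /=; rewrite in_itv /= => /cell_Some.
case: v => [i|]; first exact: mS.
rewrite (_ : cell @^-1` _ = ~` \bigcup_(i in [set: 'I_r]) (cell @^-1` [set Some i])).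
  by apply: measurableC; apply: fin_bigcup_measurable.
apply/seteqP; split => x /=; first by move=> xN [i _ /=]; rewrite xN.
by move=> h; case E: (cell x) => [i|//]; case: h; exists i.
Qed.

Lemma mass_ge0 v : 0 <= mass v.
Proof. by rewrite fine_ge0. Qed.

Let dm := discrete_moment_le xi_meas xi_4 xi_mean xi_var.

Lemma mass_sum : \sum_v mass v = 1.
Proof. by apply: fiber_prob_sum => // v; exact: measurable_cell. Qed.

(** Markov's inequality in pointwise form, to be integrated by [discrete_moment_le]. *)
Lemma normX_pow (x : R) n k : Tr <= `|x| -> `|x| ^+ n <= `|x| ^+ (n + k) / Tr ^+ k.
Proof.
move=> Tx; rewrite ler_pdivlMr ?exprn_gt0 // exprD ler_wpM2l ?exprn_ge0 //.
by apply: lerXn2r; rewrite ?nnegrE // ltW.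
Qed.

Let pow4 (x : R) : x ^+ 4 = `|x| ^+ 4.
Proof. by rewrite -normrX ger0_norm // exprn_even_ge0. Qed.

Lemma mass_None : mass None <= K / Tr ^+ 4.
Proof.
have := @dm _ cell (fun v => (v == None)%:R) 0 0 (Tr ^+ 4)^-1 0 measurable_cell.
rewrite (bigD1 None) //= mulr1 big1 => [|v /negbTE ->]; last by rewrite mulr0.
rewrite add0r !addr0 mulrC; apply => x; rewrite !mul0r !add0r addr0 (pow4 x) mulrC.
case E: (cell x) => [i|] /=; first by apply: divr_ge0; apply: exprn_ge0 => //; exact: ltW.
by have := normX_pow 0 4 (cell_None E); rewrite expr0.
Qed.

Lemma mean_rep : `|\sum_v mass v * rep v| <= del + K / Tr ^+ 3.
Proof.
have h1 x : rep (cell x) <= 1 * x + 0 * x ^+ 2 + (Tr ^+ 3)^-1 * x ^+ 4 + del /\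
   - rep (cell x) <= (-1) * x + 0 * x ^+ 2 + (Tr ^+ 3)^-1 * x ^+ 4 + del.
  have q0 : 0 <= (Tr ^+ 3)^-1 * x ^+ 4.
    by rewrite mulr_ge0 ?exprn_even_ge0 // invr_ge0 exprn_ge0 // ltW.
  case E: (cell x) => [i|] /=.
    have := @cell_dist x; rewrite E /= => /(_ isT); rewrite ler_norml => /andP[]; lra.
  have := normX_pow 1 3 (cell_None E); rewrite expr1 -(pow4 x) mulrC => h.
  by move: h; rewrite ler_norml => /andP[]; move: del_gt0; lra.
have := dm measurable_cell (fun x => (h1 x).1).
have := dm (h := fun v => - rep v) measurable_cell (fun x => (h1 x).2).
rewrite -/K !add0r (mulrC _ K) (eq_bigr (fun v => - (mass v * rep v))); last first.
  by move=> v _; rewrite mulrN.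
by rewrite sumrN ler_norml /mass => h2 h3; apply/andP; split; lra.
Qed.

Lemma sq_rep : 1 - 2 * del - K / Tr ^+ 2 <= \sum_v mass v * rep v ^+ 2 <= 1 + 2 * del + del ^+ 2.
Proof.
have h1 x : rep (cell x) ^+ 2 <= 0 * x + (1 + del) * x ^+ 2 + 0 * x ^+ 4 + (del + del ^+ 2) /\
   - rep (cell x) ^+ 2 <= 0 * x + (del - 1) * x ^+ 2 + (Tr ^+ 2)^-1 * x ^+ 4 + del.
  have q0 : 0 <= (Tr ^+ 2)^-1 * x ^+ 4.
    by rewrite mulr_ge0 ?exprn_even_ge0 // invr_ge0 exprn_ge0 // ltW.
  have dx0 : 0 <= del * x ^+ 2 by rewrite mulr_ge0 ?sqr_ge0 // ltW.
  have d20 : 0 <= del ^+ 2 by exact: sqr_ge0.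
  case E: (cell x) => [i|] /=.
    have := @cell_dist x; rewrite E /= => /(_ isT).
    set y := x - grid i => yd; have -> : grid i = x - y by rewrite /y subKr.
    have xy : `|x * y| * 2 <= del * (1 + x ^+ 2).
      rewrite normrM; apply: (@le_trans _ _ (`|x| * del * 2)).
        by rewrite ler_pM2r // ler_wpM2l.
      have : 0 <= del * (`|x| - 1) ^+ 2 by rewrite mulr_ge0 ?sqr_ge0 // ltW.
      rewrite (_ : del * _ = del * (1 + `|x| ^+ 2) - `|x| * del * 2); last by ring.
      by rewrite real_normK ?num_real // subr_ge0.
    have y2 : y ^+ 2 <= del ^+ 2.
      by rewrite -(real_normK (num_real y)); apply: lerXn2r; rewrite ?nnegrE // ltW.
    have y20 := sqr_ge0 y.
    have := ler_norm (x * y); have := ler_norm (- (x * y)); rewrite normrN => n1 n2.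
    have -> : (x - y) ^+ 2 = x ^+ 2 - 2 * (x * y) + y ^+ 2 by ring.
    have e1 : del * (1 + x ^+ 2) = del + del * x ^+ 2 by ring.
    rewrite e1 in xy; rewrite !mul0r !add0r !mulrDl !mul1r mulN1r addr0.
    by split; lra.
  have := normX_pow 2 2 (cell_None E); rewrite /= -(pow4 x) real_normK ?num_real // mulrC => h.
  rewrite expr0n /= !mul0r !add0r !mulrDl !mul1r mulN1r oppr0 addr0.
  have := sqr_ge0 x; move: del_gt0; split; lra.
have := dm (h := fun v => rep v ^+ 2) measurable_cell (fun x => (h1 x).1).
have := dm (h := fun v => - rep v ^+ 2) measurable_cell (fun x => (h1 x).2).
rewrite -/K (mulrC _ K) (eq_bigr (fun v => - (mass v * rep v ^+ 2))); last first.
  by move=> v _; rewrite mulrN.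
by rewrite sumrN /mass => h2 h3; apply/andP; split; lra.
Qed.

Lemma four_rep : del <= 1 -> \sum_v mass v * rep v ^+ 4 <= 8 * K + 8.
Proof.
move=> d1.
have := dm (h := fun v => rep v ^+ 4) (a := 0) (b := 0) (c := 8) (e := 8) measurable_cell.
rewrite add0r; apply => x; rewrite !mul0r !add0r.
case E: (cell x) => [i|] /=; last by rewrite expr0n addr_ge0 // mulr_ge0 // exprn_even_ge0.
have := @cell_dist x; rewrite E /= => /(_ isT).
set y := x - grid i => yd; have -> : grid i = x - y by rewrite /y subKr.
have y4 : y ^+ 4 <= 1.
  by rewrite pow4; apply: exprn_ile1 => //; exact: le_trans yd d1.
(* Sum-of-squares certificate for [(x - y) ^ 4 <= 8 x ^ 4 + 8 y ^ 4]. *)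
have : 0 <= (x + y) ^+ 2 * (5 * (x - y) ^+ 2 + 2 * (x ^+ 2 + y ^+ 2)).
  apply: mulr_ge0; first exact: sqr_ge0.
  by apply: addr_ge0; apply: mulr_ge0 => //; rewrite ?addr_ge0 ?sqr_ge0.
have -> : (x + y) ^+ 2 * (5 * (x - y) ^+ 2 + 2 * (x ^+ 2 + y ^+ 2)) =
  8 * x ^+ 4 + 8 * y ^+ 4 - (x - y) ^+ 4 by ring.
by lra.
Qed.

End Grid.
End Discretize.

Section DiscretizeAsymptotics.
Context (R : realType).

Lemma sqrt_above (y : R) : exists n : nat, forall d : nat, (n <= d)%N -> y <= Num.sqrt d%:R.
Proof.
have [n Hn] := nat_above (y ^+ 2); exists n => d /Hn h.
apply: le_trans (ler_norm _) _.
by rewrite -sqrtr_sqr ler_sqrt.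
Qed.

Lemma div_exp_le (c t s : R) n : 0 <= c -> 0 < t -> 1 <= s -> c / t <= s -> (0 < n)%N ->
  c / s ^+ n <= t.
Proof.
move=> c0 t0 s1 cs; case: n => // n _.
rewrite ler_pdivrMr ?exprn_gt0 ?(lt_le_trans ltr01) //.
rewrite ler_pdivrMr // mulrC in cs; apply: le_trans cs _.
by rewrite ler_wpM2l ?(ltW t0) // exprS ler_peMr ?exprn_ege1 // (le_trans ler01).
Qed.

Context (dT : measure_display) (T : measurableType dT) (P : probability T R) (xi : T -> R).
Hypotheses (xi_meas : measurable_fun setT xi)
  (xi_4 : ('E_P[fun w => (xi w ^+ 4)%R] < +oo)%E)
  (xi_mean : ('E_P[xi] = 0)%E) (xi_var : ('V_P[xi] = 1)%E).

Let K := Rintegral P setT (fun w => xi w ^+ 4).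

Let K_ge0 : 0 <= K. Proof. exact: moment4_ge0. Qed.

(** The proof of [cond_four] needs [16 * (8 * K + 8) + 8]; the value is also above the 12 that
    [block_large_deviation] requires. *)
Definition K4_of : R := 200 * (K + 1).

Section Normalize.
Context (r : nat) (Tr del e0 : R).
Local Notation V := (option 'I_r).
Local Notation rp := (rep (r := r) Tr del).
Local Notation ms := (mass (r := r) P xi Tr del).
Hypotheses (Tr_gt0 : 0 < Tr) (del_gt0 : 0 < del).
Hypotheses (r_lo : 2 * Tr < r%:R * del) (r_hi : r%:R * del <= 2 * Tr + del).
Hypotheses (e0_gt0 : 0 < e0) (e0_le : e0 <= 1 / 16) (del_le : del <= e0)
  (KT2 : K / Tr ^+ 2 <= e0) (KT3 : K / Tr ^+ 3 <= e0) (KT4 : K / Tr ^+ 4 <= 1 / 4).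

Definition pi_ok : R := \sum_(v : V | v != None) ms v.
(** The law conditioned on falling into a cell. Keeping [None] with mass 0 leaves both laws on the
    same type, so that they can be compared value by value. *)
Definition cond_law (v : V) : R := if v is Some _ then ms v / pi_ok else 0.
Definition cond_mean : R := \sum_v cond_law v * rp v.
(** [standard] asks for mean exactly 0, which truncation and rounding destroy. The correction is
    [O(del + Tr ^ -3)], still negligible after multiplication by [sqrt d]. *)
Definition cond_val (v : V) : R := if v is Some _ then rp v - cond_mean else 0.

Lemma pi_okE : pi_ok = 1 - ms None.
Proof.
have := mass_sum P xi_meas r Tr del_gt0.
by rewrite (bigD1 None) //= => <-; rewrite addrAC subrr add0r.
Qed.

Lemma pi_ok_ge : 1 - K / Tr ^+ 4 <= pi_ok.
Proof. by rewrite pi_okE lerD2l lerN2; exact: mass_None. Qed.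

Lemma pi_ok_le1 : pi_ok <= 1.
Proof. by rewrite pi_okE gerBl; exact: mass_ge0. Qed.

Let pi_ge : 3 / 4 <= pi_ok.
Proof. by move: pi_ok_ge KT4; lra. Qed.

Let pi_gt0 : 0 < pi_ok.
Proof. by move: pi_ge; lra. Qed.

Lemma cond_law_ge0 v : 0 <= cond_law v.
Proof. by case: v => [i|] //=; rewrite divr_ge0 ?mass_ge0 // ltW. Qed.

Lemma pi_cond_law v : pi_ok * cond_law v <= ms v.
Proof.
case: v => [i|] /=; last by rewrite mulr0 mass_ge0.
by rewrite mulrCA divff ?mulr1 // gt_eqF.
Qed.

Lemma sum_cond (h : V -> R) :
  \sum_v cond_law v * h v = (\sum_(v | v != None) ms v * h v) / pi_ok.
Proof.
rewrite (bigD1 None) //= mul0r add0r mulr_suml; apply: eq_bigr => -[i|] //= _.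
by rewrite mulrAC.
Qed.

Lemma cond_law_sum : \sum_v cond_law v = 1.
Proof.
transitivity (\sum_v cond_law v * 1); first by apply: eq_bigr => v _; rewrite mulr1.
rewrite sum_cond; under eq_bigr do rewrite mulr1.
by rewrite divff // gt_eqF.
Qed.

Lemma sum_cond_rep n : (0 < n)%N -> \sum_v cond_law v * rp v ^+ n = (\sum_v ms v * rp v ^+ n) / pi_ok.
Proof.
move=> n0; rewrite sum_cond [in RHS](bigD1 None) //= expr0n.
by rewrite (gtn_eqF n0) mulr0 add0r.
Qed.

Lemma cond_mean_le : `|cond_mean| <= 2 * (del + K / Tr ^+ 3).
Proof.
have -> : cond_mean = (\sum_v ms v * rp v) / pi_ok.
  rewrite /cond_mean; have := @sum_cond_rep 1 isT.
  by under eq_bigr do rewrite expr1; under [in RHS]eq_bigr do rewrite expr1.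
have := mean_rep xi_meas xi_4 xi_mean xi_var Tr_gt0 del_gt0 r_lo; rewrite -/K => h.
rewrite normrM [`|pi_ok^-1|]ger0_norm ?invr_ge0 ?(ltW pi_gt0) // ler_pdivrMr //.
apply: le_trans h _; rewrite -mulrA mulrCA ler_peMr //.
  by rewrite addr_ge0 ?divr_ge0 ?exprn_ge0 // ltW.
by move: pi_ge; lra.
Qed.

Let mean_le : `|cond_mean| <= 4 * e0.
Proof. by apply: le_trans cond_mean_le _; move: del_le KT3; lra. Qed.

Lemma cond_mean0 : \sum_v cond_law v * cond_val v = 0.
Proof.
rewrite (eq_bigr (fun v => cond_law v * rp v - cond_mean * cond_law v)).
  by rewrite sumrB -mulr_sumr cond_law_sum mulr1 subrr.
by move=> [i|] _ /=; ring.
Qed.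

Lemma cond_var : \sum_v cond_law v * cond_val v ^+ 2 = (\sum_v ms v * rp v ^+ 2) / pi_ok - cond_mean ^+ 2.
Proof.
rewrite -sum_cond_rep //.
rewrite (eq_bigr (fun v => cond_law v * rp v ^+ 2 - 2 * cond_mean * (cond_law v * rp v)
   + cond_mean ^+ 2 * cond_law v)); last first.
  by move=> [i|] _ /=; ring.
rewrite big_split sumrB /= -!mulr_sumr cond_law_sum -/cond_mean; ring.
Qed.

Lemma cond_var_bounds : 1 - 5 * e0 <= \sum_v cond_law v * cond_val v ^+ 2 <= 2.
Proof.
rewrite cond_var.
have /andP[] := sq_rep xi_meas xi_4 xi_mean xi_var Tr_gt0 del_gt0 r_lo; rewrite -/K.
set A := \sum_v _ => lo hi.
have m2 : cond_mean ^+ 2 <= e0.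
  rewrite -(real_normK (num_real _)); apply: (@le_trans _ _ ((4 * e0) ^+ 2)).
    by apply: lerXn2r; rewrite ?nnegrE // mulr_ge0 // ltW.
  have : 0 <= e0 * (1 / 16 - e0) by rewrite mulr_ge0 ?subr_ge0 // ltW.
  have -> : (4 * e0) ^+ 2 = 16 * e0 ^+ 2 by ring.
  have -> : e0 * (1 / 16 - e0) = e0 / 16 - e0 ^+ 2 by field.
  by lra.
have A0 : 0 <= A by move: del_le KT2 e0_le; lra.
have d2 : del ^+ 2 <= del.
  by rewrite expr2 ler_piMr ?(ltW del_gt0) //; move: del_le e0_le; lra.
apply/andP; split.
  have : A <= A / pi_ok by rewrite ler_pdivlMr // ler_piMr // pi_ok_le1.
  by move: del_le KT2; lra.
have : A / pi_ok <= 2.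
  rewrite ler_pdivrMr //; move: del_le e0_le pi_ge; lra.
by have := sqr_ge0 cond_mean; lra.
Qed.

Lemma cond_four : \sum_v cond_law v * cond_val v ^+ 4 <= K4_of.
Proof.
have d1 : del <= 1 by move: del_le e0_le; lra.
have A4 := four_rep xi_meas xi_4 xi_mean xi_var r Tr del_gt0 d1; rewrite -/K in A4.
apply: (@le_trans _ _ (\sum_v (8 * (cond_law v * rp v ^+ 4) + 8 * cond_mean ^+ 4 * cond_law v))).
  apply: ler_sum => -[i|] _; last by rewrite /= !mul0r !mulr0 addr0.
  set c := cond_law _; set y := rp _; rewrite /cond_val -/y; set z := cond_mean.
  have -> : 8 * (c * y ^+ 4) + 8 * z ^+ 4 * c = c * (8 * y ^+ 4 + 8 * z ^+ 4) by ring.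
  rewrite ler_wpM2l ?cond_law_ge0 //.
  have : 0 <= (y + z) ^+ 2 * (5 * (y - z) ^+ 2 + 2 * (y ^+ 2 + z ^+ 2)).
    apply: mulr_ge0; first exact: sqr_ge0.
    by apply: addr_ge0; apply: mulr_ge0 => //; rewrite ?addr_ge0 ?sqr_ge0.
  have -> : (y + z) ^+ 2 * (5 * (y - z) ^+ 2 + 2 * (y ^+ 2 + z ^+ 2)) =
    8 * y ^+ 4 + 8 * z ^+ 4 - (y - z) ^+ 4 by ring.
  by rewrite subr_ge0.
rewrite big_split /= -!mulr_sumr cond_law_sum sum_cond_rep // mulr1.
set A := \sum_v _ in A4 *.
have m4 : cond_mean ^+ 4 <= 1.
  have -> : cond_mean ^+ 4 = `|cond_mean| ^+ 4.
    by rewrite -normrX ger0_norm // exprn_even_ge0.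
  by apply: exprn_ile1 => //; apply: le_trans mean_le _; move: e0_le; lra.
have : A / pi_ok <= 2 * (8 * K + 8).
  rewrite ler_pdivrMr //; apply: le_trans A4 _.
  have : 0 <= (8 * K + 8) * (2 * pi_ok - 1).
    by apply: mulr_ge0; [move: K_ge0 | move: pi_ge]; lra.
  have -> : (8 * K + 8) * (2 * pi_ok - 1) = 2 * (8 * K + 8) * pi_ok - (8 * K + 8) by ring.
  by rewrite subr_ge0.
by rewrite /K4_of; move: K_ge0; lra.
Qed.

Lemma cond_val_le v : `|cond_val v| <= Tr + 5 * e0.
Proof.
case: v => [i|] /=; last by rewrite normr0 addr_ge0 ?mulr_ge0 // ltW.
apply: le_trans (ler_normB _ _) _.
have := rep_le Tr_gt0 del_gt0 r_lo r_hi (Some i).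
by move: mean_le del_le => /=; lra.
Qed.

Lemma cond_val_dist x : cell r Tr del x != None ->
  `|x - cond_val (cell r Tr del x)| <= 3 * del + 2 * (K / Tr ^+ 3).
Proof.
move=> xN; have := cell_dist del_gt0 xN; move: xN; case: (cell r Tr del x) => [i|] //= _ h.
rewrite opprB addrCA addrC; apply: le_trans (ler_normD _ _) _.
by move: cond_mean_le h; lra.
Qed.

End Normalize.

Lemma discretization (kappa eta tol : R) : 0 < kappa -> 0 < eta -> 0 < tol ->
  exists d0 : nat, forall d : nat, (d0 <= d)%N ->
  exists (V : finType) (v0 : V) (idx : R -> V) (p val : V -> R) (s2 pi : R),
  [/\ [/\ forall v, measurable (idx @^-1` [set v]), forall v, 0 <= p v & \sum_v p v = 1],
      [/\ \sum_v p v * val v = 0, \sum_v p v * val v ^+ 2 = s2 & \sum_v p v * val v ^+ 4 <= K4_of],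
      [/\ 1 - eta <= s2, s2 <= 2 & forall v, `|val v| <= kappa * Num.sqrt d%:R],
      [/\ p v0 = 0, forall v, pi * p v <= fine (P (xi @^-1` (idx @^-1` [set v]))),
        1 - 16 * K / kappa ^+ 4 / d%:R ^+ 2 <= pi & pi <= 1] &
      forall x, idx x != v0 -> `|x - val (idx x)| * Num.sqrt d%:R <= tol].
Proof.
move=> k0 eta0 tol0.
pose e0 := Num.min (1 / 16) (eta / 5).
have e0_gt0 : 0 < e0 by rewrite lt_min; apply/andP; split; rewrite divr_gt0.
have e0_le : e0 <= 1 / 16 by rewrite ge_min lexx.
have e0_eta : 5 * e0 <= eta.
  have : e0 <= eta / 5 by rewrite ge_min lexx orbT.
  by lra.
have [n1 H1] := sqrt_above 1.
have [n2 H2] := sqrt_above (1 / e0).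
have [n3 H3] := sqrt_above (K * 4 / kappa ^+ 2 / e0).
have [n4 H4] := sqrt_above (K * 8 / kappa ^+ 3 / e0).
have [n5 H5] := sqrt_above (K * 16 / kappa ^+ 4 / (1 / 4)).
have [n6 H6] := sqrt_above (3 / (tol / 2)).
have [n7 H7] := sqrt_above (2 * (K * 8 / kappa ^+ 3) / (tol / 2)).
have [n8 H8] := sqrt_above (10 * e0 / kappa).
exists (n1 + n2 + (n3 + n4) + (n5 + n6) + (n7 + n8))%N => d dd.
have {}H1 : 1 <= Num.sqrt d%:R :> R by apply: H1; apply: leq_trans dd; rewrite -!addnA leq_addr.
have {}H2 : 1 / e0 <= Num.sqrt d%:R by apply: H2; clear -dd; lia.
have {}H3 : K * 4 / kappa ^+ 2 / e0 <= Num.sqrt d%:R by apply: H3; clear -dd; lia.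
have {}H4 : K * 8 / kappa ^+ 3 / e0 <= Num.sqrt d%:R by apply: H4; clear -dd; lia.
have {}H5 : K * 16 / kappa ^+ 4 / (1 / 4) <= Num.sqrt d%:R by apply: H5; clear -dd; lia.
have {}H6 : 3 / (tol / 2) <= Num.sqrt d%:R by apply: H6; clear -dd; lia.
have {}H7 : 2 * (K * 8 / kappa ^+ 3) / (tol / 2) <= Num.sqrt d%:R by apply: H7; clear -dd; lia.
have {}H8 : 10 * e0 / kappa <= Num.sqrt d%:R by apply: H8; clear -dd; lia.
have sE : Num.sqrt d%:R ^+ 2 = d%:R :> R by rewrite sqr_sqrtr.
move: (Num.sqrt d%:R) H1 H2 H3 H4 H5 H6 H7 H8 sE => s s1 H2 H3 H4 H5 H6 H7 H8 sE.
have s0 : 0 < s by lra.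
have c0 n (c : R) : 0 <= c -> 0 <= K * c / kappa ^+ n.
  by move=> c0; apply: divr_ge0; rewrite ?mulr_ge0 // exprn_ge0 // ltW.
pose del := 1 / s ^+ 2; pose Tr := kappa * s / 2.
have del0 : 0 < del by rewrite divr_gt0 ?exprn_gt0.
have Tr0 : 0 < Tr by rewrite !mulr_gt0 ?invr_gt0.
pose r := (Num.trunc (2 * Tr / del)).+1.
have /andP[r1 r2] : (Num.trunc (2 * Tr / del))%:R <= 2 * Tr / del < r%:R.
  by apply: truncn_itv; apply: ltW; rewrite divr_gt0 // mulr_gt0.
have r_lo : 2 * Tr < r%:R * del by rewrite -ltr_pdivrMr.
have r_hi : r%:R * del <= 2 * Tr + del.
  by rewrite /r -natr1 mulrDl mul1r lerD2r -ler_pdivlMr.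
have sn0 n : s ^+ n != 0 by rewrite expf_neq0 // gt_eqF.
have kn0 n : kappa ^+ n != 0 by rewrite expf_neq0 // gt_eqF.
have del_le : del <= e0 by apply: div_exp_le.
have T2 : K / Tr ^+ 2 = K * 4 / kappa ^+ 2 / s ^+ 2.
  by rewrite /Tr; field; rewrite !gt_eqF.
have T3 : K / Tr ^+ 3 = K * 8 / kappa ^+ 3 / s ^+ 3.
  by rewrite /Tr; field; rewrite !gt_eqF.
have T4 : K / Tr ^+ 4 = K * 16 / kappa ^+ 4 / s ^+ 4.
  by rewrite /Tr; field; rewrite !gt_eqF.
have KT2 : K / Tr ^+ 2 <= e0 by rewrite T2; apply: div_exp_le => //; exact: c0.
have KT3 : K / Tr ^+ 3 <= e0 by rewrite T3; apply: div_exp_le => //; exact: c0.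
have KT4 : K / Tr ^+ 4 <= 1 / 4 by rewrite T4; apply: div_exp_le => //; exact: c0.
pose p : option 'I_r -> R := cond_law Tr del; pose val : option 'I_r -> R := cond_val Tr del.
exists (option 'I_r), None, (cell r Tr del), p, val, (\sum_v p v * val v ^+ 2), (pi_ok r Tr del).
have /andP[v1 v2] := cond_var_bounds Tr0 del0 r_lo e0_gt0 e0_le del_le KT2 KT3 KT4.
split.
- split; first by move=> v; exact: measurable_cell.
    exact: (cond_law_ge0 Tr0 del0 r_lo KT4).
  exact: (cond_law_sum Tr0 del0 r_lo KT4).
- split=> //; first exact: (cond_mean0 Tr0 del0 r_lo KT4).
  exact: (cond_four Tr0 del0 r_lo e0_le del_le KT3 KT4).
- split=> //; first by lra.
  move=> v; apply: le_trans (cond_val_le Tr0 del0 r_lo r_hi e0_gt0 del_le KT3 KT4 v) _.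
  rewrite ler_pdivrMr // in H8; rewrite /Tr; lra.
- split=> //; first exact: (pi_cond_law Tr0 del0 r_lo KT4).
    apply: le_trans (pi_ok_ge Tr0 del0 r_lo); rewrite T4 -sE -exprM.
    by rewrite (mulrC 16).
  exact: (pi_ok_le1 r Tr del0).
move=> x xN; apply: (@le_trans _ _ ((3 * del + 2 * (K / Tr ^+ 3)) * s)).
  rewrite ler_wpM2r ?(ltW s0) //.
  exact: (cond_val_dist Tr0 del0 r_lo KT4 xN).
have -> : (3 * del + 2 * (K / Tr ^+ 3)) * s = 3 / s ^+ 1 + 2 * (K * 8 / kappa ^+ 3) / s ^+ 2.
  by rewrite T3 /del; field; rewrite !gt_eqF.
have : 3 / s ^+ 1 <= tol / 2 by apply: div_exp_le => //; rewrite divr_gt0.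
have : 2 * (K * 8 / kappa ^+ 3) / s ^+ 2 <= tol / 2.
  by apply: div_exp_le => //; rewrite ?divr_gt0 // mulr_ge0 // c0.
by lra.
Qed.

End DiscretizeAsymptotics.

(** * Independent blocks *)

Lemma Ex_prod_indep (R : realType) (I V : finType) (p : I -> V -> R) (B : eqType)
    (F : B -> {ffun I -> V} -> R) (s : B -> {set I}) (l : seq B) : law p -> uniq l ->
  (forall b i, i \notin s b -> ign i (F b)) ->
  (forall b b' i, b != b' -> i \in s b -> i \notin s b') ->
  Ex p (fun w => \prod_(b <- l) F b w) = \prod_(b <- l) Ex p (F b).
Proof.
move=> lp + iF dis; elim: l => [|b l IH] /=.
  by move=> _; rewrite big_nil -[RHS](Ex_cst 1 lp); apply: eq_Ex => w; rewrite big_nil.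
case/andP => bl /IH {}IH.
rewrite big_cons -IH mulrC -(Ex_indep (s := s b) lp).
- by apply: eq_Ex => w; rewrite big_cons mulrC.
- move=> i ib; apply: ign_prod => b' b'l _; apply: iF; apply: dis ib.
  by apply: contraNneq bl => ->.
- by move=> i ib; exact: iF.
Qed.

Section Pattern.
Context (dT : measure_display) (T : measurableType dT) (R : realType) (P : probability T R).
Context (xi : T -> R) (n : nat) (W : T -> 'M[R]_n).
Local Notation E := ('I_n * 'I_n)%type.
Hypothesis xi_meas : measurable_fun setT xi.
Hypothesis W_meas : forall i j : 'I_n, (i < j)%N -> measurable_fun setT (fun w => W w i j).
Hypothesis W_law : forall i j : 'I_n, (i < j)%N -> same_law P (fun w => W w i j) xi.
Hypothesis W_indep : mutually_independent P
  (finset (fun ij : 'I_n * 'I_n => (ij.1 < ij.2)%N)) (fun ij w => W w ij.1 ij.2).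
Context (V : finType) (v0 : V) (idx : R -> V).
Hypothesis midx : forall v, measurable (idx @^-1` [set v]).

Definition pattern (w : T) : {ffun E -> V} :=
  [ffun ij : E => if (ij.1 < ij.2)%N then idx (W w ij.1 ij.2) else v0].

(* Coordinates on or below the diagonal carry a Dirac mass at the dummy value [v0]. *)
Definition upper_law (p : V -> R) (ij : E) (v : V) : R :=
  if (ij.1 < ij.2)%N then p v else (v == v0)%:R.

Definition idx_law (v : V) : R := fine (P (xi @^-1` (idx @^-1` [set v]))).

Lemma law_upper_law (p : V -> R) : (forall v, 0 <= p v) -> \sum_v p v = 1 -> law (upper_law p).
Proof.
move=> p0 p1; split=> [ij v|ij]; rewrite /upper_law; case: (ij.1 < ij.2)%N => //.
rewrite (bigD1 v0) //= eqxx big1 ?addr0 //.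
by move=> v /negbTE ->.
Qed.

Lemma pattern_law (o : {ffun E -> V}) : measurable [set w | pattern w = o] /\
  P [set w | pattern w = o] = (wt (upper_law idx_law) o)%:E.
Proof.
pose A : {set E} := finset (fun ij : E => (ij.1 < ij.2)%N).
have mA ij : (ij \in A) = (ij.1 < ij.2)%N by rewrite finset.in_set.
have [/fintype.existsP[ij /andP[ijA ijo]]|off] := boolP [exists ij, (ij \notin A) && (o ij != v0)].
  have -> : [set w | pattern w = o] = set0.
    apply/seteqP; split => w //= wo; move: ijo; rewrite -wo ffunE.
    by move: ijA; rewrite mA => /negbTE ->; rewrite eqxx.
  split; first exact: measurable0.
  rewrite measure0 /wt (bigD1 ij) //= /upper_law; move: ijA; rewrite mA => /negbTE ->.
  by rewrite (negbTE ijo) mul0r.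
have offE ij : ij \notin A -> o ij = v0.
  by move=> ijA; apply/eqP; apply: contraNT off => ijo; apply/fintype.existsP; exists ij; rewrite ijA.
have -> : [set w | pattern w = o] = [set w | forall ij, ij \in A -> (idx @^-1` [set o ij]) (W w ij.1 ij.2)].
  apply/seteqP; split => w /=; first by move=> <- ij; rewrite mA ffunE => ->.
  move=> h; apply/ffunP => ij; rewrite ffunE; case: ifP => ijA; first by apply: h; rewrite mA.
  by rewrite offE // mA ijA.
split.
  rewrite (_ : [set w | _] = \bigcap_(ij in [set` A]) ((fun w => W w ij.1 ij.2) @^-1` (idx @^-1` [set o ij]))).
    apply: fin_bigcap_measurable => // ij /=; rewrite mA => ijA.
    by rewrite -[X in measurable X]setTI; apply: W_meas.
  by apply/seteqP; split => w /= h ij ijA; exact: h.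
etransitivity; first exact: (W_indep (fintype.subxx _) (fun ij => midx (o ij))).
have -> : wt (upper_law idx_law) o = \prod_(ij in A) upper_law idx_law ij (o ij).
  rewrite /wt (bigID (fun ij => ij \in A)) /= [X in _ * X]big1 ?mulr1 // => ij ijA.
  by rewrite /upper_law -mA (negbTE ijA) offE // eqxx.
rewrite -prodEFin; apply: eq_bigr => ij; rewrite mA => ijA.
rewrite /upper_law ijA /idx_law.
rewrite (W_law ijA); last exact: midx.
rewrite fineK // fin_num_measure //.
by rewrite -[X in measurable X]setTI; exact: xi_meas.
Qed.
(** Subadditivity over the finitely many patterns; only the probability of failure is to be bounded,
    so an inequality is enough. *)
Lemma pattern_prob_le (B : pred {ffun E -> V}) :
  measurable [set w | B (pattern w)] /\
  (P [set w | B (pattern w)] <= (Ex (upper_law idx_law) (fun o => (B o)%:R))%:E)%E.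
Proof.
have key (l : seq {ffun E -> V}) : measurable [set w | (pattern w \in l) && B (pattern w)] /\
    (P [set w | (pattern w \in l) && B (pattern w)] <=
     (\sum_(o <- l) wt (upper_law idx_law) o * (B o)%:R)%:E)%E.
  elim: l => [|o l [IH1 IH2]].
    rewrite (_ : [set w | _] = set0); first by rewrite measure0 big_nil.
    by apply/seteqP; split.
  have [mo Po] := pattern_law o.
  have [Bo|/negbTE Bo] := boolP (B o); last first.
    rewrite big_cons Bo mulr0 add0r (_ : [set w | _] = [set w | (pattern w \in l) && B (pattern w)]) //.
    apply/seteqP; split => w /=; last by rewrite inE => /andP[-> ->]; rewrite orbT.
    by rewrite inE => /andP[/orP[/eqP ->|->]]; rewrite ?Bo.
  have -> : [set w | (pattern w \in o :: l) && B (pattern w)] =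
      [set w | pattern w = o] `|` [set w | (pattern w \in l) && B (pattern w)].
    apply/seteqP; split => w /=; rewrite inE.
      by move=> /andP[/orP[/eqP -> _|-> ->]]; [left | right].
    by case=> [->|/andP[-> ->]]; rewrite ?eqxx ?Bo ?orbT.
  split; first exact: measurableU.
  apply: le_trans (measureU2 _ mo IH1) _; rewrite big_cons Bo mulr1 EFinD -Po.
  exact: leeD.
have [H1 H2] := key (enum {: {ffun E -> V}}).
rewrite (_ : [set w | B (pattern w)] = [set w | (pattern w \in enum {: {ffun E -> V}}) && B (pattern w)]).
  by split=> //; rewrite /Ex -[X in (_ <= X%:E)%E]big_enum.
by apply/seteqP; split => w /=; rewrite mem_enum.
Qed.

End Pattern.

Section Blocks.
Context (R : realType) (n N m q : nat).
Local Notation X := ('I_N * 'I_m)%type.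
Local Notation E := ('I_n * 'I_n)%type.
Context (pos : 'I_q -> X -> 'I_n).
Hypothesis pos_inj : forall b b' x x', pos b x = pos b' x' -> b = b' /\ x = x'.

Definition pair_of b (x y : X) : E :=
  if (pos b x < pos b y)%N then (pos b x, pos b y) else (pos b y, pos b x).

Lemma pair_of_sym b x y : pair_of b x y = pair_of b y x.
Proof.
rewrite /pair_of; case: ltngtP => // E; have /pos_inj[_ ->] // : pos b x = pos b y.
exact/val_inj.
Qed.

Lemma pair_of_mem b x y b' x' y' : pair_of b x y = pair_of b' x' y' ->
  [/\ b = b', x \in [:: x'; y'] & y \in [:: x'; y']].
Proof.
rewrite /pair_of !inE; case: ifP => _; case: ifP => _ [] /pos_inj[-> ->] /pos_inj[_ ->];
  by rewrite !eqxx ?orbT.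
Qed.

Lemma pair_of_inj b x y x' y' : pair_of b x y = pair_of b x' y' ->
  (x = x' /\ y = y') \/ (x = y' /\ y = x').
Proof.
rewrite /pair_of; case: ifP => _; case: ifP => _ [] /pos_inj[_ ->] /pos_inj[_ ->]; by [left | right].
Qed.

Lemma pair_of_upper b x y : x != y -> ((pair_of b x y).1 < (pair_of b x y).2)%N.
Proof.
move=> xy; rewrite /pair_of; case: (ltngtP (pos b x) (pos b y)) => /= E //.
have /pos_inj[_ exy] : pos b x = pos b y by exact/val_inj.
by rewrite exy eqxx in xy.
Qed.

Context (V : finType) (v0 : V) (p phat : V -> R) (val : V -> R) (pi lam g0 : R).
Hypotheses (p_ge0 : forall v, 0 <= p v) (p_sum : \sum_v p v = 1).
Hypotheses (phat_ge0 : forall v, 0 <= phat v) (phat_sum : \sum_v phat v = 1).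
Hypotheses (p_v0 : p v0 = 0) (pi_ge0 : 0 <= pi) (pi_le1 : pi <= 1)
  (pi_p : forall v, pi * p v <= phat v).

Definition heavy b (o : {ffun E -> V}) : bool :=
  `[< exists u, lam * (\sum_x u x ^+ 2) < qform val (pair_of b) o u >].

(** The second condition excludes truncated entries, the only ones that may be far from their
    rounded value. *)
Definition good b (o : {ffun E -> V}) : bool :=
  heavy b o && [forall x, forall y, (x != y) ==> (o (pair_of b x y) != v0)].

Hypothesis g0_ge0 : 0 <= g0.
Hypothesis heavy_ge : forall b, g0 <= Ex (upper_law v0 p) (fun o => (heavy b o)%:R).

Let edges b : {set E} := [set pair_of b z.1 z.2 | z : X * X]%SET.

Let mem_edges b x y : pair_of b x y \in edges b.
Proof. by apply/imsetP; exists (x, y). Qed.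

Let card_edges b : (#|edges b| <= (N * m) ^ 2)%N.
Proof. by apply: leq_trans (leq_imset_card _ _) _; rewrite card_prod card_prod !card_ord mulnn. Qed.

Let good_ign b i : i \notin edges b -> ign i (fun o => (good b o)%:R : R).
Proof.
move=> ib o v; congr (_%:R); congr nat_of_bool.
have E x y : upd o i v (pair_of b x y) = o (pair_of b x y).
  by rewrite upd_ne //; apply: contraNneq ib => <-.
have Q u : qform val (pair_of b) (upd o i v) u = qform val (pair_of b) o u.
  by apply: eq_bigr => x _; apply: eq_bigr => y _; rewrite /edge E.
rewrite /good; congr (_ && _).
  apply: asbool_equiv_eq; split=> -[u hu]; exists u; by [rewrite -Q | rewrite Q].
by apply: eq_forallb => x; apply: eq_forallb => y; rewrite E.
Qed.

(** Under the conditioned law [p] the value [v0] has mass 0, so [good] and [heavy] agree almost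
    surely. Passing to the actual law costs a factor [pi] per coordinate of the block, by
    [Ex_dominated]. *)
Lemma Ex_good_ge b : pi ^+ ((N * m) ^ 2) * g0 <= Ex (upper_law v0 phat) (fun o => (good b o)%:R).
Proof.
have l1 := law_upper_law n v0 p_ge0 p_sum.
have l2 := law_upper_law n v0 phat_ge0 phat_sum.
apply: (@le_trans _ _ (pi ^+ #|edges b| * Ex (upper_law v0 p) (fun o => (good b o)%:R))); last first.
  apply: Ex_dominated => //; last exact: good_ign.
  move=> i v; rewrite /upper_law; case: ifP => _ //.
  by rewrite -[leRHS]mul1r ler_wpM2r.
have -> : Ex (upper_law v0 p) (fun o => (good b o)%:R) = Ex (upper_law v0 p) (fun o => (heavy b o)%:R).
  apply: eq_bigr => o _; rewrite /good.
  have [_|] := boolP [forall x, forall y, (x != y) ==> (o (pair_of b x y) != v0)]; first by rewrite andbT.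
  rewrite negb_forall => /fintype.existsP[x]; rewrite negb_forall => /fintype.existsP[y].
  rewrite negb_imply negbK => /andP[xy /eqP oxy]; rewrite andbF mulr0.
  by rewrite /wt (bigD1 (pair_of b x y)) //= /upper_law pair_of_upper // oxy p_v0 !mul0r.
apply: ler_pM => //; first exact: exprn_ge0.
by apply: ler_wiXn2l.
Qed.

Lemma Ex_no_good :
  Ex (upper_law v0 phat) (fun o => ([forall b, ~~ good b o])%:R) <= (1 - pi ^+ ((N * m) ^ 2) * g0) ^+ q.
Proof.
have l2 := law_upper_law n v0 phat_ge0 phat_sum.
rewrite (eq_Ex _ (G := fun o => \prod_(b <- enum 'I_q) (1 - (good b o)%:R))); last first.
  move=> o; have [/fintype.forallP h|] := boolP [forall b, ~~ good b o].
    by rewrite big1 // => b _; rewrite (negbTE (h b)) subr0.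
  rewrite negb_forall => /fintype.existsP[b]; rewrite negbK => hb.
  by rewrite (big_rem b) ?mem_enum //= hb subrr mul0r.
rewrite (Ex_prod_indep (s := edges)) ?enum_uniq //; first last.
- move=> b b' i bb' /imsetP[[x y] _ ->]; apply/negP => /imsetP[[x' y'] _ /pair_of_mem[E _ _]].
  by rewrite E eqxx in bb'.
- by move=> b i ib; apply: ign_add; [exact: ign_cst | exact: (ign_comp -%R (good_ign ib))].
apply: (@le_trans _ _ (\prod_(b <- enum 'I_q) (1 - pi ^+ ((N * m) ^ 2) * g0))); last first.
  by rewrite big_enum /= prodr_const card_ord.
apply: ler_prod => b _; rewrite ExB Ex_cst // lerD2l lerN2 Ex_good_ge andbT subr_ge0.
by rewrite -[leRHS](Ex_cst 1 l2); apply: le_Ex => // o; case: (good b o).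
Qed.

End Blocks.

(** * The spectral norm *)

Section SpectralNorm.
Context (R : realType) (n : nat).
Implicit Types (M : 'M[R]_n) (x y : 'cV[R]_n) (v : 'I_n -> R).

Definition sumsq v : R := \sum_i v i ^+ 2.

Definition mapply M v (i : 'I_n) : R := \sum_j M i j * v j.

Lemma sumsq_ge0 v : 0 <= sumsq v.
Proof. by apply: sumr_ge0 => i _; exact: sqr_ge0. Qed.

Lemma vnorm2E x : vnorm2 x = Num.sqrt (sumsq (x ^~ 0)).
Proof. by []. Qed.

Lemma vnorm2_mul M x : vnorm2 (M *m x) = Num.sqrt (sumsq (mapply M (x ^~ 0))).
Proof. by rewrite vnorm2E; congr Num.sqrt; apply: eq_bigr => i _; rewrite mxE. Qed.

Lemma sumsqZ (a : R) v : sumsq (fun i => a * v i) = a ^+ 2 * sumsq v.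
Proof. by rewrite /sumsq mulr_sumr; apply: eq_bigr => i _; rewrite exprMn. Qed.

Lemma mapplyZ M (a : R) v i : mapply M (fun i => a * v i) i = a * mapply M v i.
Proof. by rewrite /mapply mulr_sumr; apply: eq_bigr => j _; rewrite mulrCA. Qed.

Lemma CauchySchwarz_sum v u : 0 < sumsq v -> (\sum_i v i * u i) ^+ 2 <= sumsq v * sumsq u.
Proof.
set A := sumsq v; set C := sumsq u; set B := \sum_i _ => A0.
have : 0 <= \sum_i (A * u i - B * v i) ^+ 2 by apply: sumr_ge0 => i _; exact: sqr_ge0.
rewrite (eq_bigr (fun i => A ^+ 2 * u i ^+ 2 - 2 * A * B * (v i * u i) + B ^+ 2 * v i ^+ 2)).
  rewrite big_split sumrB /= -!mulr_sumr -/A -/B -/C.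
  have -> : A ^+ 2 * C - 2 * A * B * B + B ^+ 2 * A = A * (A * C - B ^+ 2) by ring.
  by rewrite pmulr_rge0 // subr_ge0.
by move=> i _; ring.
Qed.

Lemma spec_norm_has_sup M : has_sup [set r | exists x, vnorm2 x <= 1 /\ r = vnorm2 (M *m x)].
Proof.
split.
  exists (vnorm2 (M *m 0)), 0; split=> //.
  by rewrite vnorm2E /sumsq big1 ?sqrtr0 ?ler01 // => i _; rewrite mxE expr0n.
exists (Num.sqrt (sumsq (fun i => \sum_j `|M i j|))) => _ [x [x1 ->]].
have xj j : `|x j 0| <= 1.
  rewrite -sqrtr_sqr; apply: le_trans x1; rewrite vnorm2E ler_sqrt ?sumsq_ge0 //.
  by rewrite /sumsq (bigD1 j) //= lerDl; apply: sumr_ge0 => i _; exact: sqr_ge0.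
rewrite vnorm2_mul ler_sqrt ?sumsq_ge0 //; apply: ler_sum => i _.
rewrite -(real_normK (num_real _)); apply: lerXn2r; rewrite ?nnegrE ?sumr_ge0 //.
apply: le_trans (ler_norm_sum _ _ _) _; apply: ler_sum => j _.
by rewrite normrM -[leRHS]mulr1 ler_wpM2l.
Qed.

Lemma spec_norm_ge0 M : 0 <= spec_norm M.
Proof.
apply: le_trans (_ : vnorm2 (M *m 0) <= _); first exact: sqrtr_ge0.
apply: sup_ubound; first by case: (spec_norm_has_sup M).
exists 0; split=> //.
by rewrite vnorm2E /sumsq big1 ?sqrtr0 ?ler01 // => i _; rewrite mxE expr0n.
Qed.

Lemma sumsq_mapply_le M v : sumsq (mapply M v) <= spec_norm M ^+ 2 * sumsq v.
Proof.
have [v0|v0] := eqVneq (sumsq v) 0.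
  have vz i : v i = 0.
    move/eqP: v0; rewrite psumr_eq0 => [/allP/(_ i)|j _]; last exact: sqr_ge0.
    by rewrite mem_index_enum => /(_ isT) /=; rewrite sqrf_eq0 => /eqP.
  rewrite v0 mulr0 /sumsq big1 // => i _.
  by rewrite /mapply big1 ?expr0n // => j _; rewrite vz mulr0.
have vp : 0 < sumsq v by rewrite lt_neqAle eq_sym v0 sumsq_ge0.
pose a := (Num.sqrt (sumsq v))^-1.
have a2 : a ^+ 2 = (sumsq v)^-1 by rewrite /a exprVn sqr_sqrtr ?sumsq_ge0.
pose x : 'cV[R]_n := \col_i (a * v i).
have xE i : x i 0 = a * v i by rewrite mxE.
have h : vnorm2 (M *m x) <= spec_norm M.
  apply: sup_ubound; first by case: (spec_norm_has_sup M).
  exists x; split=> //; rewrite vnorm2E.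
  rewrite (_ : sumsq _ = 1) ?sqrtr1 //.
  transitivity (sumsq (fun i => a * v i)); first by apply: eq_bigr => i _; rewrite xE.
  by rewrite sumsqZ a2 mulVf.
have : vnorm2 (M *m x) ^+ 2 <= spec_norm M ^+ 2.
  by apply: lerXn2r; rewrite ?nnegrE ?sqrtr_ge0 ?spec_norm_ge0.
rewrite vnorm2_mul sqr_sqrtr ?sumsq_ge0 //.
have -> : sumsq (mapply M (x^~ 0)) = a ^+ 2 * sumsq (mapply M v).
  rewrite -sumsqZ; apply: eq_bigr => i _; rewrite -mapplyZ.
  by congr (_ ^+ 2); apply: eq_bigr => j _; rewrite xE.
by rewrite a2 mulrC ler_pdivrMr.
Qed.

(** Cauchy-Schwarz bounds the form by [spec_norm M * sumsq v], without recourse to eigenvalues. *)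
Lemma spec_norm_ge_form M v (c : R) : 0 <= c ->
  c * sumsq v < \sum_i \sum_j M i j * (v i * v j) -> c <= spec_norm M.
Proof.
move=> c0 h.
have E : \sum_i \sum_j M i j * (v i * v j) = \sum_i v i * mapply M v i.
  by apply: eq_bigr => i _; rewrite /mapply mulr_sumr; apply: eq_bigr => j _; rewrite mulrCA.
have [v0|v0] := eqVneq (sumsq v) 0.
  have vz i : v i = 0.
    move/eqP: v0; rewrite psumr_eq0 => [/allP/(_ i)|j _]; last exact: sqr_ge0.
    by rewrite mem_index_enum => /(_ isT) /=; rewrite sqrf_eq0 => /eqP.
  by move: h; rewrite E v0 mulr0 big1 ?ltxx // => i _; rewrite vz mul0r.
have vp : 0 < sumsq v by rewrite lt_neqAle eq_sym v0 sumsq_ge0.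
rewrite leNgt; apply/negP => sc.
move: h; rewrite E; apply/negP; rewrite -leNgt.
have cs := CauchySchwarz_sum (mapply M v) vp.
have : (\sum_i v i * mapply M v i) ^+ 2 <= (c * sumsq v) ^+ 2.
  apply: le_trans cs _; apply: le_trans (ler_wpM2l (ltW vp) (sumsq_mapply_le M v)) _.
  rewrite exprMn mulrCA -expr2 ler_wpM2r ?sqr_ge0 //.
  by apply: lerXn2r; rewrite ?nnegrE ?spec_norm_ge0 //; exact: ltW.
have cv : 0 <= c * sumsq v by rewrite mulr_ge0 // ltW.
by rewrite -[X in X <= _ -> _]real_normK ?num_real // ler_sqr ?nnegrE // => /(le_trans (ler_norm _)).
Qed.

(** For [r >= 0], positivity at [v] certifies [r < spec_norm M]. The condition is homogeneous, so
    certificates need not lie in the unit ball and can be sought among rational vectors. *)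
Definition excess M (r : R) v : R := sumsq (mapply M v) - r ^+ 2 * sumsq v.

Lemma excess_bump M r v j : exists b c : R, forall dl : R,
  excess M r (fun i => if i == j then v j + dl else v i) = excess M r v + dl * b + dl ^+ 2 * c.
Proof.
exists (\sum_i 2 * mapply M v i * M i j - r ^+ 2 * (2 * v j)), (\sum_i M i j ^+ 2 - r ^+ 2) => dl.
have mE i : mapply M (fun i => if i == j then v j + dl else v i) i = mapply M v i + dl * M i j.
  rewrite /mapply (bigD1 j) //= [in RHS](bigD1 j) //= eqxx.
  rewrite (eq_bigr (fun k => M i k * v k)); first by ring.
  by move=> k /negbTE ->.
have sE : sumsq (fun i => if i == j then v j + dl else v i) = sumsq v + 2 * v j * dl + dl ^+ 2.
  rewrite /sumsq (bigD1 j) //= [in RHS](bigD1 j) //= eqxx.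
  rewrite (eq_bigr (fun k => v k ^+ 2)); first by ring.
  by move=> k /negbTE ->.
rewrite /excess sE.
have -> : sumsq (mapply M (fun i => if i == j then v j + dl else v i)) =
   sumsq (mapply M v) + dl * (\sum_i 2 * mapply M v i * M i j) + dl ^+ 2 * (\sum_i M i j ^+ 2).
  rewrite /sumsq !mulr_sumr -!big_split /=; apply: eq_bigr => i _; rewrite mE; ring.
by ring.
Qed.

(** Coordinates are made rational one at a time: the excess is a quadratic polynomial in the
    increment of one coordinate, so a small enough increment keeps it positive. *)
Lemma excess_rational M r v : 0 < excess M r v ->
  exists q : {ffun 'I_n -> rat}, 0 < excess M r (fun i => ratr (q i)).
Proof.
move=> h0.
have key (s : seq 'I_n) : exists u : 'I_n -> R, 0 < excess M r u /\
   forall i, i \in s -> exists q : rat, u i = ratr q.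
  elim: s => [|j s [u [u0 us]]]; first by exists v.
  have [b [c bc]] := excess_bump M r u j.
  pose e := Num.min 1 (excess M r u / (1 + `|b| + `|c|)).
  have den : 0 < 1 + `|b| + `|c| by have := normr_ge0 b; have := normr_ge0 c; lra.
  have e0 : 0 < e by rewrite lt_min ltr01 divr_gt0.
  have uje : u j < u j + e by rewrite ltrDl.
  have [q] := rat_in_itvoo uje.
  rewrite in_itv /= => /andP[q1 q2].
  pose dl := ratr q - u j.
  have dl0 : 0 < dl by rewrite subr_gt0.
  have dle : dl < e by rewrite ltrBlDl.
  exists (fun i => if i == j then u j + dl else u i); split; last first.
    move=> i; rewrite inE; case: eqP => [_ _|_ /= /us //].
    by exists q; rewrite /dl addrC subrK.
  rewrite bc.
  have dl1 : dl <= 1 by apply: ltW; apply: lt_le_trans dle _; rewrite ge_min lexx.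
  have : dl * (1 + `|b| + `|c|) < excess M r u.
    by rewrite -ltr_pdivlMr //; apply: lt_le_trans dle _; rewrite ge_min lexx orbT.
  have : - (dl * `|b|) <= dl * b by rewrite -mulrN ler_wpM2l ?(ltW dl0) // lerNl ler_normr lexx orbT.
  have : - (dl * `|c|) <= dl ^+ 2 * c.
    apply: (@le_trans _ _ (- (dl ^+ 2 * `|c|))).
      by rewrite lerN2 ler_wpM2r // expr2 ler_piMr // ltW.
    by rewrite -mulrN ler_wpM2l ?sqr_ge0 // lerNl ler_normr lexx orbT.
  have -> : dl * (1 + `|b| + `|c|) = dl + dl * `|b| + dl * `|c| by ring.
  by lra.
have [u [u0 us]] := key (enum 'I_n).
have /choice[q qE] : forall i, exists q : rat, u i = ratr q by move=> i; apply: us; rewrite mem_enum.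
exists [ffun i => q i]; rewrite (_ : (fun i => _) = u) //.
by apply/funext => i; rewrite ffunE qE.
Qed.

Lemma spec_norm_gtP M r : 0 <= r -> (r < spec_norm M) <->
  exists q : {ffun 'I_n -> rat}, 0 < excess M r (fun i => ratr (q i)).
Proof.
move=> r0; split.
  move=> /(sup_gt (spec_norm_has_sup M).1)[_ [x [x1 ->]]] rx.
  apply: (@excess_rational _ _ (x^~ 0)); rewrite /excess subr_gt0.
  have xn : sumsq (x^~ 0) <= 1.
    by move: x1; rewrite vnorm2E -[X in _ <= X]sqrtr1 ler_sqrt.
  apply: (@le_lt_trans _ _ (r ^+ 2)).
    by rewrite -[leRHS]mulr1 ler_wpM2l // sqr_ge0.
  rewrite -[ltRHS]sqr_sqrtr ?sumsq_ge0 // -vnorm2_mul.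
  by rewrite ltrXn2r // nnegrE ?sqrtr_ge0.
case=> q; rewrite /excess subr_gt0 => h; rewrite ltNge; apply/negP => sr.
move: h; apply/negP; rewrite -leNgt; apply: le_trans (sumsq_mapply_le _ _) _.
rewrite ler_wpM2r ?sumsq_ge0 //; apply: lerXn2r; rewrite ?nnegrE //.
exact: spec_norm_ge0.
Qed.

(** A supremum over a ball is an uncountable operation; [spec_norm_gtP] turns its superlevel sets
    into countable unions over rational vectors. *)
Lemma measurable_spec_norm (dT : measure_display) (T : measurableType dT) (M : T -> 'M[R]_n) :
  (forall i j, measurable_fun [set: T] (fun w => M w i j)) ->
  measurable_fun [set: T] (fun w => spec_norm (M w)).
Proof.
move=> mM; apply: (measurability _ (RGenOInfty.measurableE R)) => // _ [_ [r ->] <-].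
rewrite setTI.
have [r0|r0] := ltP r 0.
  rewrite (_ : _ @^-1` _ = setT) //; apply/seteqP; split => w //= _.
  by rewrite in_itv /= andbT (lt_le_trans r0) // spec_norm_ge0.
rewrite (_ : _ @^-1` _ = \bigcup_(q in [set: {ffun 'I_n -> rat}])
   [set w | 0 < excess (M w) r (fun i => ratr (q i))]); last first.
  apply/seteqP; split => w /=; rewrite in_itv /= andbT.
    by move=> /(spec_norm_gtP _ r0)[q hq]; exists q.
  by case=> q _ hq; apply/(spec_norm_gtP _ r0); exists q.
apply: countable_bigcupT_measurable => // q.
have mf : measurable_fun [set: T] (fun w => excess (M w) r (fun i => ratr (q i))).
  apply: measurable_funB => //; apply: measurable_sum => i; apply: measurable_funX.
  by apply: measurable_sum => j; apply: measurable_funM.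
rewrite (_ : [set w | _] = (fun w => excess (M w) r (fun i => ratr (q i))) @^-1` `]0, +oo[%classic).
  by rewrite -[X in measurable X]setTI; apply: mf.
by apply/seteqP; split => w /=; rewrite in_itv /= andbT.
Qed.

End SpectralNorm.

(** * The graphs *)

Section Graph.

(** Connection set of a circulant graph: [d./2] steps in each direction, and the antipodal step when
    [d] is odd. *)
Definition circ_step (r d s : nat) : bool :=
  (0 < s)%N && [|| (s <= d./2)%N, (r - d./2 <= s)%N | odd d && (s.*2 == r)].

Lemma card_ord_interval (r l u : nat) : (u <= r)%N -> #|[pred s : 'I_r | l <= s < u]%N| = (u - l)%N.
Proof.
move=> ur; have [ul|lu] := leqP u l.
  rewrite (eqP (ul : (u - l == 0)%N)); apply: eq_card0 => s; rewrite !inE.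
  by apply/negP => /andP[h1 h2]; have := leq_trans h2 ul; rewrite ltnNge h1.
have gP (k : 'I_(u - l)) : (l + k < r)%N.
  by apply: leq_trans ur; rewrite -ltn_subRL.
rewrite -[RHS]card_ord -(card_imset predT (f := fun k : 'I_(u - l) => Ordinal (gP k))).
  apply: eq_card => s; rewrite !inE; apply/andP/imsetP.
    move=> [ls su]; have ks : (s - l < u - l)%N by rewrite ltn_sub2r.
    by exists (Ordinal ks) => //; apply/val_inj; rewrite /= subnKC.
  by move=> [k _ ->] /=; rewrite leq_addr -ltn_subRL.
by move=> k k' [] /addnI /val_inj.
Qed.

Lemma card_circ_step (r d : nat) : (d < r)%N -> ~~ odd (r * d) ->
  #|[pred s : 'I_r | circ_step r d s]| = d.
Proof.
move=> dr odd_rd; set h := d./2.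
have dE : (odd d + h.*2 = d)%N by rewrite odd_double_half.
pose A := [pred s : 'I_r | 1 <= s < h.+1]%N.
pose B := [pred s : 'I_r | r - h <= s < r]%N.
pose C := [pred s : 'I_r | odd d && (s.*2 == r)].
have cA : #|A| = h by rewrite card_ord_interval ?subSS ?subn0 //; lia.
have cB : #|B| = h by rewrite card_ord_interval //; lia.
have cC : #|C| = odd d.
  have [od|od] := boolP (odd d); last by apply: eq_card0 => s; rewrite !inE (negbTE od).
  have re : ~~ odd r by move: odd_rd; rewrite oddM od andbT.
  have hr : (r./2 < r)%N by rewrite -divn2 ltn_Pdiv //; lia.
  rewrite (eq_card (B := pred1 (Ordinal hr))) ?card1 // => s; rewrite !inE od /=.
  apply/eqP/eqP => [sr|->]; last by rewrite /= even_halfK.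
  by apply/val_inj; rewrite /= -[LHS]doubleK sr.
rewrite -[RHS]dE -cC -[X in (_ + X.*2)%N]cA -addnn {2}cA -cB.
have dAB : #|[predI A & B]| = 0%N.
  by apply: eq_card0 => s; rewrite !inE /=; apply/negP => /andP[/andP[_ h1] /andP[h2 _]]; lia.
have dABC : #|[predI [predU A & B] & C]| = 0%N.
  apply: eq_card0 => s; rewrite !inE /=; apply/negP.
  by move=> /andP[/orP[/andP[_ h1]|/andP[h1 _]] /andP[od /eqP h2]]; lia.
rewrite addnC -cardUI dAB addn0 -cardUI dABC addn0.
apply: eq_card => s; rewrite !inE /circ_step -/h ltnS -orbA andb_orr.
case: (posnP s) => [->|s0] /=; last by rewrite (ltn_ord s) andbT.
have -> /= : (r - h <= 0)%N = false by apply/negbTE; lia.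
by rewrite double0 eq_sym (gtn_eqF (_ : 0 < r)%N) ?andbF //; lia.
Qed.

Context (n d : nat).
Local Notation D := d.+1.

(** One clique fewer than would fit, so that at least [d + 1] vertices remain, as a [d]-regular
    graph on them requires. *)
Definition clique_count : nat := (n %/ D).-1.
Local Notation c := (clique_count * D)%N.

Definition block_graph : rel 'I_n := fun i j =>
  if (i < c)%N && (j < c)%N then (i != j) && (i %/ D == j %/ D)%N
  else if (c <= i)%N && (c <= j)%N then circ_step (n - c) d ((j - c + (n - c) - (i - c)) %% (n - c))
  else false.

Lemma block_graph_irr i : block_graph i i = false.
Proof. by rewrite /block_graph eqxx /=; case: ifP => // _; case: ifP => // _; rewrite addKn modnn. Qed.

Hypotheses (Dn : (D <= n)%N) (even_nd : ~~ odd (n * d)).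

Lemma clique_bounds : (c + D <= n)%N.
Proof.
rewrite /clique_count addnC -mulSn prednK ?leq_trunc_div //.
by rewrite divn_gt0.
Qed.

Let r := (n - c)%N.
Let rD : (D <= r)%N. Proof. by rewrite leq_subRL ?clique_bounds // (leq_trans _ clique_bounds) // leq_addr. Qed.
Let rn : (c + r = n)%N. Proof. by rewrite subnKC // (leq_trans _ clique_bounds) // leq_addr. Qed.
Let r_gt0 : (0 < r)%N. Proof. exact: leq_trans rD. Qed.

(** The cliques account for a multiple of [d * (d + 1)], which is even, so the parity of [n * d]
    passes to the remaining vertices. *)
Let odd_rd : ~~ odd (r * d).
Proof.
move: even_nd; rewrite -rn mulnDl oddD !oddM /=.
by case: (odd d); rewrite ?andbF //= !andbT ?andbF addFb.
Qed.

Lemma circ_step_opp (a b : nat) : (a < r)%N -> (b < r)%N ->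
  circ_step r d ((b + r - a) %% r) = circ_step r d ((a + r - b) %% r).
Proof.
move=> ar br; rewrite /circ_step.
have aux x y : (x < r)%N -> (y < r)%N -> (x < y)%N -> ((y + r - x) %% r = y - x)%N /\ ((x + r - y) %% r = r - (y - x))%N.
  move=> xr yr xy; split.
    by rewrite addnC -addnBA ?(ltnW xy) // modnDl modn_small // (leq_ltn_trans (leq_subr _ _)).
  rewrite (_ : x + r - y = r - (y - x))%N; last lia.
  by rewrite modn_small; lia.
have sym s : (0 < s < r)%N -> [|| (s <= d./2)%N, (r - d./2 <= s)%N | odd d && (s.*2 == r)] =
   [|| (r - s <= d./2)%N, (r - d./2 <= r - s)%N | odd d && ((r - s).*2 == r)].
  move=> /andP[s0 sr]; have dr : (d < r)%N by exact: rD.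
  have h : (d./2 <= d)%N by lia.
  have -> : (r - s <= d./2)%N = (r - d./2 <= s)%N by lia.
  have -> : (r - d./2 <= r - s)%N = (s <= d./2)%N by lia.
  have -> : ((r - s).*2 == r) = (s.*2 == r) by lia.
  by rewrite orbCA.
have [ab|ba|->] := ltngtP a b; last by [].
  have [-> ->] := aux _ _ ar br ab.
  rewrite sym; last by rewrite subn_gt0 ab (leq_ltn_trans (leq_subr _ _)).
  by congr (_ && _); lia.
have [-> ->] := aux _ _ br ar ba.
rewrite [in RHS]sym; last by rewrite subn_gt0 ba (leq_ltn_trans (leq_subr _ _)).
by congr (_ && _); lia.
Qed.

Lemma block_graph_simple : simple_graph block_graph.
Proof.
split=> [i j|i]; last exact: block_graph_irr.
rewrite /block_graph (andbC (j < c)%N) (andbC (c <= j)%N) (eq_sym j) (eq_sym (j %/ D)%N).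
case: ifP => // _; case: ifP => // /andP[ci cj].
by apply: circ_step_opp; rewrite ltn_subLR // rn.
Qed.

Lemma block_graph_card (i : 'I_n) : #|block_graph i| = d.
Proof.
have [ic|ci] := ltnP i c.
  pose b := (i %/ D)%N.
  have bq : (b < clique_count)%N by rewrite ltn_divLR.
  have gP (k : 'I_D) : (b * D + k < n)%N.
    apply: leq_trans clique_bounds; rewrite -addnS leq_add // ?ltn_ord //.
    by rewrite leq_mul2r ltnW ?orbT.
  pose g k := Ordinal (gP k).
  have g_inj : injective g by move=> k k' /(congr1 val) /= /addnI /val_inj.
  have gi : exists k, g k = i.
    by exists (Ordinal (ltn_pmod i (ltn0Sn d))); apply/val_inj; rewrite /= -divn_eq.
  have : #|g @: [set: 'I_D]%SET| = D by rewrite card_imset // cardsT card_ord.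
  rewrite (cardsD1 i) (_ : i \in _); last by have [k <-] := gi; rewrite imset_f.
  rewrite add1n => -[E]; rewrite -[RHS]E -cardsE; apply: eq_card => j; rewrite !inE.
  rewrite unfold_in /block_graph ic /= (leqNgt c i) ic /=.
  apply/idP/andP.
    case: ifP => // jc /andP[ij /eqP bj]; rewrite eq_sym; split=> //.
    apply/imsetP; exists (Ordinal (ltn_pmod j (ltn0Sn d))); first by rewrite finset.in_setT.
    by apply/val_inj; rewrite /= /b bj -divn_eq.
  move=> [ji /imsetP[k _ jk]]; rewrite jk /=.
  have kD : (k < D)%N by [].
  have -> : (b * D + k < c)%N.
    by apply: leq_trans (_ : b.+1 * D <= _)%N; rewrite ?leq_mul2r ?bq ?orbT // mulSn addnC ltn_add2r.
  have -> : ((b * D + k) %/ D = b)%N by rewrite divnMDl // divn_small // addn0.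
  by rewrite eqxx andbT -jk eq_sym.
have gP (s : 'I_r) : (c + (i - c + s) %% r < n)%N.
  by rewrite -[X in (_ < X)%N]rn ltn_add2l ltn_pmod.
pose g s := Ordinal (gP s).
have ir : (i - c < r)%N by rewrite ltn_subLR // rn.
have gstep (s : 'I_r) : ((c + (i - c + s) %% r - c + r - (i - c)) %% r = s)%N.
  rewrite addKn -addnBA ?(ltnW ir) // modnDml addnAC subnKC ?(ltnW ir) //.
  by rewrite modnDl modn_small.
have g_inj : injective g.
  by move=> s s' E; apply/val_inj; rewrite /= -(gstep s) -(gstep s'); have /(congr1 val) /= -> := E.
rewrite -[RHS](card_circ_step rD odd_rd) -(card_imset _ g_inj) -[LHS]cardsE.
apply: eq_card => j; rewrite !inE unfold_in /block_graph ltnNge ci /=.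
apply/idP/imsetP.
  case: ifP => // cj h.
  exists (Ordinal (ltn_pmod (j - c + r - (i - c)) r_gt0)) => //.
  apply/val_inj => /=; rewrite modnDmr addnBA; last first.
    by rewrite (leq_trans (ltnW ir)) // leq_addl.
  rewrite addKn modnDr modn_small ?subnKC //.
  by rewrite ltn_subLR // rn.
by move=> [s hs ->]; rewrite /= leq_addr gstep.
Qed.

Lemma block_graph_regular : regular block_graph d.
Proof.
move=> i; rewrite -[RHS](block_graph_card i); apply: eq_card => j.
by apply/idP/idP; rewrite inE.
Qed.

Section Positions.
Context (N m : nat).
Hypothesis mN : (N * m <= D)%N.

Lemma offset_lt (x : 'I_N * 'I_m) : (x.1 * m + x.2 < D)%N.
Proof.
apply: leq_trans mN; apply: leq_trans (_ : x.1.+1 * m <= _)%N; last by rewrite leq_mul2r ltn_ord orbT.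
by rewrite mulSn addnC ltn_add2r.
Qed.

Lemma pos_subproof (b : 'I_clique_count) (x : 'I_N * 'I_m) : (b * D + (x.1 * m + x.2) < n)%N.
Proof.
have h := offset_lt x; apply: leq_trans clique_bounds; rewrite -addnS leq_add //.
by rewrite leq_mul2r ltnW ?orbT.
Qed.

(** Each part is a run of [m] consecutive vertices; the last [D - N * m] vertices of the clique
    belong to no part. *)
Definition pos b x : 'I_n := Ordinal (pos_subproof b x).

Lemma pos_div b x : (pos b x %/ D = b)%N.
Proof. by rewrite /= divnMDl // divn_small ?addn0 // offset_lt. Qed.

Lemma pos_inj b b' x x' : pos b x = pos b' x' -> b = b' /\ x = x'.
Proof.
move=> E; have bb : b = b' by apply/val_inj; rewrite /= -(pos_div b x) -(pos_div b' x') E.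
split=> //; move: E => /(congr1 val) /=; rewrite bb => /addnI E.
case: x x' E => [i a] [i' a'] /= E.
have m0 : (0 < m)%N by exact: leq_ltn_trans (ltn_ord a).
have ii : i = i'.
  by apply/val_inj; have := congr1 (divn^~ m) E; rewrite !divnMDl // !divn_small // !addn0.
by rewrite ii in E *; congr pair; apply/val_inj; move/addnI: E.
Qed.

Lemma block_graph_pos b x y : block_graph (pos b x) (pos b y) = (x != y).
Proof.
have lt z : (pos b z < c)%N by rewrite -ltn_divLR // pos_div.
rewrite /block_graph !lt /= [X in _ && X](_ : _ = true) ?andbT; last first.
  by have := pos_div b x; have := pos_div b y => /= -> ->; rewrite eqxx.
by congr (~~ _); apply/eqP/eqP => [/pos_inj[]|->].
Qed.

End Positions.
End Graph.

(** * The tail bound and Borel-Cantelli *)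

Section Numerics.
Context (R : realType).

(* With [z = sqrt n], the [q >= n / D - 2] trials give [(1 - g) ^ q <= exp (2 - z)],
   and [exp z >= z ^ 4 / 24]. *)
Lemma tail_bound (n D q : nat) (g y : R) : (0 < n)%N -> 1 <= y -> D%:R <= y -> y ^+ 4 <= n%:R ->
  y^-1 <= g -> g <= 1 -> (n <= (q + 2) * D)%N ->
  (1 - g) ^+ q <= 24 * expR 2 / n%:R ^+ 2.
Proof.
move=> n0 y1 Dy yn yg g1 nqD.
have y0 : 0 < y by lra.
have nR0 : 0 < n%:R :> R by rewrite ltr0n.
pose z : R := Num.sqrt n%:R.
have z2 : z ^+ 2 = n%:R by rewrite sqr_sqrtr // ltW.
have z0 : 0 < z by rewrite sqrtr_gt0.
have yz : y ^+ 2 <= z.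
  by rewrite -(ler_pXn2r (n := 2)) ?nnegrE ?sqr_ge0 ?(ltW z0) // -exprM z2.
have nqR : n%:R <= (q%:R + 2) * y.
  apply: (@le_trans _ _ ((q + 2) * D)%:R); first by rewrite ler_nat.
  by rewrite natrM natrD ler_wpM2l // addr_ge0.
have zq : z - 2 <= q%:R * g.
  apply: (@le_trans _ _ (q%:R * y^-1)); last by rewrite ler_wpM2l.
  rewrite ler_pdivlMr // -(ler_pM2r y0).
  have h1 : z * y ^+ 2 <= z ^+ 2 by rewrite expr2 ler_pM2l.
  have h2 : y <= y * y by rewrite ler_peMr // ltW.
  have -> : (z - 2) * y * y = z * y ^+ 2 - 2 * (y * y) by ring.
  by move: nqR; rewrite -z2 mulrDl; lra.
apply: (@le_trans _ _ (expR (- g) ^+ q)).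
  by apply: lerXn2r; rewrite ?nnegrE ?expR_ge0 ?subr_ge0 // expR_ge1Dx.
rewrite -expRM_natl mulrN; apply: (@le_trans _ _ (expR (2 - z))).
  by rewrite ler_expR lerNl opprB.
have h : z ^+ 4 <= 24 * expR z.
  rewrite mulrC -ler_pdivrMr //; apply: le_trans (expR_ge1Dxn 3 (ltW z0)).
  by rewrite lerDr.
rewrite expRD expRN -z2 -exprM ler_pdivlMr ?exprn_gt0 //.
have -> : expR 2 / expR z * z ^+ (2 * 2) = expR 2 * (z ^+ 4 / expR z) by ring.
by rewrite (mulrC 24) ler_pM2l ?expR_gt0 // ler_pdivrMr ?expR_gt0.
Qed.

Lemma one_sub_pow_ge (x : R) (k : nat) : 0 <= x -> x <= 1 / 2 -> expR (- (2 * x * k%:R)) <= (1 - x) ^+ k.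
Proof.
move=> x0 x2; have x1 : 0 < 1 - x by lra.
rewrite -mulNr mulrC expRM_natl; apply: lerXn2r; rewrite ?nnegrE ?expR_ge0 ?(ltW x1) //.
rewrite expRN -[leRHS]invrK lef_pV2 ?posrE ?expR_gt0 ?invr_gt0 //.
apply: le_trans (expR_ge1Dx _); rewrite -[leLHS]mul1r ler_pdivrMr //.
have : 0 <= x * (1 - 2 * x) by apply: mulr_ge0; lra.
have -> : (1 + 2 * x) * (1 - x) = 1 + x * (1 - 2 * x) by ring.
by lra.
Qed.

Lemma sum_pullback (n : nat) (X : finType) (io : X -> 'I_n) (h : 'I_n -> R) :
  (forall i, i \notin codom io -> h i = 0) -> injective io -> \sum_i h i = \sum_x h (io x).
Proof.
move=> h0 inj.
transitivity (\sum_i \sum_(x | io x == i) h i).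
  apply: eq_bigr => i _; have [/codomP[x ix]|ni] := boolP (i \in codom io); last first.
    by rewrite h0 // big1.
  by rewrite (big_pred1 x) // => x'; rewrite ix /= (inj_eq inj).
rewrite (exchange_big_dep predT) //=; apply: eq_bigr => x _.
by rewrite (big_pred1 (io x)) // => i; rewrite /= eq_sym.
Qed.

End Numerics.

Section GoodBlock.
Context (R : realType) (dT : measure_display) (T : measurableType dT) (n N m q : nat) (W : T -> 'M[R]_n) (G : rel 'I_n).
Local Notation X := ('I_N * 'I_m)%type.
Context (pos : 'I_q -> X -> 'I_n).
Hypothesis pos_inj : forall b b' x x', pos b x = pos b' x' -> b = b' /\ x = x'.
Hypothesis G_pos : forall b x y, G (pos b x) (pos b y) = (x != y).
Hypothesis W_sym : forall w, (W w)^T = W w.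
Context (V : finType) (v0 : V) (idx : R -> V) (val : V -> R) (s eps tol : R).
Hypotheses (s_gt0 : 0 < s) (X_le : (N * m)%:R <= 2 * s ^+ 2).
Hypothesis tol_ge0 : 0 <= tol.
Hypothesis dist : forall x, idx x != v0 -> `|x - val (idx x)| * s <= tol.

(** The witness [u], extended by 0 outside the block, is a test vector for the true entries. An
    error [tol / s] per entry changes the form by at most [tol / s * (N * m)] times the squared
    norm, hence by [2 * tol] after normalization. *)
Lemma good_spec_norm b w : 2 * tol <= eps ->
  good pos v0 val ((2 + eps) * s) b (pattern W v0 idx w) ->
  2 + (eps - 2 * tol) <= spec_norm (s^-1 *: hadamard (adjmx R G) (W w)).
Proof.
move=> te /andP[/asboolP[u hu] /fintype.forallP ok].
have inj : injective (pos b) by move=> x y /pos_inj[].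
have Wt i j : W w i j = W w j i by rewrite -[in LHS](W_sym w) mxE.
pose v (i : 'I_n) : R := if [pick x | pos b x == i] is Some x then u x else 0.
have vpos x : v (pos b x) = u x.
  rewrite /v; case: pickP => [y /eqP /inj -> //|/(_ x)]; by rewrite eqxx.
have v_off i : i \notin codom (pos b) -> v i = 0.
  by rewrite /v; case: pickP => // x /eqP <-; rewrite codom_f.
have vsq : sumsq v = \sum_x u x ^+ 2.
  rewrite /sumsq (sum_pullback (io := pos b)) //; first by apply: eq_bigr => x _; rewrite vpos.
  by move=> i /v_off ->; rewrite expr0n.
apply: (@spec_norm_ge_form _ _ _ v); first by lra.
set M := _ *: _.
have -> : \sum_i \sum_j M i j * (v i * v j) =
    s^-1 * \sum_x \sum_(y | y != x) W w (pos b x) (pos b y) * (u x * u y).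
  rewrite (sum_pullback (io := pos b)) //; last first.
    by move=> i /v_off vi; rewrite big1 // => j _; rewrite vi mul0r mulr0.
  rewrite mulr_sumr; apply: eq_bigr => x _.
  rewrite (sum_pullback (io := pos b)) //; last by move=> j /v_off ->; rewrite !mulr0.
  rewrite mulr_sumr [in RHS]big_mkcond /=; apply: eq_bigr => y _.
  rewrite !mxE G_pos !vpos eq_sym.
  by case: eqP => _ /=; rewrite ?(mul0r, mulr0) ?mul1r ?mulrA.
have diff x y : y != x -> `|W w (pos b x) (pos b y) - val (pattern W v0 idx w (pair_of pos b x y))| <= tol / s.
  move=> yx; have xy : x != y by rewrite eq_sym.
  have := ok x => /fintype.forallP/(_ y); rewrite xy /=.
  have up := pair_of_upper pos_inj b xy.
  rewrite ffunE up ler_pdivlMr //.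
  have -> : W w (pos b x) (pos b y) = W w (pair_of pos b x y).1 (pair_of pos b x y).2.
    by rewrite /pair_of; case: ifP.
  exact: dist.
have low : qform val (pair_of pos b) (pattern W v0 idx w) u - tol / s * ((N * m)%:R * \sum_x u x ^+ 2) <=
    \sum_x \sum_(y | y != x) W w (pos b x) (pos b y) * (u x * u y).
  rewrite lerBlDr /qform.
  have half : \sum_x \sum_y (tol / s) * ((u x ^+ 2 + u y ^+ 2) / 2) = tol / s * ((N * m)%:R * \sum_x u x ^+ 2).
    transitivity (tol / s / 2 * (\sum_(x : X) \sum_(y : X) (u x ^+ 2 + u y ^+ 2))).
      by rewrite mulr_sumr; apply: eq_bigr => x _; rewrite mulr_sumr; apply: eq_bigr => y _; field; rewrite gt_eqF.
    rewrite (eq_bigr (fun x => (N * m)%:R * u x ^+ 2 + \sum_y u y ^+ 2)); last first.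
      by move=> x _; rewrite big_split /= sumr_const card_prod !card_ord mulr_natl.
    rewrite big_split /= -mulr_sumr sumr_const card_prod !card_ord -(mulr_natl (\sum_y _)).
    by field; rewrite gt_eqF.
  rewrite -half -big_split; apply: ler_sum => x _ /=.
  rewrite [X in _ + X](bigID (fun y => y != x)) /= addrA.
  apply: (@le_trans _ _ (\sum_(y | y != x) W w (pos b x) (pos b y) * (u x * u y) +
      \sum_(y | y != x) (tol / s) * ((u x ^+ 2 + u y ^+ 2) / 2))); last first.
    rewrite lerDl; apply: sumr_ge0 => y _; rewrite mulr_ge0 ?divr_ge0 ?(ltW s_gt0) //.
    by rewrite addr_ge0 ?sqr_ge0.
  rewrite -big_split; apply: ler_sum => y yx /=; rewrite -lerBlDl -mulrBl.
  have ts : 0 <= tol / s by rewrite divr_ge0 // ltW.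
  have uu : `|u x * u y| <= (u x ^+ 2 + u y ^+ 2) / 2.
    rewrite normrM; have := sqr_ge0 (`|u x| - `|u y|).
    rewrite sqrrB !real_normK ?num_real // -mulr_natl; lra.
  apply: le_trans (ler_norm _) _; rewrite normrM; apply: ler_pM => //.
  by rewrite distrC; exact: diff.
rewrite [ltRHS]mulrC ltr_pdivlMr //; apply: lt_le_trans low.
rewrite vsq; set U := \sum_x u x ^+ 2 in hu *.
have U0 : 0 <= U by apply: sumr_ge0 => x _; exact: sqr_ge0.
apply: (@le_lt_trans _ _ ((2 + eps) * s * U - tol / s * ((N * m)%:R * U))); last by rewrite ltrD2r.
have h : tol / s * ((N * m)%:R * U) <= 2 * tol * s * U.
  have -> : 2 * tol * s * U = tol / s * (2 * s ^+ 2 * U) by field; rewrite gt_eqF.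
  by rewrite ler_wpM2l ?divr_ge0 ?(ltW s_gt0) // ler_wpM2r.
have -> : (2 + (eps - 2 * tol)) * U * s = (2 + eps) * s * U - 2 * tol * s * U by ring.
by rewrite lerD2l lerN2.
Qed.

End GoodBlock.

(** There are [O(d ^ 2)] entries and each survives with probability [1 - O(d ^ -2)], so the power
    stays above the constant [exp (- 8 a)], and for large [d] above the stated exponential. *)
Lemma pow_retention (R : realType) (K kappa r : R) : 0 <= K -> 0 < kappa -> 0 < r ->
  exists d0 : nat, forall d : nat, (d0 <= d)%N -> forall (k : nat) (pi : R),
  (k <= (2 * d) ^ 2)%N -> 1 - 16 * K / kappa ^+ 4 / d%:R ^+ 2 <= pi ->
  expR (- (r ^+ 2 * d%:R)) <= pi ^+ k.
Proof.
move=> K0 k0 r0; pose a := 16 * K / kappa ^+ 4.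
have a0 : 0 <= a by rewrite divr_ge0 ?mulr_ge0 ?exprn_ge0 // ltW.
have [n1 H1] := nat_above (2 * a + 1).
have [n2 H2] := nat_above (8 * a / r ^+ 2).
exists (maxn n1 n2) => d; rewrite geq_max => /andP[/H1 h1 /H2 h2] k pi kd.
rewrite -/a => pid.
have d0 : 0 < d%:R :> R by lra.
pose x := a / d%:R ^+ 2.
have x0 : 0 <= x by rewrite divr_ge0 ?exprn_ge0 // ltW.
have x2 : x <= 1 / 2.
  rewrite ler_pdivrMr ?exprn_gt0 //.
  have : d%:R <= d%:R ^+ 2 :> R by rewrite expr2 ler_peMr; lra.
  by lra.
apply: (@le_trans _ _ ((1 - x) ^+ k)); last first.
  by move: pid; rewrite -/x => pid; apply: lerXn2r; rewrite ?nnegrE //; lra.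
apply: le_trans (one_sub_pow_ge k x0 x2).
rewrite ler_expR lerN2; apply: (@le_trans _ _ (2 * x * (4 * d%:R ^+ 2))).
  apply: ler_wpM2l; first by lra.
  move: kd; rewrite -(ler_nat R) natrX natrM exprMn.
  by move=> kd; lra.
have -> : 2 * x * (4 * d%:R ^+ 2) = 8 * a by rewrite /x; field; rewrite gt_eqF.
by rewrite [leRHS]mulrC -ler_pdivrMr ?exprn_gt0.
Qed.

Section BlockTail.
Context (dT : measure_display) (T : measurableType dT) (R : realType) (P : probability T R).
Context (xi : T -> R).
Hypotheses (xi_meas : measurable_fun setT xi)
  (xi_4 : ('E_P[fun w => (xi w ^+ 4)%R] < +oo)%E)
  (xi_mean : ('E_P[xi] = 0)%E) (xi_var : ('V_P[xi] = 1)%E).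

Lemma block_graph_tail (C : R) : 0 < C ->
  exists (eps : R) (d0 : nat), 0 < eps /\ forall (n d : nat) (W : T -> 'M[R]_n),
  (forall w, (W w)^T = W w) ->
  (forall i j : 'I_n, (i < j)%N -> measurable_fun setT (fun w => W w i j)) ->
  (forall i j : 'I_n, (i < j)%N -> same_law P (fun w => W w i j) xi) ->
  mutually_independent P (finset (fun ij : 'I_n * 'I_n => (ij.1 < ij.2)%N))
    (fun ij w => W w ij.1 ij.2) ->
  (d0 <= d)%N -> d%:R <= C * ln n%:R -> ~~ odd (n * d) ->
  (d < n)%N /\ exists F : set T, [/\ measurable F,
    (P F <= (24 * expR 2 / n%:R ^+ 2)%:E)%E &
    forall w, ~ F w ->
      2 + eps <= spec_norm ((Num.sqrt d%:R)^-1 *: hadamard (adjmx R (@block_graph n d)) (W w))].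
Proof.
move=> C0.
(* With this rate, [d <= C * ln n] gives [exp (2 r ^ 2 d) <= n ^ (1/4)]. One factor
   [exp (- r ^ 2 d)] is spent on the large deviation, another on truncation. *)
pose r : R := Num.sqrt (8 * C)^-1.
have C8 : 0 < (8 * C)^-1 by rewrite invr_gt0; lra.
have r0 : 0 < r by rewrite sqrtr_gt0.
have r2 : 8 * r ^+ 2 * C = 1 by rewrite sqr_sqrtr ?(ltW C8) //; field; rewrite gt_eqF.
have K0 := moment4_ge0 P xi.
have K4 : 12 <= K4_of P xi by rewrite /K4_of; lra.
have [N [eps [kappa [eta [d1 [N0 eps0 kappa0 eta0 big]]]]]] := block_large_deviation K4 r0.
(* Rounding costs [2 * tol], so half of [eps] is left. *)
have tol0 : 0 < eps / 4 by lra.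
have [d2 disc] := discretization xi_meas xi_4 xi_mean xi_var kappa0 eta0 tol0.
have [d3 ret] := pow_retention K0 kappa0 r0.
have rr0 : 0 < 2 * r ^+ 2 by rewrite mulr_gt0 ?exprn_gt0.
have [d4 dom] := expR_dominates_pow 2 1 rr0.
exists (eps / 2), (maxn (maxn d1 d2) (maxn d3 (maxn d4 1))); split; first by lra.
move=> n d W W_sym W_meas W_law W_indep; rewrite !geq_max.
move=> /andP[/andP[dd1 dd2] /andP[dd3 /andP[dd4 dgt0]]] dlog ev.
have dR1 : 1 <= d%:R :> R by rewrite ler1n.
pose y : R := expR (2 * r ^+ 2 * d%:R).
have n0 : (0 < n)%N.
  by case: (n) dlog => // ; rewrite ln0 // mulr0 => h; lra.
have nR0 : 0 < n%:R :> R by rewrite ltr0n.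
have yn : y ^+ 4 <= n%:R.
  rewrite -expRM_natl -[leRHS]lnK ?posrE // ler_expR.
  have -> : 4 * (2 * r ^+ 2 * d%:R) = 8 * r ^+ 2 * d%:R by ring.
  apply: (@le_trans _ _ (8 * r ^+ 2 * (C * ln n%:R))); last by rewrite mulrA r2 mul1r.
  by rewrite ler_wpM2l // mulr_ge0 ?sqr_ge0.
have dy : 2 * d%:R <= y by have := dom d dd4; rewrite expr1.
have Dy : d.+1%:R <= y by rewrite -natr1; lra.
have y1 : 1 <= y by lra.
have Dn : (d.+1 <= n)%N.
  rewrite -(ler_nat R); apply: le_trans Dy _; apply: le_trans yn.
  exact: ler_eXnr.
split=> //.
have [V [v0 [idx [p [val [s2 [pi [[midx p_ge0 p_sum] [m1 m2 m4] [s2_ge s2_le val_le]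
  [p_v0 pi_p pi_ge pi_le1] dist]]]]]]]] := disc d dd2.
pose m := (d.+1 %/ N)%N.
have mN : (N * m <= d.+1)%N by rewrite mulnC leq_trunc_div.
have NR : (N * m)%:R <= 2 * d%:R :> R.
  apply: (@le_trans _ _ d.+1%:R); first by rewrite ler_nat.
  by rewrite -natr1; lra.
have pi_ge0 : 0 <= pi.
  have h : expR (- (r ^+ 2 * d%:R)) <= pi ^+ 1.
    by apply: (ret d dd3 1%N pi) => //; rewrite expn_gt0 muln_gt0 dgt0.
  by apply: ltW; apply: lt_le_trans h; exact: expR_gt0.
have inj := @pos_inj n d Dn N m mN.
have phat_ge0 v : 0 <= idx_law P xi idx v by exact: fine_ge0.
have phat_sum : \sum_v idx_law P xi idx v = 1 by exact: fiber_prob_sum.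
pose g0 : R := expR (- (r ^+ 2 * d%:R)).
have hv b : g0 <= Ex (upper_law v0 p)
    (fun o => (heavy (pos Dn mN) val ((2 + eps) * Num.sqrt d%:R) b o)%:R).
  apply: (big d dd1 _ _ _ _ _ s2) => //.
  - exact: law_upper_law.
  - exact: pair_of_sym.
  - move=> x z x' z'; exact: pair_of_inj.
  - by move=> x z xz; rewrite /standard /upper_law pair_of_upper.
have bound := Ex_no_good inj p_ge0 p_sum phat_ge0 phat_sum p_v0 pi_ge0 pi_le1 pi_p (expR_ge0 _) hv.
have [mF PF] := pattern_prob_le xi_meas W_meas W_law W_indep v0 midx
  (fun o => [forall b, ~~ good (pos Dn mN) v0 val ((2 + eps) * Num.sqrt d%:R) b o]).
exists [set w | [forall b, ~~ good (pos Dn mN) v0 val ((2 + eps) * Num.sqrt d%:R) b (pattern W v0 idx w)]].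
split=> //.
  apply: le_trans PF _; rewrite lee_fin; apply: le_trans bound _.
  have g_ge : g0 <= pi ^+ ((N * m) ^ 2).
    apply: (ret d dd3) => //; rewrite leq_sqr; apply: (leq_trans mN).
    by rewrite mul2n -addnn -add1n leq_add2r.
  apply: (@tail_bound _ n d.+1 _ _ y) => //.
  - rewrite /y -expRN (_ : - _ = - (r ^+ 2 * d%:R) + - (r ^+ 2 * d%:R)); last by ring.
    by rewrite expRD; apply: ler_pM => //; exact: expR_ge0.
  - rewrite -[leRHS]mulr1; apply: ler_pM; rewrite ?exprn_ge0 ?expR_ge0 ?exprn_ile1 //.
    by rewrite -expR0 ler_expR oppr_le0 mulr_ge0 ?sqr_ge0.
  - have h1 : (0 < n %/ d.+1)%N by rewrite divn_gt0.
    by rewrite /clique_count addn2 prednK // ltnW // ltn_ceil.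
move=> w /negP; rewrite negb_forall => /fintype.existsP[b]; rewrite negbK => hb.
have -> : eps / 2 = eps - 2 * (eps / 4) by field.
apply: (good_spec_norm inj _ _ _ _ _ dist _ hb) => //.
- move=> b' x z; exact: block_graph_pos.
- by rewrite sqrtr_gt0 ltr0n.
- by rewrite sqr_sqrtr.
- exact: ltW.
- by lra.
Qed.

End BlockTail.

(** For [k >= 2] the terms telescope through [1 / k ^ 2 <= 1 / (k - 1) - 1 / k]; the term [k = 0] is
    0, as the inverse of 0 is 0. *)
Lemma sum_inv_sqr_le (R : realType) (c : R) n : 0 <= c ->
  \sum_(0 <= k < n) c / k%:R ^+ 2 <= 2 * c.
Proof.
move=> c0; rewrite -mulr_sumr mulrC ler_wpM2r //.
case: n => [|[|n]]; [by rewrite big_geq | by rewrite big_nat1 expr0n /= invr0 |].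
suff : \sum_(0 <= k < n.+2) (k%:R ^+ 2)^-1 <= 2 - n.+1%:R^-1 :> R.
  by move=> h; apply: le_trans h _; rewrite gerBl invr_ge0.
elim: n => [|n IH].
  by rewrite big_nat_recr // big_nat1 /= expr0n /= invr0 expr1n invr1; lra.
rewrite big_nat_recr //=; apply: le_trans (lerD IH (lexx _)) _.
set x : R := n.+1%:R; have x0 : 0 < x by rewrite ltr0n.
have -> : n.+2%:R = x + 1 :> R by rewrite natr1.
rewrite -subr_ge0.
have -> : 2 - (x + 1)^-1 - (2 - x^-1 + ((x + 1) ^+ 2)^-1) = (x * (x + 1) ^+ 2)^-1.
  by field; rewrite !gt_eqF // addr_gt0.
by rewrite invr_ge0 mulr_ge0 ?exprn_ge0 // ltW // addr_gt0.
Qed.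

Lemma measurable_limn_einf_gt (dT : measure_display) (T : measurableType dT) (R : realType)
    (f : nat -> T -> R) (a : \bar R) : (forall n, measurable_fun setT (f n)) ->
  measurable [set w | (a < limn_einf (fun n => (f n w)%:E))%E].
Proof.
move=> mf.
have m : measurable_fun setT (fun w => limn_esup (fun n => (- (f n w)%:E)%E)).
  apply: measurable_fun_limn_esup => n; apply/measurable_EFinP.
  exact: measurableT_comp.
rewrite (_ : [set w | _] =
    setT `&` (fun w => limn_esup (fun n => (- (f n w)%:E)%E)) @^-1` `]-oo, (- a)%E[%classic).
  by apply: m => //; exact: emeasurable_itv.
by rewrite setTI; apply/seteqP; split => w /=; rewrite in_itv /= /limn_einf lteNr.
Qed.

(** By Borel-Cantelli almost every [w] lies in only finitely many [F n]. The gap between [a] and [b]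
    keeps the inequality strict in the limit. *)
Lemma limn_einf_gt_ae (dT : measure_display) (T : measurableType dT) (R : realType)
    (P : probability T R) (f : nat -> T -> R) (F : nat -> set T) (a b c : R) (n0 : nat) :
  (forall n, measurable_fun setT (f n)) -> (forall n, measurable (F n)) -> 0 <= c ->
  (forall n, P (F n) <= (c / n%:R ^+ 2)%:E)%E -> a < b ->
  (forall n w, (n0 <= n)%N -> ~ F n w -> b <= f n w) ->
  P [set w | (a%:E < limn_einf (fun n => (f n w)%:E))%E] = 1%E.
Proof.
move=> mf mF c0 PF ab fb; set A := [set w | _].
have mA : measurable A by exact: measurable_limn_einf_gt.
have P0 : P (lim_sup_set F) = 0%E.
  apply: lim_sup_set_cvg0 => //; apply: (@le_lt_trans _ _ (2 * c)%:E); last exact: ltry.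
  apply: lime_le; first by apply: is_cvg_nneseries.
  near=> n; apply: le_trans (_ : (\sum_(0 <= k < n) (c / k%:R ^+ 2)%:E <= _)%E).
    by apply: lee_sum => k _; exact: PF.
  by rewrite sumEFin lee_fin sum_inv_sqr_le.
have mL : measurable (lim_sup_set F).
  by apply: bigcapT_measurable => n; apply: bigcup_measurable => k _; exact: mF.
have LA : ~` lim_sup_set F `<=` A.
  move=> w; rewrite /lim_sup_set setC_bigcap => -[n _]; rewrite setC_bigcup => nF.
  rewrite /A /= limn_einf_lim; apply: (@lt_le_trans _ _ b%:E); first by rewrite lte_fin.
  apply: lime_ge; first exact: is_cvg_einfs.
  near=> m; apply: le_ereal_inf_tmp => _ [k /= mk <-]; rewrite lee_fin; apply: fb.
    by apply: leq_trans mk; near: m; exact: nbhs_infty_ge.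
  by apply: nF => /=; apply: leq_trans mk; near: m; exact: nbhs_infty_ge.
apply/eqP; rewrite eq_le probability_le1 //=.
have -> : 1%E = P (~` lim_sup_set F) by rewrite probability_setC // P0 sube0.
by apply: le_measure => //; rewrite inE //; exact: measurableC.
Unshelve. all: by end_near.
Qed.

Theorem theorem1p3
  (dT : measure_display) (T : measurableType dT) (R : realType)
  (P : probability T R)
  (xi : T -> R)
  (W : forall n : nat, T -> 'M[R]_n)
  (d : nat -> nat)
  (* xi: centered, unit variance, finite fourth moment *)
  (xi_meas : measurable_fun setT xi)
  (xi_4 : ('E_P[fun w => (xi w ^+ 4)%R] < +oo)%E)
  (xi_mean : ('E_P[xi] = 0)%E)
  (xi_var : ('V_P[xi] = 1)%E)
  (* W n: symmetric, off-diagonal upper entries iid copies of xi *)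
  (W_sym : forall n w, (W n w)^T = W n w)
  (W_meas : forall n (i j : 'I_n), (i < j)%N ->
     measurable_fun setT (fun w => W n w i j))
  (W_law : forall n (i j : 'I_n), (i < j)%N ->
     same_law P (fun w => W n w i j) xi)
  (W_indep : forall n, mutually_independent P
     (finset (fun ij : 'I_n * 'I_n => (ij.1 < ij.2)%N))
     (fun ij w => W n w ij.1 ij.2))
  (* d = d(n): positive, O(log n), tends to infinity, n d(n) even *)
  (d_pos : forall n, (0 < d n)%N)
  (d_log : exists C : R, exists N : nat, forall n, (N <= n)%N ->
     (d n)%:R <= C * ln n%:R)
  (d_inf : forall M : nat, exists N : nat, forall n, (N <= n)%N -> (M <= d n)%N)
  (d_even : forall n, ~~ odd (n * d n)) :
  exists E : forall n : nat, rel 'I_n,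
    (exists N : nat, forall n, (N <= n)%N ->
       simple_graph (E n) /\ regular (E n) (d n)) /\
    P [set w | (2%:E < limn_einf (fun n =>
        (spec_norm ((Num.sqrt (d n)%:R)^-1 *: hadamard (adjmx R (E n)) (W n w)))%:E))%E]
    = 1%E.
Proof.
have [C [N1 dC]] := d_log.
(* Enlarging [C] preserves the bound only where [ln n >= 0], hence the 1 in [n0]. *)
have C1 : 0 < Num.max C 1 by rewrite lt_max ltr01 orbT.
have [eps [d0 [eps0 tail]]] := block_graph_tail xi_meas xi_4 xi_mean xi_var C1.
have [N2 dN2] := d_inf d0.
pose n0 := maxn N1 (maxn N2 1).
have tail_n n (nn : (n0 <= n)%N) := tail n (d n) (W n) (W_sym n) (W_meas n) (W_law n) (W_indep n).
have large n : (n0 <= n)%N -> (d0 <= d n)%N /\ (d n)%:R <= Num.max C 1 * ln n%:R.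
  rewrite !geq_max => /andP[nN1 /andP[nN2 n1]]; split; first exact: dN2.
  apply: le_trans (dC n nN1) _; rewrite ler_wpM2r ?le_max ?lexx //.
  by rewrite ln_ge0 // ler1n.
exists (fun n => @block_graph n (d n)); split.
  exists n0 => n nn; have [h1 h2] := large n nn.
  have [dn _] := tail_n n nn h1 h2 (d_even n).
  by split; [exact: block_graph_simple | exact: block_graph_regular].
have c0 : 0 <= 24 * expR 2 :> R by rewrite mulr_ge0 ?expR_ge0.
(* Below [n0] the failure set is empty; at [n = 0] this is forced up to a null set, the bound there
   being 0. *)
have /choice[F hF] : forall n, exists F : set T, [/\ measurable F,
    (P F <= (24 * expR 2 / n%:R ^+ 2)%:E)%E & (n0 <= n)%N -> forall w, ~ F w ->
      2 + eps <= spec_norm ((Num.sqrt (d n)%:R)^-1 *: hadamard (adjmx R (@block_graph n (d n))) (W n w))].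
  move=> n; have [nn|nn] := leqP n0 n.
    have [h1 h2] := large n nn.
    by have [_ [F [mF PF Fw]]] := tail_n n nn h1 h2 (d_even n); exists F.
  exists set0; split=> //.
    by rewrite measure0 lee_fin divr_ge0 // exprn_ge0.
apply: (@limn_einf_gt_ae _ _ _ _ _ F 2 (2 + eps) (24 * expR 2) n0) => //.
- move=> n; apply: measurable_spec_norm => i j.
  rewrite (_ : (fun w => _) = (fun w => (Num.sqrt (d n)%:R)^-1 * (block_graph (d n) i j)%:R * W n w i j)); last first.
    by apply/funext => w; rewrite !mxE mulrA.
  have [ij|ji|ij] := ltngtP i j.
  + by apply: measurable_funM => //; exact: W_meas.
  + apply: measurable_funM => //.
    rewrite (_ : (fun w => _) = (fun w => W n w j i)); first exact: W_meas.
    by apply/funext => w; rewrite -[in LHS](W_sym n w) mxE.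
  (* [W_meas] concerns entries above the diagonal; on the diagonal the graph has no edge, so the
     product is constantly 0. *)
  + rewrite (val_inj ij) block_graph_irr mulr0 (_ : (fun w => _) = cst 0) //.
    by apply/funext => w; rewrite mul0r.
- by move=> n; have [] := hF n.
- by move=> n; have [] := hF n.
- by rewrite ltrDl.
- by move=> n w nn; have [_ _ h] := hF n; exact: h.
Qed.
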